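(* Under the standing assumptions in the context, on an enlarged probability space there exists a sequence of random times $(\tau_n)_{n\in\mathbb N}$ with $\tau_1=\tau$ such that, setting $S_n=\sum_{i=1}^n\tau_i$, under $\mathbb P$ the sequence $$\Big(\tau_{n+1},\ (X_{S_n+s}-X_{S_n})_{0\le s\le\tau_{n+1}}\Big)_{n\in\mathbb N}$$ is i.i.d., independent of $(\tau,(X_s)_{0\le s\le\tau})$, and each of its terms is distributed as $(\tau,(X_s)_{0\le s\le\tau})$ under $\mathbb P^{\angle}$.
   Context: Model: fix $q\in(0,1)$, $p_\circ,p_\bullet\in[0,1]$, $v_\circ=2p_\circ-1$, $v_\bullet=2p_\bullet-1$. Under $\mathbb P^\rho$: $\omega$ is a Poisson point process of intensity $\rho\sum_xP_x$ on the set $W$ of two-sided paths $w:\mathbb Z\to\mathbb Z$ with $|w(n+1)-w(n)|\le1$, where $P_x$ is the law of a two-sided lazy simple random walk (steps $-1,0,1$ with probabilities $\frac{1-q}2,q,\frac{1-q}2$) with $w(0)=x$; independently $(U_y)_{y\in\mathbb Z^2}$ are i.i.d. uniform $[0,1]$. $\mathcal T=\{(w(n),n): w\in\omega, n\in\mathbb Z\}$. For $y\in\mathbb Z^2$, $Y^y_0=y$, $Y^y_{i+1}=Y^y_i+(1,1)$ if ($Y^y_i\in\mathcal T$, $U_{Y^y_i}\le p_\bullet$) or ($Y^y_i\notin\mathcal T$, $U_{Y^y_i}\le p_\circ$), else $Y^y_{i+1}=Y^y_i+(-1,1)$; $X^y$ is its spatial coordinate; $Y=Y^{(0,0)}$,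 $X=X^{(0,0)}$. Standing assumptions: $v_\bullet>0$, $v_\circ>-1$, $\rho\in(0,\infty)$, and for some $v_\star\in(0,v_\bullet)$ there are $c_0>0,\gamma>1$ with $\mathbb P^\rho(\exists n\in\mathbb N: X_n<nv_\star-L)\le c_0^{-1}e^{-c_0\log^\gamma L}$ for all $L\in\mathbb N$. Write $\mathbb P=\mathbb P^\rho$, $\bar v=v_\star/3$. Cones: $\angle(x,n)=(x,n)+\{(x',n')\in\mathbb Z_+^2: x'\ge\bar vn'\}$ and $\angle^{\mathrm{rev}}(x,n)=(x,n)+\{(x',n')\in\mathbb Z_-^2: x'<\bar vn'\}$. $W^{\times}_y$ is the set of $w$ whose trace $\{(w(n),n)\}$ intersects both $\angle(y)$ and $\angle^{\mathrm{rev}}(y)$. $A^y=\{Y^y_i\in\angle(y)\ \forall i\ge0\}$. $R_k=\inf\{n\ge0: X_n\ge(1-\bar v)k+\bar vn\}$, $k\in\mathbb N$. $\mathbb P^{\angle}(\cdot)=\mathbb P(\,\cdot\mid \omega(W^\times_{(0,0)})=0,\ A^{(0,0)})$. $\mathcal I=\inf\{k\in\mathbb N: \omega(W^\times_{Y_{R_k}})=0\text{ and }A^{Y_{R_k}}\text{ occurs}\}$, $\tau=R_{\mathcal I}$. *)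

(* Defs.v *)
From HB Require Import structures.
From mathcomp Require Import all_boot all_order all_algebra.
From mathcomp Require Import all_classical all_reals all_analysis.
Set Implicit Arguments. Unset Strict Implicit. Unset Printing Implicit Defensive.
Import Order.TTheory GRing.Theory Num.Theory.
Local Open Scope classical_set_scope.
Local Open Scope ring_scope.

(* a space-time point (x, n) : x spatial, n time *)
Notation pt := (int * int)%type.

Definition path : Type := int -> int.
HB.instance Definition _ := Choice.on path.
HB.instance Definition _ := isPointed.Build path (fun _ => 0%R).

Definition cyl : set (set path) :=
  [set A | exists (n a : int), A = [set w | w n = a]].

(* the path space W with the product sigma-algebra (generated by coordinates).
   Paths charged by the intensity measure are nearest-neighbour a.s. *)
Notation Wt := (g_sigma_algebraType cyl).

Definition lazy_step (R : realType) (q : R) (d : int) : R :=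
  if d == 0 then q else if (d == 1) || (d == -1) then (1 - q) / 2 else 0.

(* mu is the law P_x of a two-sided lazy SRW with w(0) = x: its finite-dimensional
   distributions on every time window [-N, N] (these determine it on the product
   sigma-algebra). *)
Definition lazy_walk_law (R : realType) (q : R) (x : int)
  (mu : probability Wt R) : Prop :=
  forall (N : nat) (a : nat -> int),
    mu [set w : Wt | forall i : nat, (i <= N.*2)%N -> w (i%:Z - N%:Z) = a i]
    = (((a N == x)%:R) * \prod_(i < N.*2) lazy_step q (a i.+1 - a i))%:E.

(* Poisson probability mass function with parameter lam in [0, +oo]
   (Poisson(+oo) is the Dirac mass at +oo, so it gives 0 to every finite k) *)
Definition poisson_pmf (R : realType) (lam : \bar R) (k : nat) : R :=
  match lam with
  | EFin l => expR (- l) * l ^+ k / (k`!)%:R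
  | _ => 0
  end.

Section Env.
Context {d : measure_display} {Omega : measurableType d} {R : realType}.

(* The point process omega is encoded by an enumeration ws o : nat -> W of its
   atoms (with multiplicity); omega(A) = #{i | ws o i \in A}. *)
Definition omega_count_is (ws : Omega -> nat -> Wt) (o : Omega) (A : set Wt) (k : nat) :=
  ([set i | A (ws o i)] #= `I_k)%card.

Definition omega_zero (ws : Omega -> nat -> Wt) (o : Omega) (A : set Wt) :=
  forall i, ~ A (ws o i).

(* Joint law of (omega, U) under P: omega is a Poisson point process on W with
   intensity rho * sum_x P_x, U = (U_y)_y i.i.d. uniform on [0,1], independent
   of omega.  Stated through the joint law of the counts of finitely many
   disjoint measurable sets and finitely many distinct U's (a determining class). *)
Definition env_law (P : probability Omega R) (rho : R) (Px : int -> probability Wt R)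
  (ws : Omega -> nat -> Wt) (U : Omega -> pt -> R) : Prop :=
  (forall i, measurable_fun setT (fun o => ws o i)) /\
  (forall y, measurable_fun setT (fun o => U o y)) /\
  forall (m : nat) (A : nat -> set Wt) (k : nat -> nat) (ys : seq pt) (b : pt -> R),
    (forall i, (i < m)%N -> measurable (A i)) ->
    (forall i j, (i < m)%N -> (j < m)%N -> i <> j -> A i `&` A j = set0) ->
    uniq ys -> (forall y, y \in ys -> 0 <= b y <= 1) ->
    P [set o | (forall i, (i < m)%N -> omega_count_is ws o (A i) (k i)) /\
               (forall y, y \in ys -> U o y <= b y)]
    = ((\prod_(i < m) poisson_pmf ((rho%:E * \esum_(x in [set: int]) Px x (A i))%E) (k i))
       * \prod_(y <- ys) b y)%:E.
End Env.

Definition Tset (ws : nat -> Wt) : set pt := [set z | exists i n, z = (ws i n, n)].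

Fixpoint Ypath (R : realType) (T : set pt) (U : pt -> R) (pb pc : R) (y : pt) (i : nat) : pt :=
  match i with
  | 0 => y
  | i.+1 => let z := Ypath T U pb pc y i in
            if `[< (T z /\ U z <= pb) \/ (~ T z /\ U z <= pc) >]
            then (z.1 + 1, z.2 + 1) else (z.1 - 1, z.2 + 1)
  end.

Definition cone (R : realType) (vb : R) (y : pt) : set pt :=
  [set z | 0 <= z.1 - y.1 /\ 0 <= z.2 - y.2 /\ vb * (z.2 - y.2)%:~R <= (z.1 - y.1)%:~R].
Definition rcone (R : realType) (vb : R) (y : pt) : set pt :=
  [set z | z.1 - y.1 <= 0 /\ z.2 - y.2 <= 0 /\ (z.1 - y.1)%:~R < vb * (z.2 - y.2)%:~R].
Definition trace (w : path) : set pt := [set z | exists n, z = (w n, n)].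
Definition Wcross (R : realType) (vb : R) (y : pt) : set Wt :=
  [set w | (trace w `&` cone vb y) !=set0 /\ (trace w `&` rcone vb y) !=set0].

Definition first_hit (P : nat -> Prop) : option nat :=
  xget None [set o | match o with
                     | Some n => P n /\ (forall m, (m < n)%N -> ~ P m)
                     | None => forall n, ~ P n end].

Section Walk.
Context {d : measure_display} {Omega : measurableType d} {R : realType}.
Variables (pb pc vstar : R) (ws : Omega -> nat -> Wt) (U : Omega -> pt -> R).

Definition vbar : R := vstar / 3.
Definition Yw (o : Omega) (y : pt) (i : nat) : pt := Ypath (Tset (ws o)) (U o) pb pc y i.
Definition Xw (o : Omega) (n : nat) : int := (Yw o (0, 0) n).1.

Definition noCross (o : Omega) (y : pt) : Prop := omega_zero ws o (Wcross vbar y).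
Definition Aev (o : Omega) (y : pt) : Prop := forall i, cone vbar y (Yw o y i).
Definition Rk (o : Omega) (k : nat) : option nat :=
  first_hit (fun n => (1 - vbar) * k%:R + vbar * n%:R <= (Xw o n)%:~R).
Definition Iidx (o : Omega) : option nat :=
  first_hit (fun k => (1 <= k)%N /\
    match Rk o k with
    | Some r => noCross o (Yw o (0, 0) r) /\ Aev o (Yw o (0, 0) r)
    | None => False end).
Definition tauw (o : Omega) : option nat :=
  match Iidx o with Some k => Rk o k | None => None end.

Definition Z0 (o : Omega) : option (nat * seq int) :=
  match tauw o with
  | Some t => Some (t, [seq Xw o s | s <- iota 0 t.+1])
  | None => None end.

(* conditioning event of P^angle *)
Definition Bangle : set Omega := [set o | noCross o (0, 0) /\ Aev o (0, 0)].
End Walk.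

Definition condP {d : measure_display} {Omega : measurableType d} {R : realType}
  (P : probability Omega R) (B E : set Omega) : R :=
  fine (P (E `&` B)) / fine (P B).

Definition oadd (a b : option nat) : option nat :=
  match a, b with Some x, Some y => Some (x + y)%N | _, _ => None end.
Definition Ssum {T} (tau : nat -> T -> option nat) (n : nat) (o : T) : option nat :=
  foldr oadd (Some 0%N) [seq tau i o | i <- iota 1 n].

Definition Zseg {T} (X : T -> nat -> int) (tau : nat -> T -> option nat) (n : nat) (o : T)
  : option (nat * seq int) :=
  match Ssum tau n o, tau n.+1 o with
  | Some s, Some t => Some (t, [seq X o (s + i)%N - X o s | i <- iota 0 t.+1])
  | _, _ => None end.

(* Main.v *)
Require Import Defs.
From HB Require Import structures.
From mathcomp Require Import all_boot all_order all_algebra.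
From mathcomp Require Import all_classical all_reals all_analysis.
From mathcomp Require Import ring lra zify.
Set Implicit Arguments. Unset Strict Implicit. Unset Printing Implicit Defensive.
Import Order.TTheory GRing.Theory Num.Theory numFieldNormedType.Exports.
Local Open Scope classical_set_scope.
Local Open Scope ring_scope.

(**
The renewal times are those of the environment itself, so no enlargement is needed: after the
n-th renewal, at the space-time point y, tau_(n+1) is tau computed for the environment seen from
y.  The event "tau ends at y along a given path" is an event carried by the trajectories missing
the forward cone of y, intersected with "no trajectory crosses y and the walk from y stays in its
cone"; the latter event, and everything that happens afterwards, is carried by the trajectories
that meet the forward cone of y.  Independence of the Poisson process on disjoint sets and
space-time stationarity of its intensity turn this into the i.i.d. product formula, provided that
P(angle event) > 0 and tau < oo almost surely.

Positivity: force L steps to the right, after which the ballistic hypothesis keeps the walk in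
the cone with probability close to 1, whereas P(no crossing) > 0 does not depend on L.

Finiteness of tau: a trajectory that crosses a record after missing the backward cone of the
record m steps earlier has to climb about m levels, which is exponentially unlikely in m, and it
is independent of the walk up to that earlier record.  A union bound over m, at those records
(a positive fraction of all of them, by ballisticity) from which one looks back on a linear time
scale, shows that with probability close to 1 infinitely many records are such that no
trajectory from their past reaches the forward cone l steps further along the diagonal.  At each
of these, whatever the past, forcing l steps to the right and using a fresh environment gives a
renewal with probability bounded below.
*)

(** * Countable measurability *)

(** A trajectory lives for all times, so the environment after a given time is never independent of
    the environment before it, and the event [A] looks at the whole future of the walk. Independence
    is therefore used only between disjoint sets of trajectories taken with disjoint sets of sites,
    and every random point is first frozen by summing over its countably many values. A trajectory
    may meet both cones of y; the absence of crossings ensures that those seen before y miss the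
    forward cone. The past half of the event that a block ends at y becomes a genuine event by
    erasing the environment of the forward cone and setting its uniforms to 0: the walk from y then
    runs along the diagonal, y is automatically a renewal point, and the half is again an event
    about [cZ]. The slope vstar/3 leaves a margin: off an unlikely event the level of the walk grows
    at rate 2 vstar/3, which serves both to stay in the cone and to reach records in linear time. An
    infinite tau is the value [None]; the product formula is also asserted there, and both of its
    sides vanish because tau is almost surely finite. *)

Section MeasurablePredicates.
Context {d : measure_display} {T : measurableType d}.
Implicit Types (Phi Psi : T -> Prop).

Definition mpred Phi := measurable [set x | Phi x].

Lemma mpred_eq Phi Psi : (forall x, Phi x <-> Psi x) -> mpred Phi -> mpred Psi.
Proof.
by move=> e; rewrite /mpred; congr measurable; apply/seteqP; split => x /e.
Qed.

Lemma mpred_not Phi : mpred Phi -> mpred (fun x => ~ Phi x).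
Proof. exact: measurableC. Qed.

Lemma mpred_and Phi Psi : mpred Phi -> mpred Psi -> mpred (fun x => Phi x /\ Psi x).
Proof. exact: measurableI. Qed.

Lemma mpred_or Phi Psi : mpred Phi -> mpred Psi -> mpred (fun x => Phi x \/ Psi x).
Proof. exact: measurableU. Qed.

Lemma mpred_const (Q : Prop) : mpred (fun=> Q).
Proof.
have [q|q] := pselect Q.
- by apply: (@mpred_eq (fun=> True)) => //; exact: measurableT.
- by apply: (@mpred_eq (fun=> False)) => //; exact: measurable0.
Qed.

Lemma mpred_imp Phi Psi : mpred Phi -> mpred Psi -> mpred (fun x => Phi x -> Psi x).
Proof.
move=> h1 h2; apply: (mpred_eq _ (mpred_or (mpred_not h1) h2)) => x; split.
  by case=> [h /h //|].
by move=> h; have [/h|] := pselect (Phi x); [right|left].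
Qed.

Lemma mpred_ex (I : countType) (Phi : I -> T -> Prop) :
  (forall i, mpred (Phi i)) -> mpred (fun x => exists i, Phi i x).
Proof.
move=> h.
pose F (n : nat) := if @pickle_inv I n is Some i then [set x | Phi i x] else set0.
rewrite /mpred; have -> : [set x | exists i, Phi i x] = \bigcup_n F n.
  apply/seteqP; split => x /=.
    by case=> i hi; exists (pickle i) => //; rewrite /F pickleK_inv.
  by case=> n _; rewrite /F; case: pickle_inv => // i hi; exists i.
by apply: bigcupT_measurable => n; rewrite /F; case: pickle_inv => // i; apply: h.
Qed.

Lemma mpred_all (I : countType) (Phi : I -> T -> Prop) :
  (forall i, mpred (Phi i)) -> mpred (fun x => forall i, Phi i x).
Proof.
move=> h; apply: (mpred_eq _ (mpred_not (mpred_ex (fun i => mpred_not (h i))))) => x.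
split=> [nh i|h1 [i]]; last exact.
by apply: contrapT => hi; apply: nh; exists i.
Qed.

(** Measurability into a countable type, expressed by fibres, so that types such as [option pt] or
    [seq int] need no sigma-algebra of their own. *)
Definition discrete_mfun {I : Type} (f : T -> I) := forall i, mpred (fun x => f x = i).

Lemma mpred_bind (I : countType) (f : T -> I) (Q : I -> T -> Prop) :
  discrete_mfun f -> (forall i, mpred (Q i)) -> mpred (fun x => Q (f x) x).
Proof.
move=> mf mQ; apply: (mpred_eq _ (mpred_ex (fun i => mpred_and (mf i) (mQ i)))) => x.
by split=> [[i [<-]]//|h]; exists (f x).
Qed.

Lemma discrete_mfun_bind (I : countType) (J : Type) (f : T -> I) (g : I -> T -> J) :
  discrete_mfun f -> (forall i, discrete_mfun (g i)) -> discrete_mfun (fun x => g (f x) x).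
Proof. move=> mf mg j; apply: (@mpred_bind I f (fun i x => g i x = j)) => // i; exact: mg. Qed.

Lemma discrete_mfun_comp (I : countType) (J : Type) (f : T -> I) (g : I -> J) :
  discrete_mfun f -> discrete_mfun (fun x => g (f x)).
Proof.
by move=> mf; apply: (@discrete_mfun_bind I J f (fun i _ => g i)) => // i j; exact: mpred_const.
Qed.

Lemma discrete_mfun_const (J : Type) (y : J) : discrete_mfun (fun=> y).
Proof. by move=> j; exact: mpred_const. Qed.

End MeasurablePredicates.

Ltac to_mpred := lazymatch goal with |- _ (mkset ?P) => change (mpred P) end.

Lemma mpred_preimage d1 d2 (T1 : measurableType d1) (T2 : measurableType d2)
    (f : T1 -> T2) (Phi : T2 -> Prop) :
  measurable_fun setT f -> mpred Phi -> mpred (fun x => Phi (f x)).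
Proof. by move=> mf mPhi; have := mf measurableT _ mPhi; rewrite setTI. Qed.

Lemma esum_support {R : realType} {I : choiceType} (S : set I) (f : I -> \bar R) :
  (forall i, ~ S i -> f i = 0%E) -> \esum_(i in setT) f i = \esum_(i in S) f i.
Proof.
move=> h; rewrite [RHS]esum_mkcond; apply: eq_esum => i _.
by case: ifPn => //; rewrite notin_setE => /h.
Qed.

Section Fibers.
Context {R : realType} {d : measure_display} {T : measurableType d} {I : countType}.
Variables (f : T -> I).
Hypothesis mf : discrete_mfun f.

Lemma measure_fibers (mu : {measure set T -> \bar R}) (A : set T) : measurable A ->
  mu A = \esum_(i in setT) mu (A `&` [set x | f x = i]).
Proof.
move=> mA.
pose F (n : nat) := if @pickle_inv I n is Some i then A `&` [set x | f x = i] else set0.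
have AF : A = \bigcup_n F n.
  apply/seteqP; split => x /=.
    by move=> Ax; exists (pickle (f x)) => //; rewrite /F pickleK_inv.
  by case=> n _; rewrite /F; case: pickle_inv => // i [].
have mFn n : measurable (F n).
  by rewrite /F; case: pickle_inv => // i; apply: measurableI => //; exact: mf.
have tF : trivIset setT F.
  move=> i j _ _ [x []]; rewrite /F.
  case ei: (pickle_inv i) => [a|//]; case ej: (pickle_inv j) => [b|//] [_ /= fa] [_ /= fb].
  have := @pickle_invK I i; have := @pickle_invK I j.
  by rewrite ei ej /= -fa -fb => <- <-.
rewrite [in LHS]AF measure_semi_bigcup//; last exact: bigcupT_measurable.
rewrite nneseries_esumT//.
rewrite (esum_support (S := range (@pickle I))).
  rewrite (esum_image setT (@pickle I)).
    by apply: eq_esum => i _; rewrite /F pickleK_inv.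
  by move=> i j _ _ /(pcan_inj (@pickleK_inv I)).
move=> n hn; rewrite /F; case e: (pickle_inv n) => [i|]; last exact: measure0.
case: hn; exists i => //.
by have := @pickle_invK I n; rewrite e.
Qed.
End Fibers.

(** Replaces conditioning on a random point: an inequality proved with the point frozen at each
    value sums up to the inequality itself. The two sides may even use different spaces and
    different maps. *)
Lemma le_measure_fibers {R : realType} {d1 d2} {T1 : measurableType d1} {T2 : measurableType d2}
  {I : countType} (f1 : T1 -> I) (f2 : T2 -> I)
  (m1 : {measure set T1 -> \bar R}) (m2 : {measure set T2 -> \bar R}) (c : R) A B :
  discrete_mfun f1 -> discrete_mfun f2 -> measurable A -> measurable B -> 0 <= c ->
  (forall i, m1 (A `&` [set x | f1 x = i]) <= c%:E * m2 (B `&` [set x | f2 x = i]))%E ->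
  (m1 A <= c%:E * m2 B)%E.
Proof.
move=> mf1 mf2 mA mB c0 h.
have -> : (c%:E * m2 B)%E = mscale (NngNum c0) m2 B by [].
rewrite (measure_fibers mf1 m1 mA) (measure_fibers mf2 _ mB).
by apply: le_esum => i _; exact: h.
Qed.

Lemma eq_measure_fibers {R : realType} {d1 d2} {T1 : measurableType d1} {T2 : measurableType d2}
  {I : countType} (f1 : T1 -> I) (f2 : T2 -> I)
  (m1 : {measure set T1 -> \bar R}) (m2 : {measure set T2 -> \bar R}) (c : R) A B :
  discrete_mfun f1 -> discrete_mfun f2 -> measurable A -> measurable B -> 0 <= c ->
  (forall i, m1 (A `&` [set x | f1 x = i]) = c%:E * m2 (B `&` [set x | f2 x = i]))%E ->
  (m1 A = c%:E * m2 B)%E.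
Proof.
move=> mf1 mf2 mA mB c0 h.
have -> : (c%:E * m2 B)%E = mscale (NngNum c0) m2 B by [].
rewrite (measure_fibers mf1 m1 mA) (measure_fibers mf2 _ mB).
by apply: eq_esum => i _; exact: h.
Qed.

Lemma geometric_cover {R : realType} {d} {T : measurableType d}
  (mu : {measure set T -> \bar R}) (A : set T) (F : nat -> set T) (C r : R) :
  measurable A -> (forall n, measurable (F n)) -> A `<=` \bigcup_n F n ->
  0 <= C -> 0 <= r < 1 -> (forall n, mu (F n) <= (C * r ^+ n)%:E)%E ->
  (mu A <= (C / (1 - r))%:E)%E.
Proof.
move=> mA mF' AF C0 /andP[r0 r1] h.
apply: le_trans (measure_sigma_subadditive mu mF' mA AF) _.
apply: (@le_trans _ _ (\sum_(i <oo) (C * r ^+ i)%:E)%E); first by apply: lee_nneseries.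
apply: lime_le; first by apply: is_cvg_nneseries => n _ _; rewrite lee_fin mulr_ge0 ?exprn_ge0.
apply: nearW => n; rewrite sumEFin lee_fin.
have -> : \sum_(0 <= i < n) C * r ^+ i = C * (1 - r ^+ n) / (1 - r).
  have r1' : 1 - r != 0 by rewrite subr_eq0 eq_sym lt_eqF.
  apply: (mulIf r1'); rewrite mulfVK// big_mkord -mulr_sumr -mulrA; congr (_ * _).
  by rewrite -[RHS]opprB subrX1; ring.
rewrite -mulrA ler_wpM2l// ler_pdivrMr ?subr_gt0// mulVf ?subr_eq0 1?eq_sym ?lt_eqF//.
by rewrite lerBlDr lerDl exprn_ge0.
Qed.

(** * The intensity measure on paths *)

Lemma discrete_mfun_coord (n : int) : discrete_mfun (fun w : Wt => w n).
Proof. by move=> a; apply: sub_sigma_algebra; exists n, a. Qed.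

Lemma lazy_step_sym {R : realType} (q : R) (x : int) : lazy_step q (- x) = lazy_step q x.
Proof.
rewrite /lazy_step oppr_eq0.
have -> // : (- x == 1) || (- x == -1) = ((x == 1) || (x == -1)).
by apply/idP/idP => h; have [/eqP|/eqP] := orP h => {}h; apply/orP;
  [right|left|right|left]; apply/eqP; lia.
Qed.

Lemma esum_lazy_step {R : realType} (q : R) (g : int -> R) (x : int) :
  0 < q < 1 -> (forall b, 0 <= g b) ->
  \esum_(b in setT) (lazy_step q (b - x) * g b)%:E =
  (q * g x + (1 - q) / 2 * (g (x + 1) + g (x - 1)))%:E.
Proof.
move=> q01 g0.
have s0 y : 0 <= lazy_step q y.
  by rewrite /lazy_step; case: ifP => _; [lra|case: ifP => _ //; lra].
have st0 : lazy_step q 0 = q by rewrite /lazy_step eqxx.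
have st1 : lazy_step q 1 = (1 - q) / 2 by [].
have stm1 : lazy_step q (-1) = (1 - q) / 2 by [].
rewrite (esum_support (S := [set` [:: x; x + 1; x - 1]])); last first.
  move=> i /= hi; suff -> : lazy_step q (i - x) = 0 by rewrite mul0r.
  rewrite /lazy_step; case: ifP => [/eqP h|_].
    by case: hi; rewrite !inE; apply/orP; left; apply/eqP; lia.
  case: ifP => // /orP[/eqP h|/eqP h]; case: hi; rewrite !inE; apply/orP; right; apply/orP.
    by left; apply/eqP; lia.
  by right; apply/eqP; lia.
rewrite esum_fset; [|exact: finite_seq|by move=> i _; rewrite lee_fin mulr_ge0].
rewrite -fsbig_seq; last first.
  by rewrite /= !inE !negb_or !andbT; apply/andP; split; [apply/andP; split|]; lia.
rewrite !big_cons big_nil /= adde0 -!EFinD; congr EFin.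
have -> : x - x = 0 :> int by lia.
have -> : x + 1 - x = 1 :> int by lia.
have -> : x - 1 - x = -1 :> int by lia.
by rewrite st0 st1 stm1; ring.
Qed.

Section PathMeasure.
Variables (R : realType) (q : R) (Px : int -> probability Wt R).
Hypothesis q01 : 0 < q < 1.
Hypothesis hPx : forall x, lazy_walk_law q x (Px x).

(** Enumerating the starting points by [pickle] makes the intensity an instance of [mseries], hence
    a measure; indices that code no integer contribute [mzero]. *)
Definition lam_seq (n : nat) : {measure set Wt -> \bar R} :=
  if @pickle_inv int n is Some x then Px x else mzero.
Definition lam : {measure set Wt -> \bar R} := mseries lam_seq 0.

Lemma lamE A : lam A = \esum_(x in [set: int]) Px x A.
Proof.
rewrite /lam /mseries /= /mseries nneseries_esumT//.
rewrite (esum_support (S := range (@pickle int))).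
  rewrite (esum_image setT (@pickle int)).
    by apply: eq_esum => i _; rewrite /lam_seq pickleK_inv.
  by move=> i j _ _ /(pcan_inj (@pickleK_inv int)).
move=> n hn; rewrite /lam_seq; case e: (pickle_inv n) => [i|//].
by case: hn; exists i => //; have := @pickle_invK int n; rewrite e.
Qed.

Definition window (s : int) (n : nat) (a : nat -> int) : set Wt :=
  [set w | forall i : nat, (i <= n)%N -> w (s + i%:Z) = a i].

Definition path_weight (n : nat) (a : nat -> int) : R :=
  \prod_(i < n) lazy_step q (a i.+1 - a i).

Lemma lazy_step_ge0 x : 0 <= lazy_step q x.
Proof.
have /andP[q0 q1] := q01.
by rewrite /lazy_step; case: ifP => _; [lra|case: ifP => _ //; lra].
Qed.

Lemma path_weight_ge0 n a : 0 <= path_weight n a.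
Proof. by apply: prodr_ge0 => i _; exact: lazy_step_ge0. Qed.

Lemma measurable_window s n a : measurable (window s n a).
Proof.
apply: (@mpred_all _ _ _ (fun i (w : Wt) => (i <= n)%N -> w (s + i%:Z) = a i)) => i.
by apply: mpred_imp; [exact: mpred_const|exact: discrete_mfun_coord].
Qed.

Lemma lam_window_centered N a :
  lam (window (- N%:Z) N.*2 a) = (path_weight N.*2 a)%:E.
Proof.
rewrite lamE (esum_support (S := [set a N])); last first.
  move=> x hx; have := hPx x N a.
  have -> : (a N == x) = false by apply/negbTE/eqP => h; apply: hx; rewrite -h.
  rewrite mul0r => hx0; apply: etrans hx0; congr (Px x _).
  by apply/seteqP; split => w /= h i /h; rewrite addrC.
rewrite esum_set1//.
have := hPx (a N) N a; rewrite eqxx mul1r => ha; apply: etrans ha; congr (Px _ _).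
by apply/seteqP; split => w /= h i /h; rewrite addrC.
Qed.

Definition acons (x : int) (a : nat -> int) : nat -> int :=
  fun i => if i is j.+1 then a j else x.

(** The law of the walk is given on windows centred at time 0 only. Summing over the last position
    shortens a window on the right; summing over the first shortens it on the left, the symmetry of
    the step turning this into the same sum. Every window sits in a centred one. *)
Lemma lam_window s n a : lam (window s n a) = (path_weight n a)%:E.
Proof.
pose V s n := forall a, lam (window s n a) = (path_weight n a)%:E.
have Vr t m : V t m.+1 -> V t m.
  move=> h b; rewrite (measure_fibers (discrete_mfun_coord (t + m.+1%:Z)))//; last exact: measurable_window.
  pose bx x := fun i => if (i <= m)%N then b i else x.
  transitivity (\esum_(x in setT) (lazy_step q (x - b m) * path_weight m b)%:E).
    apply: eq_esum => x _.
    have -> : window t m b `&` [set w | w (t + m.+1%:Z) = x] = window t m.+1 (bx x).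
      apply/seteqP; split => [w [/= h1 h2] i|w /= h1].
        rewrite leq_eqVlt => /orP[/eqP->|]; first by rewrite /bx ltnn.
        by rewrite ltnS => im; rewrite /bx im; exact: h1.
      split => [i im|]; first by rewrite h1 /bx ?im// leqW.
      by rewrite h1 // /bx ltnn.
    rewrite h /path_weight big_ord_recr/= /bx leqnn ltnn mulrC; congr (_ * _)%:E.
    by apply: eq_bigr => i _; rewrite ltn_ord ltnW.
  rewrite (esum_lazy_step (g := fun=> path_weight m b))//; first by congr EFin; lra.
  by move=> _; exact: path_weight_ge0.
have Vl t m : V t m.+1 -> V (t + 1) m.
  move=> h b; rewrite (measure_fibers (discrete_mfun_coord t))//; last exact: measurable_window.
  transitivity (\esum_(x in setT) (lazy_step q (x - b 0%N) * path_weight m b)%:E).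
    apply: eq_esum => x _.
    have -> : window (t + 1) m b `&` [set w | w t = x] = window t m.+1 (acons x b).
      apply/seteqP; split => [w [/= h1 h2] [|i]|w /= h1].
      - by rewrite addr0.
      - rewrite ltnS => im; rewrite /= -h1//; congr w; lia.
      - split => [i im|]; last by have /= := h1 0%N isT; rewrite addr0.
        by have /= <- := h1 i.+1 im; congr w; lia.
    rewrite h /path_weight big_ord_recl/= /acons -lazy_step_sym opprB; congr (_ * _)%:E.
  rewrite (esum_lazy_step (g := fun=> path_weight m b))//; first by congr EFin; lra.
  by move=> _; exact: path_weight_ge0.
have Vrk k t m : V t (m + k)%N -> V t m.
  by elim: k m => [|k IH] m; [rewrite addn0|rewrite addnS -addSn => /IH/Vr].
have Vlk (k : nat) t m : V t (m + k)%N -> V (t + k%:Z) m.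
  elim: k m t => [|k IH] m t; first by rewrite addn0 addr0.
  rewrite addnS => /Vl /IH.
  by have -> : t + 1 + k%:Z = t + k.+1%:Z by lia.
suff : V s n by exact.
pose N := (absz s + n)%N.
have h0 : V (- N%:Z) N.*2 by exact: lam_window_centered.
have [k hk] : exists k : nat, s = - N%:Z + k%:Z by exists (absz (s + N%:Z)); lia.
rewrite hk; apply: Vlk.
have [j hj] : exists j : nat, N.*2 = (n + k + j)%N by exists (N.*2 - (n + k))%N; lia.
by rewrite hj in h0; exact: Vrk h0.
Qed.

End PathMeasure.

Definition path_shift (y : pt) (w : Wt) : Wt := fun n => w (n + y.2) - y.1.

Lemma measurable_path_shift y : measurable_fun setT (path_shift y).
Proof.
apply: (@measurability _ _ _ _ setT (path_shift y) cyl) => // _ [_ [n [a ->]] <-].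
rewrite setTI; apply: (mpred_eq _ (@discrete_mfun_coord (n + y.2) (a + y.1))) => w /=.
by rewrite /path_shift; split => h; lia.
Qed.

Definition path_window (s : int) (n : nat) (w : Wt) : seq int :=
  mkseq (fun i => w (s + i%:Z)) n.+1.

Lemma path_windowP s n w l : path_window s n w = l <->
  size l = n.+1 /\ window s n (nth 0 l) w.
Proof.
split => [<-|[sl h]].
  by split => [|i im]; rewrite ?size_mkseq// nth_mkseq.
apply: (eq_from_nth (x0 := 0)); rewrite ?size_mkseq// => i im.
by rewrite nth_mkseq// h.
Qed.

Lemma discrete_mfun_path_window s n : discrete_mfun (path_window s n).
Proof.
move=> l; apply: (mpred_eq (Phi := fun w => size l = n.+1 /\ window s n (nth 0 l) w)).
  by move=> w; split => /path_windowP.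
by apply: mpred_and; [exact: mpred_const|exact: measurable_window].
Qed.

(** Unlike [cyl], this generating family is stable under intersection, as uniqueness of measures
    requires. *)
Definition fdcyl : set (set Wt) :=
  [set A | exists l : seq (int * int), A = [set w | forall p, p \in l -> w p.1 = p.2]].

Lemma fdcyl_generates : (measurable : set (set Wt)) = <<s fdcyl >>.
Proof.
apply/seteqP; split.
  apply: smallest_sub; first exact: smallest_sigma_algebra.
  move=> _ [n [a ->]]; apply: sub_sigma_algebra; exists [:: (n, a)].
  apply/seteqP; split => w /= h; first by move=> p; rewrite inE => /eqP ->.
  by apply: (h (n, a)); rewrite inE.
apply: smallest_sub; first exact: sigma_algebra_measurable.
move=> _ [l ->].
apply: (@mpred_all _ _ _ (fun (p : int * int) (w : Wt) => p \in l -> w p.1 = p.2)) => p.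
by apply: mpred_imp; [exact: mpred_const|exact: discrete_mfun_coord].
Qed.

Section PathMeasureBounds.
Variables (R : realType) (q : R) (Px : int -> probability Wt R).
Hypothesis q01 : 0 < q < 1.
Hypothesis hPx : forall x, lazy_walk_law q x (Px x).
Local Notation lam := (lam Px).

Lemma lam_path_window s n l :
  lam [set w | path_window s n w = l] =
  (if size l == n.+1 then path_weight q n (nth 0 l) else 0)%:E.
Proof.
case: ifP => [/eqP h|/eqP h].
  rewrite -(lam_window q01 hPx s); congr (lam _).
  by apply/seteqP; split => w /=; [move/path_windowP => []|move=> hw; apply/path_windowP].
rewrite -[RHS](@measure0 _ _ _ lam); congr (lam _).
by apply/seteqP; split => // w /= /path_windowP [].
Qed.

(** A path weight depends only on increments and is the same for windows at all times, so the
    measure and its image agree on finite-dimensional cylinders. *)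
Lemma lam_path_shift y D : measurable D -> lam (path_shift y @^-1` D) = lam D.
Proof.
move=> mD.
pose pf : {measure set Wt -> \bar R} := pushforward lam (path_shift y).
pose m2 := pf (measurable_path_shift y).
have mm2 A : m2 A = lam (path_shift y @^-1` A) by [].
rewrite -mm2; apply/esym.
(* Sigma-finiteness: the sets of paths with prescribed position at time 0 have mass 1 and cover the
   space; an index that codes no integer repeats the one at 0. *)
pose g n : set Wt := if @pickle_inv int n is Some x then [set w | w 0 = x]
   else [set w | w 0 = 0].
have g1 n x : lam [set w : Wt | w n = x] = 1%E.
  have := lam_path_window n 0 [:: x]; rewrite eqxx /path_weight big_ord0 => <-.
  congr (lam _); apply/seteqP; split => w /=; rewrite /path_window /mkseq /= addr0.
    by move=> ->.
  by case.
apply: (measure_unique fdcyl g) => //; first exact: fdcyl_generates.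
- move=> _ _ [l1 ->] [l2 ->]; exists (l1 ++ l2); apply/seteqP; split => w /=.
    by move=> [h1 h2] p; rewrite mem_cat => /orP[/h1|/h2].
  by move=> h; split => p hp; apply: h; rewrite mem_cat hp ?orbT.
- move=> n; rewrite /g; case: pickle_inv => [x|].
    exists [:: (0, x)]; apply/seteqP; split => w /= h; last by apply: (h (0, x)); rewrite inE.
    by move=> p; rewrite inE => /eqP ->.
  exists [:: (0, 0)]; apply/seteqP; split => w /= h; last by apply: (h (0, 0)); rewrite inE.
  by move=> p; rewrite inE => /eqP ->.
- apply/seteqP; split => // w _; exists (pickle (w 0)) => //.
  by rewrite /g pickleK_inv.
- move=> _ [l ->]; rewrite mm2.
  pose N := \max_(p <- l) absz p.1.
  have hN p : p \in l -> (absz p.1 <= N)%N by move=> hp; rewrite /N (big_rem p)//= leq_maxl.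
  (* The window of times from [-N] to [N] contains every time constrained by [l]; time [p.1] sits
     there at index [p.1 + N]. *)
  pose PP (t : seq int) := forall p, p \in l -> nth 0 t (absz (p.1 + N%:Z)) = p.2.
  have hP w : [set w : Wt | forall p, p \in l -> w p.1 = p.2] w <-> PP (path_window (- N%:Z) N.*2 w).
    have aux p : p \in l -> nth 0 (path_window (- N%:Z) N.*2 w) (absz (p.1 + N%:Z)) = w p.1.
      by move=> /hN hp; rewrite nth_mkseq; [congr w; lia|lia].
    by split => h p hp; have := h p hp; rewrite aux.
  rewrite -[RHS]mul1e.
  have mfs : discrete_mfun (fun w => path_window (- N%:Z) N.*2 (path_shift y w)).
    by move=> t; apply: mpred_preimage (@discrete_mfun_path_window _ _ t); exact: measurable_path_shift.
  have mA : measurable [set w : Wt | forall p, p \in l -> w p.1 = p.2].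
    by rewrite fdcyl_generates; apply: sub_sigma_algebra; exists l.
  apply: (eq_measure_fibers (@discrete_mfun_path_window (- N%:Z) N.*2) mfs) => //.
    exact: (mpred_preimage (measurable_path_shift y) mA).
  move=> t; rewrite mul1e.
  have [Pt|nPt] := pselect (PP t); last first.
    transitivity (0 : \bar R)%E.
      rewrite -[RHS](@measure0 _ _ _ lam); congr (lam _).
      by apply/seteqP; split => // w [/hP + /= e]; rewrite e.
    rewrite -[LHS](@measure0 _ _ _ lam); congr (lam _).
    by apply/seteqP; split => // w [/hP + /= e]; rewrite e.
  transitivity (lam [set w | path_window (- N%:Z) N.*2 w = t]).
    congr (lam _); apply/seteqP; split => [w []//|w /= e]; split => //.
    by apply/hP; rewrite e.
  transitivity (lam [set w | path_window (- N%:Z) N.*2 (path_shift y w) = t]); last first.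
    congr (lam _); apply/seteqP; split => [w /= e|w []//]; split => //.
    by rewrite /preimage /=; apply/hP; rewrite e.
  rewrite lam_path_window.
  transitivity (lam [set w | path_window (- N%:Z + y.2) N.*2 w = map (fun z => z + y.1) t]).
    rewrite lam_path_window size_map; case: ifP => // /eqP st; congr EFin.
    apply: eq_bigr => i _; rewrite !(nth_map 0) ?st ?ltnS ?ltn_ord 1?ltnW//.
    by congr (lazy_step q _); lia.
  congr (lam _); apply/seteqP; split => w /= /path_windowP[].
    rewrite size_map => st h; apply/path_windowP; split => // i im.
    have := h i im; rewrite (nth_map 0) ?st//.
    have e : - N%:Z + y.2 + i%:Z = - N%:Z + i%:Z + y.2 by lia.
    by rewrite /path_shift -e => ->; rewrite addrK.
  move=> st h; apply/path_windowP; split => [|i im]; first by rewrite size_map.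
  have := h i im; rewrite (nth_map 0) ?st//.
  have e : - N%:Z + y.2 + i%:Z = - N%:Z + i%:Z + y.2 by lia.
  by rewrite /path_shift -e => <-; rewrite subrK.
- move=> k; rewrite /g; case: pickle_inv => [x|]; rewrite g1 ltry//.
Qed.

Lemma lam_markov s n x0 x1 (z : R) :
  lam [set w : Wt | [/\ w s = x0, w (s + 1) = x1 & z <= (w (s + 1 + n%:Z))%:~R]] =
  ((lazy_step q (x1 - x0)%R)%:E * lam [set w : Wt | w (s + 1)%R = x1 /\ (z <= (w (s + 1 + n%:Z)%R)%:~R)%R])%E.
Proof.
have mz : mpred (fun w : Wt => z <= (w (s + 1 + n%:Z))%:~R).
  apply: (@mpred_bind _ _ _ (fun w : Wt => w (s + 1 + n%:Z)) (fun a _ => z <= a%:~R)).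
    exact: discrete_mfun_coord.
  by move=> a; exact: mpred_const.
have mB : measurable [set w : Wt | w (s + 1) = x1 /\ (z <= (w (s + 1 + n%:Z))%:~R)%R].
  by to_mpred; apply: mpred_and => //; exact: discrete_mfun_coord.
apply: (eq_measure_fibers (@discrete_mfun_path_window (s + 1) n) (@discrete_mfun_path_window (s + 1) n)) => //.
- to_mpred; apply: (mpred_eq (Phi := fun w : Wt => w s = x0 /\ (w (s + 1) = x1 /\ (z <= (w (s + 1 + n%:Z))%:~R)%R))).
    by move=> w; split => [[? [? ?]]|[? ? ?]].
  by apply: mpred_and; [|apply: mpred_and => //]; exact: discrete_mfun_coord.
- exact: lazy_step_ge0.
move=> t.
have w0 w : path_window (s + 1) n w = t -> w (s + 1) = nth 0 t 0.
  by move=> <-; rewrite nth_mkseq// addr0.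
have wn w : path_window (s + 1) n w = t -> w (s + 1 + n%:Z) = nth 0 t n.
  by move=> <-; rewrite nth_mkseq.
have [[e1 e2]|ne] := pselect (nth 0 t 0 = x1 /\ z <= (nth 0 t n)%:~R); last first.
  transitivity (0 : \bar R)%E.
    rewrite -[RHS](@measure0 _ _ _ lam); congr (lam _).
    apply/seteqP; split => // w [[_ h1 h2] /= e]; apply: ne.
    by rewrite -(w0 w e) -(wn w e).
  rewrite -[LHS](mule0 (lazy_step q (x1 - x0))%:E); congr (_ * _)%E.
  rewrite -[LHS](@measure0 _ _ _ lam); congr (lam _).
  apply/seteqP; split => // w [[h1 h2] /= e]; apply: ne.
  by rewrite -(w0 w e) -(wn w e).
transitivity (lam [set w | path_window s n.+1 w = x0 :: t]).
  congr (lam _); apply/seteqP; split.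
    move=> w [[h0 h1 h2] /= /path_windowP [st h]]; apply/path_windowP.
    split => [|[|i] im]; rewrite /= ?st//; first by rewrite addr0.
    by rewrite -h//; congr w; lia.
  move=> w /= /path_windowP /= [[st] h].
  have ht : path_window (s + 1) n w = t.
    apply/path_windowP; split => // i im; have /= <- := h i.+1 im; congr w; lia.
  split => //=; split; first by have /= := h 0%N isT; rewrite addr0.
    by rewrite (w0 w ht).
  by rewrite (wn w ht).
transitivity ((lazy_step q (x1 - x0))%:E * lam [set w | path_window (s + 1) n w = t])%E; last first.
  congr (_ * lam _)%E; apply/seteqP; split => [w /= e|w []//]; split => //=.
  by rewrite (w0 w e) (wn w e).
rewrite !lam_path_window /= eqSS; case: ifP => _; last by rewrite mule0.
rewrite -EFinM; congr EFin.
by rewrite /path_weight big_ord_recl /= e1.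
Qed.

End PathMeasureBounds.

(** * Exponential bounds for trajectories that outrun the cone *)

Section PathMeasureExponential.
Variables (R : realType) (q : R) (Px : int -> probability Wt R).
Hypothesis q01 : 0 < q < 1.
Hypothesis hPx : forall x, lazy_walk_law q x (Px x).
Local Notation lam := (lam Px).

Definition step_mgf (th : R) : R := q + (1 - q) / 2 * (expR th + expR (- th)).

Lemma step_mgf_ge0 th : 0 <= step_mgf th.
Proof.
have /andP[q0 q1] := q01.
have h : 0 <= (1 - q) / 2 by lra.
by rewrite /step_mgf addr_ge0 ?(ltW q0)// mulr_ge0// addr_ge0// expR_ge0.
Qed.

(** Chernoff's bound by induction on [n], splitting off one step with [lam_markov], so that no
    exponential is ever integrated. It has its usual form because [lam] gives mass 1 to the paths at
    [x0] at time [s]. *)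
Lemma lam_chernoff th s n x0 (b : R) : 0 < th ->
  (lam [set w : Wt | w s = x0 /\ (b <= (w (s + n%:Z) - x0)%R%:~R)%R] <=
   (expR (- (th * b)) * step_mgf th ^+ n)%:E)%E.
Proof.
move=> th0.
have mE (s' x' : int) n' (b' : R) :
    measurable [set w : Wt | w s' = x' /\ (b' <= (w (s' + n'%:Z) - x')%:~R)%R].
  to_mpred; apply: mpred_and; first exact: discrete_mfun_coord.
  apply: (@mpred_bind _ _ _ (fun w : Wt => w (s' + n'%:Z)) (fun a _ => b' <= (a - x')%:~R)).
    exact: discrete_mfun_coord.
  by move=> a; exact: mpred_const.
elim: n s x0 b => [|n IH] s x0 b.
  rewrite expr0 mulr1; have [b0|b0] := leP b 0.
    apply: (@le_trans _ _ (lam [set w | path_window s 0 w = [:: x0]])).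
      apply: le_measure; rewrite ?inE; [exact: mE|exact: discrete_mfun_path_window|].
      move=> w /= [h _]; apply/path_windowP; split => // -[|//] _.
      by rewrite addr0.
    rewrite (lam_path_window q01 hPx) eqxx /path_weight big_ord0 lee_fin -expR0 ler_expR.
    by rewrite oppr_ge0 pmulr_rle0.
  rewrite (_ : [set w | _] = set0) ?measure0 ?lee_fin ?expR_ge0//.
  apply/seteqP; split => // w /= [h]; by rewrite addr0 h subrr leNgt b0.
rewrite (measure_fibers (discrete_mfun_coord (s + 1)))//.
apply: (@le_trans _ _ (\esum_(x1 in setT) (lazy_step q (x1 - x0) *
    (expR (- (th * (b - (x1 - x0)%:~R))) * step_mgf th ^+ n))%:E)); last first.
  rewrite (esum_lazy_step (g := fun x1 =>
    expR (- (th * (b - (x1 - x0)%:~R))) * step_mgf th ^+ n))//; last first.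
    by move=> x1; rewrite mulr_ge0 ?expR_ge0 ?exprn_ge0 ?step_mgf_ge0.
  rewrite subrr lee_fin exprS mulrCA !mulrA.
  have -> : x0 + 1 - x0 = 1 by lia.
  have -> : x0 - 1 - x0 = -1 by lia.
  have -> : - (th * (b - 1%:~R)) = - (th * b) + th by ring.
  have -> : - (th * (b - (-1)%:~R)) = - (th * b) - th by ring.
  have -> : - (th * (b - 0%:~R)) = - (th * b) by ring.
  rewrite !expRD /step_mgf.
  by rewrite le_eqVlt; apply/orP; left; apply/eqP; ring.
apply: le_esum => x1 _.
rewrite EFinM.
have -> : [set w : Wt | w s = x0 /\ (b <= (w (s + n.+1%:Z) - x0)%:~R)%R] `&` [set x | x (s + 1) = x1] =
  [set w : Wt | [/\ w s = x0, w (s + 1) = x1 & b + x0%:~R <= (w (s + 1 + n%:Z))%:~R]].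
  have e : s + n.+1%:Z = s + 1 + n%:Z by lia.
  rewrite e; apply/seteqP; split => w /=; rewrite intrB.
    by move=> [[h1 h2] h3]; split => //; lra.
  by move=> [h1 h2 h3]; split => //; split => //; lra.
rewrite (lam_markov q01 hPx) lee_wpmul2l ?lee_fin ?lazy_step_ge0//.
rewrite (_ : [set w | _] = [set w : Wt | w (s + 1) = x1 /\ (b - (x1 - x0)%:~R <= (w (s + 1 + n%:Z) - x1)%:~R)%R]).
  exact: IH.
apply/seteqP; split => w /= [h1 h2]; split => //; move: h2; rewrite !intrB; lra.
Qed.

(** By symmetry of the step the moment generating function is [1 + O(th^2)], whereas the slope of
    the cone gains a factor of first order in [th]. Everything follows from [1 + x <= expR x], which
    bounds [expR th + expR (- th)] by [2 / (1 - th^2)]. *)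
Lemma exists_contracting_exponent (vb : R) : 0 < vb <= 1 ->
  exists th : R, 0 < th /\ expR (- (th * vb)) * step_mgf th < 1.
Proof.
move=> /andP[v0 v1]; have /andP[q0 q1] := q01.
(* With this choice [th * vb = 2 * th^2], which beats the excess [1 / (1 - th^2) - 1] as soon as
   [th^2 < 1/2]. *)
pose th := vb / 2; have th0 : 0 < th by rewrite /th; lra.
have th12 : th <= 1 / 2 by rewrite /th; lra.
exists th; split => //.
have h1 : expR th <= (1 - th)^-1.
  rewrite -[expR th]invrK -expRN lef_pV2 ?posrE ?expR_gt0 ?subr_gt0//; last by lra.
  by have := expR_ge1Dx (- th); lra.
have h2 : expR (- th) <= (1 + th)^-1.
  rewrite expRN lef_pV2 ?posrE ?expR_gt0//; last by lra.
  exact: expR_ge1Dx.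
have h3 : 1 + 2 * th ^+ 2 <= expR (th * vb).
  apply: le_trans (expR_ge1Dx _).
  by have -> : th * vb = 2 * th ^+ 2 by rewrite /th; field.
have e3 : expR (- (th * vb)) = (expR (th * vb))^-1 by rewrite expRN.
rewrite e3 mulrC ltr_pdivrMr ?expR_gt0// mul1r.
apply: lt_le_trans h3.
have th2 : 0 < th ^+ 2 by rewrite exprn_gt0.
have th2' : th ^+ 2 <= 1 / 4.
  have -> : 1 / 4 = (1 / 2) ^+ 2 :> R by field.
  by rewrite lerXn2r// nnegrE; lra.
pose t := th ^+ 2; rewrite -/t in th2 th2' *.
have t1 : 0 < 1 - t by lra.
have h4 : expR th + expR (- th) <= 2 * (1 - t)^-1.
  have -> : 2 * (1 - t)^-1 = (1 - th)^-1 + (1 + th)^-1.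
    have n1 : 1 - th != 0 by apply: lt0r_neq0; lra.
    have n2 : 1 + th != 0 by apply: lt0r_neq0; lra.
    have -> : 1 - t = (1 - th) * (1 + th) by rewrite /t; ring.
    by field; rewrite n1 n2.
  exact: lerD.
pose A := (1 - t)^-1; rewrite -/A in h4 *.
have A1 : A * (1 - t) = 1 by rewrite mulVf// lt0r_neq0.
have A0 : 0 < A by rewrite invr_gt0.
have h7 : 0 <= A - 1.
  have -> : A - 1 = A * t by rewrite -[X in _ - X]A1; ring.
  by rewrite mulr_ge0// ltW.
have h6 : A < 1 + 2 * t.
  have : 0 < A * (t * (1 - 2 * t)) by rewrite !mulr_gt0//; lra.
  have -> : A * (t * (1 - 2 * t)) = A * (1 - t) * (1 + 2 * t) - A by ring.
  by rewrite A1; lra.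
have h8 : 0 <= q * (A - 1) by rewrite mulr_ge0// ltW.
have h9 : (1 - q) / 2 * (expR th + expR (- th)) <= (1 - q) / 2 * (2 * A).
  by apply: ler_wpM2l => //; lra.
have h10 : (1 - q) / 2 * (2 * A) = A - q * A by field.
by rewrite /step_mgf; lra.
Qed.

End PathMeasureExponential.

Lemma measurable_path_set (Q : int -> Prop) (n : int) : mpred (fun w : Wt => Q (w n)).
Proof.
apply: (@mpred_bind _ _ _ (fun w : Wt => w n) (fun a _ => Q a)); first exact: discrete_mfun_coord.
by move=> a; exact: mpred_const.
Qed.

Section Climbers.
Variables (R : realType) (q : R) (Px : int -> probability Wt R).
Hypothesis q01 : 0 < q < 1.
Hypothesis hPx : forall x, lazy_walk_law q x (Px x).
Local Notation lam := (lam Px).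
Variable (vb : R).

(* [x - vb * n] is the level of the space-time point [(x, n)]: both kinds of cones are level
   sets restricted to one side of time. *)
Definition climbers (s : int) (al be : R) : set Wt :=
  [set w : Wt | (exists t0 : int, t0 <= s /\ (w t0)%:~R - vb * t0%:~R < al) /\
           (exists t1 : int, s <= t1 /\ be <= (w t1)%:~R - vb * t1%:~R)].

Lemma measurable_climbers s al be : measurable (climbers s al be).
Proof.
rewrite /climbers; to_mpred; apply: mpred_and.
  apply: mpred_ex => t0; apply: mpred_and; first exact: mpred_const.
  exact: (@measurable_path_set (fun a => a%:~R - vb * t0%:~R < al)).
apply: mpred_ex => t0; apply: mpred_and; first exact: mpred_const.
exact: (@measurable_path_set (fun a => be <= a%:~R - vb * t0%:~R)).
Qed.

(** Climbers are sorted by a time [s - u] at which they are below [al], a time [s + v] at which they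
    are above [be], and their depth [j] below [al] at the former. The contracting exponent makes the
    bound geometric in [u] and [v], and [expR (- th)] makes it geometric in [j]; none of this
    depends on [s]. *)
Lemma lam_climbers : 0 < vb <= 1 -> exists K th : R, [/\ 0 < K, 0 < th &
  forall s al be, (lam (climbers s al be) <= (K * expR (- (th * (be - al))))%:E)%E].
Proof.
move=> vb01; have [th [th0 r1]] := exists_contracting_exponent q01 vb01.
set r := expR (- (th * vb)) * step_mgf q th in r1.
have r0 : 0 <= r by rewrite /r mulr_ge0 ?expR_ge0 ?step_mgf_ge0.
have r01 : 0 <= r < 1 by rewrite r0.
pose g := expR (- th).
have g01 : 0 <= g < 1 by rewrite /g expR_ge0 -expR0 ltr_expR; lra.
exists ((1 - g)^-1 * (1 - r)^-1 * (1 - r)^-1), th.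
split => //; first by rewrite !mulr_gt0 ?invr_gt0; lra.
move=> s al be.
(* At time [s - u] the largest integer position of level below [al] is the ceiling minus 1; [x0 u j]
   is [j] units further left. *)
pose x0 (u j : nat) : int := Num.ceil (al + vb * (s - u%:Z)%:~R) - 1 - j%:Z.
pose b u v j : R := be + vb * (s + v%:Z)%:~R - (x0 u j)%:~R.
pose F u v j : set Wt := [set w : Wt | w (s - u%:Z) = x0 u j /\
  b u v j <= (w (s - u%:Z + (u + v)%N%:Z) - x0 u j)%:~R].
have mF' u v j : measurable (F u v j).
  rewrite /F; to_mpred; apply: mpred_and; first exact: discrete_mfun_coord.
  exact: (@measurable_path_set (fun a => b u v j <= (a - x0 u j)%:~R)).
have hF u v j : (lam (F u v j) <= (expR (- (th * (be - al))) * r ^+ u * r ^+ v * g ^+ j)%:E)%E.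
  apply: le_trans (lam_chernoff q01 hPx _ _ _ _ th0) _.
  rewrite lee_fin /r !exprMn /g -!expRM_natl.
  have -> : expR (- (th * (be - al))) * (expR (u%:R * - (th * vb)) * step_mgf q th ^+ u) *
    (expR (v%:R * - (th * vb)) * step_mgf q th ^+ v) * expR (j%:R * - th) =
    expR (- (th * (be - al)) + u%:R * - (th * vb) + v%:R * - (th * vb) + j%:R * - th) * step_mgf q th ^+ (u + v).
    by rewrite !expRD exprD; ring.
  rewrite ler_wpM2r ?exprn_ge0 ?step_mgf_ge0// ler_expR.
  have hx0 : (x0 u j)%:~R <= al + vb * (s - u%:Z)%:~R - j%:R.
    rewrite /x0; have /andP[+ _] := ceil_itv (al + vb * (s - u%:Z)%:~R).
    by rewrite !intrB; lra.
  have hb : be - al + vb * (u%:R + v%:R) + j%:R <= b u v j.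
    have e : (s + v%:Z)%:~R = (s - u%:Z)%:~R + (u%:R + v%:R) :> R.
      by rewrite -[u%:R]/(u%:Z%:~R) -[v%:R]/(v%:Z%:~R) -!intrD; congr (_%:~R); lia.
    by rewrite /b e mulrDr; lra.
  have : th * (be - al + vb * (u%:R + v%:R) + j%:R) <= th * b u v j by rewrite ler_pM2l.
  lra.
have cov : climbers s al be `<=` \bigcup_j (\bigcup_v (\bigcup_u F u v j)).
  move=> w [[t0 [t0s h0]] [t1 [t1s h1]]].
  have [u eu] : exists u : nat, t0 = s - u%:Z.
    by exists (absz (s - t0)%R); clear -t0s; lia.
  have [v ev] : exists v : nat, t1 = s + v%:Z.
    by exists (absz (t1 - s)%R); clear -t1s; lia.
  have hw : w t0 < Num.ceil (al + vb * t0%:~R) by rewrite ceil_gt_int; lra.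
  have [j ex] : exists j, w t0 = x0 u j.
    rewrite /x0 -eu; move: (Num.ceil _) hw => c hw.
    by exists (absz (c - 1 - w t0)%R); clear -hw; lia.
  exists j => //; exists v => //; exists u => //; split; rewrite -eu //.
  have -> : t0 + (u + v)%N%:Z = t1 by clear -eu ev; rewrite eu ev; lia.
  by rewrite -ex /b -ev -ex intrB; lra.
apply: le_trans (_ : _ <= (expR (- (th * (be - al))) * (1 - r)^-1 * (1 - r)^-1 / (1 - g))%:E)%E _; last first.
  by rewrite lee_fin le_eqVlt; apply/orP; left; apply/eqP; ring.
have e0 : 0 <= expR (- (th * (be - al))) by exact: expR_ge0.
have ir0 : 0 <= (1 - r)^-1 by rewrite invr_ge0; lra.
have g0 : 0 <= g by rewrite /g expR_ge0.
apply: (geometric_cover _ _ cov) => //.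
- exact: measurable_climbers.
- by move=> j; do 2 (apply: bigcupT_measurable => ?).
- by rewrite !mulr_ge0.
move=> j; rewrite mulrAC.
apply: (@geometric_cover _ _ _ _ _ (fun v => \bigcup_u F u v j)) => //.
- by do 2 (apply: bigcupT_measurable => ?).
- by move=> v; apply: bigcupT_measurable => ?.
- by rewrite !mulr_ge0 ?exprn_ge0.
move=> v.
have -> : expR (- (th * (be - al))) * (1 - r)^-1 * g ^+ j * r ^+ v =
  expR (- (th * (be - al))) * g ^+ j * r ^+ v / (1 - r) by ring.
apply: (@geometric_cover _ _ _ _ _ (fun u => F u v j)) => //.
- by apply: bigcupT_measurable => ?.
- by rewrite !mulr_ge0 ?exprn_ge0.
move=> u; apply: le_trans (hF u v j) _.
by rewrite lee_fin le_eqVlt; apply/orP; left; apply/eqP; ring.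
Qed.

End Climbers.

(** * Environments and independence *)

(* The atoms of the point process, without their multiplicities, and the uniforms: the law of
   the process is determined by its avoidance probabilities. *)
Definition conf (R : realType) : Type := (set Wt * (pt -> R))%type.
HB.instance Definition _ (R : realType) := gen_eqMixin (conf R).
HB.instance Definition _ (R : realType) := gen_choiceMixin (conf R).
HB.instance Definition _ (R : realType) := isPointed.Build (conf R) (set0, fun=> 0).

Section Environment.
Variable R : realType.

Definition basic (D : set Wt) (ys : seq pt) (b : pt -> R) : set (conf R) :=
  [set c | (forall w, c.1 w -> ~ D w) /\ (forall y, y \in ys -> c.2 y <= b y)].

Definition basics : set (set (conf R)) :=
  [set E | exists D ys b, [/\ measurable D, uniq ys, forall y, 0 <= b y <= 1 & E = basic D ys b]].

End Environment.

HB.instance Definition _ (R : realType) :=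
  Measurable.copy (conf R) (g_sigma_algebraType (@basics R)).

Section EnvironmentTheory.
Variable R : realType.
Notation env := (conf R).
Notation basics := (@basics R).

Lemma measurable_basic D ys b : measurable D -> uniq ys -> (forall y, 0 <= b y <= 1) ->
  measurable (basic D ys b : set env).
Proof. by move=> *; apply: sub_sigma_algebra; exists D, ys, b. Qed.

Lemma basicsI : setI_closed basics.
Proof.
move=> _ _ [D1 [ys1 [b1 [mD1 u1 hb1 ->]]]] [D2 [ys2 [b2 [mD2 u2 hb2 ->]]]].
(* Threshold 1 stands for the absence of a constraint: it is neutral in a minimum of thresholds in
   [[0, 1]]. *)
exists (D1 `|` D2), (undup (ys1 ++ ys2)), (fun y => Order.min
  (if y \in ys1 then b1 y else 1) (if y \in ys2 then b2 y else 1)).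
split; [exact: measurableU|exact: undup_uniq| |].
  move=> y; have /andP[? ?] := hb1 y; have /andP[? ?] := hb2 y.
  by rewrite le_min ge_min; case: ifP => _; case: ifP => _; lra.
apply/seteqP; split => c /=.
  move=> [[h1 h2] [h3 h4]]; split; first by move=> w cw [/(h1 w cw)|/(h3 w cw)].
  move=> y; rewrite mem_undup mem_cat le_min.
  case: ifP => y1; case: ifP => y2 //= _.
  - by rewrite h2 ?h4.
  - by rewrite h2//=; apply: (le_trans (h2 y y1)); have /andP[] := hb1 y.
  - by rewrite h4// andbT; apply: (le_trans (h4 y y2)); have /andP[] := hb2 y.
move=> [h1 h2]; split; split.
- by move=> w cw Dw; apply: (h1 w cw); left.
- by move=> y y1; have := h2 y; rewrite mem_undup mem_cat y1 => /(_ isT); rewrite le_min => /andP[].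
- by move=> w cw Dw; apply: (h1 w cw); right.
- move=> y y1; have := h2 y; rewrite mem_undup mem_cat y1 orbT => /(_ isT).
  by rewrite le_min => /andP[].
Qed.

Lemma mpred_avoid D : measurable D -> mpred (fun c : env => forall w, c.1 w -> ~ D w).
Proof.
move=> mD; apply: (mpred_eq (Phi := basic D [::] (fun=> 0))); last first.
  apply: measurable_basic => //.
  by move=> y; rewrite lexx ler01.
by move=> c; split => [[]|h].
Qed.

Lemma mpred_uniform y (b : R) : 0 <= b <= 1 -> mpred (fun c : env => c.2 y <= b).
Proof.
move=> hb; apply: (mpred_eq (Phi := basic set0 [:: y] (fun=> b))); last exact: measurable_basic.
move=> c; split => [[_ h]|h]; first by apply: h; exact: mem_head.
by split => [w _ []|z]; rewrite mem_seq1 => /eqP ->.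
Qed.

Definition agree (A : set Wt) (B : set pt) (c c' : conf R) :=
  (forall w, A w -> c.1 w <-> c'.1 w) /\ (forall y, B y -> c.2 y = c'.2 y).

Lemma agree_sym A B c c' : agree A B c c' -> agree A B c' c.
Proof. by move=> [h1 h2]; split => [w /h1 [] //|y /h2 ->]. Qed.

Lemma agreeS A B A' B' c c' : A' `<=` A -> B' `<=` B -> agree A B c c' -> agree A' B' c c'.
Proof. by move=> hA hB [h1 h2]; split => [w /hA/h1|y /hB/h2]. Qed.

(** Locality as invariance under changes elsewhere, rather than through a sub-sigma-algebra: such an
    event is its own preimage under [crestrict A B]. *)
Definition dep (A : set Wt) (B : set pt) (E : conf R -> Prop) :=
  forall c c', agree A B c c' -> E c -> E c'.

(** The reset value 0 is deliberate: a uniform equal to 0 sends the walk to the right whether or not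
    the site is occupied. *)
Definition crestrict (A : set Wt) (B : set pt) (c : conf R) : conf R :=
  (c.1 `&` A, fun y => if y \in B then c.2 y else 0).

Lemma agree_crestrict A B c : agree A B c (crestrict A B c).
Proof.
split => [w Aw|y By] /=; first by split => [|[]].
by rewrite mem_set.
Qed.

(** A site outside [B] is reset to 0, which is below every threshold in [[0, 1]], so its constraint
    disappears. *)
Lemma crestrict_basic A B D ys b : (forall y, 0 <= b y <= 1) ->
  crestrict A B @^-1` basic D ys b = basic (D `&` A) [seq y <- ys | y \in B] b.
Proof.
move=> hb; apply/seteqP; split => c /= [h1 h2]; split.
- by move=> w cw [Dw Aw]; apply: (h1 w).
- by move=> y; rewrite mem_filter => /andP[yB yys]; have /= := h2 y yys; rewrite yB.
- by move=> w [cw Aw] Dw; apply: (h1 w).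
- move=> y yys /=; case: ifP => yB; first by apply: h2; rewrite mem_filter yB.
  by have /andP[] := hb y.
Qed.

Lemma measurable_crestrict A B : measurable A ->
  measurable_fun setT (crestrict A B : env -> env).
Proof.
move=> mA; apply: (@measurability _ _ _ _ setT (crestrict A B : env -> env) basics) => //.
move=> _ [_ [D [ys [b [mD uys hb ->]]]] <-].
rewrite setTI crestrict_basic//.
by apply: measurable_basic; [exact: measurableI|exact: filter_uniq|].
Qed.

Section Independence.
Variables (mu : probability env R) (av : set Wt -> R).
Hypothesis mu_basic : forall D ys b, measurable D -> uniq ys -> (forall y, 0 <= b y <= 1) ->
  mu (basic D ys b) = (av D * \prod_(y <- ys) b y)%:E.
Hypothesis avU : forall D D', measurable D -> measurable D' -> D `&` D' = set0 ->
  av (D `|` D') = av D * av D'.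

(** Both events are preimages under restrictions. On [basics] the product formula is
    multiplicativity of [av] on disjoint sets; two successive monotone class arguments extend it,
    one event at a time. *)
Lemma independence A1 B1 A2 B2 (E F : set env) :
  measurable A1 -> measurable A2 -> A1 `&` A2 = set0 -> B1 `&` B2 = set0 ->
  measurable E -> measurable F -> dep A1 B1 E -> dep A2 B2 F ->
  (mu (E `&` F) = mu E * mu F)%E.
Proof.
move=> mA1 mA2 A12 B12 mE mF dE dF.
pose r1 : env -> env := crestrict A1 B1; pose r2 : env -> env := crestrict A2 B2.
have mr1 G : measurable G -> measurable (r1 @^-1` G).
  by move=> mG; have := measurable_crestrict B1 mA1 measurableT mG; rewrite setTI.
have mr2 G : measurable G -> measurable (r2 @^-1` G).
  by move=> mG; have := measurable_crestrict B2 mA2 measurableT mG; rewrite setTI.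
have preE A B (G : set env) : dep A B G -> G = crestrict A B @^-1` G.
  move=> dG; apply/seteqP; split => c; first by apply: dG; exact: agree_crestrict.
  by apply: dG; apply: agree_sym; exact: agree_crestrict.
suff h : forall G, measurable G -> forall H, measurable H ->
    (mu (r1 @^-1` G `&` r2 @^-1` H) = mu (r1 @^-1` G) * mu (r2 @^-1` H))%E.
  by rewrite (preE _ _ _ dE) (preE _ _ _ dF); exact: h.
(* Stated for an abstract operation [m] with the properties of a preimage, so that it serves for
   either of the two restrictions. *)
have lsys (m : set env -> set env) (X : set env) : measurable X ->
    (forall G, measurable G -> measurable (m G)) -> m setT = setT ->
    (forall G H, m (G `\` H) = m G `\` m H) -> (forall G H, G `<=` H -> m G `<=` m H) ->
    (forall G : nat -> set env, m (\bigcup_n G n) = \bigcup_n m (G n)) ->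
    lambda_system setT [set G : set env | measurable G /\ (mu (m G `&` X) = mu (m G) * mu X)%E].
  move=> mX mm mT mDD mS mU; split => //.
  - by split => //; rewrite mT setTI probability_setT mul1e.
  - move=> G H HG [mG hG] [mH hH]; split; first exact: measurableD.
    have fin Z : measurable Z -> mu Z \is a fin_num by move=> mZ; exact: fin_num_measure.
    have sub : m H `<=` m G by exact: mS.
    have mXG : measurable (m G `&` X) by apply: measurableI => //; exact: mm.
    have lty Z : measurable Z -> (mu Z < +oo)%E.
      by move=> mZ; apply: le_lt_trans (probability_le1 mu mZ) (ltry 1).
    rewrite mDD [_ `&` X]setIC setIDA [X `&` _]setIC (measureD mXG (mm _ mH) (lty _ mXG)).
    rewrite (measureD (mm _ mG) (mm _ mH) (lty _ (mm _ mG))).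
    rewrite -setIA [X `&` _]setIC setIA !(setIidr sub).
    transitivity (mu (m G) * mu X - mu (m H) * mu X)%E; first by congr (_ - _)%E.
    rewrite muleBl//.
      by rewrite fin//; exact: mm.
    by rewrite fin_num_adde_defr// fin//; exact: mm.
  - move=> G ndG hG; split.
      by apply: bigcupT_measurable => n; have [] := hG n.
    have mGn n : measurable (m (G n)) by apply: mm; have [] := hG n.
    have c1 : mu (m (G n)) @[n --> \oo] --> mu (m (\bigcup_n G n)).
      rewrite mU; apply: nondecreasing_cvg_mu => //; first exact: bigcupT_measurable.
      by move=> i j ij; apply/subsetPset; apply: mS; apply/subsetPset/ndG.
    have c2 : mu (m (G n) `&` X) @[n --> \oo] --> mu (m (\bigcup_n G n) `&` X).
      rewrite mU setI_bigcupl; apply: nondecreasing_cvg_mu => //.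
      - by move=> n; exact: measurableI.
      - by apply: bigcupT_measurable => n; exact: measurableI.
      - by move=> i j ij; apply/subsetPset; apply: setSI; apply: mS; apply/subsetPset/ndG.
    have c3 : (mu (m (G n)) * mu X)%E @[n --> \oo] --> (mu (m (\bigcup_n G n)) * mu X)%E.
      by apply: cvgeZr => //; exact: fin_num_measure.
    have e : (fun n => mu (m (G n) `&` X)) = (fun n => mu (m (G n)) * mu X)%E.
      by apply/funext => n; have [] := hG n.
    by rewrite e in c2; exact: (cvg_unique _ c2 c3).
have base : forall G, basics G -> forall H, basics H ->
    (mu (r1 @^-1` G `&` r2 @^-1` H) = mu (r1 @^-1` G) * mu (r2 @^-1` H))%E.
  move=> _ [D1 [ys1 [b1 [mD1 u1 hb1 ->]]]] _ [D2 [ys2 [b2 [mD2 u2 hb2 ->]]]].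
  rewrite !crestrict_basic//.
  set z1 := [seq _ <- _ | _]; set z2 := [seq _ <- _ | _].
  have z12 y : y \in z1 -> y \notin z2.
    rewrite !mem_filter => /andP[yB1 _]; apply/negP => /andP[yB2 _].
    by have : set0 y by rewrite -B12; split; exact: set_mem.
  pose b y := if y \in z1 then b1 y else b2 y.
  have -> : basic (D1 `&` A1) z1 b1 `&` basic (D2 `&` A2) z2 b2 =
            basic ((D1 `&` A1) `|` (D2 `&` A2)) (z1 ++ z2) b.
    apply/seteqP; split => c /=.
      move=> [[h1 h2] [h3 h4]]; split; first by move=> w cw [/(h1 w cw)|/(h3 w cw)].
      by move=> y; rewrite mem_cat /b; case: ifP => [/h2//|_ /h4].
    move=> [h1 h2]; split; split.
    - by move=> w cw Dw; apply: (h1 w cw); left.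
    - by move=> y y1; have := h2 y; rewrite mem_cat /b y1 => /(_ isT).
    - by move=> w cw Dw; apply: (h1 w cw); right.
    - move=> y y2; have := h2 y; rewrite mem_cat /b y2 orbT => /(_ isT).
      by case: ifP => // /z12; rewrite y2.
  rewrite !mu_basic//; try exact: measurableI; try exact: filter_uniq; last 3 first.
  - by apply: measurableU; exact: measurableI.
  - rewrite cat_uniq !filter_uniq// andbT/=; apply/hasPn => y y2; apply/negP => y1.
    by have := z12 y y1; rewrite y2.
  - by move=> y; rewrite /b; case: ifP.
  rewrite -EFinM avU; [|exact: measurableI|exact: measurableI|]; last first.
    by apply/seteqP; split => // w [[_ w1] [_ w2]]; rewrite -A12.
  rewrite big_cat /= mulrACA; congr (_ * _ * (_ * _))%:E; apply: eq_big_seq => y hy; rewrite /b ?hy//.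
  by case: ifP => // /z12; rewrite hy.
have half : forall G, basics G -> forall H, measurable H ->
    (mu (r1 @^-1` G `&` r2 @^-1` H) = mu (r1 @^-1` G) * mu (r2 @^-1` H))%E.
  move=> G bG H mH.
  have mG : measurable (r1 @^-1` G) by apply: mr1; exact: sub_sigma_algebra.
  have := @lambda_system_subset _ basics basicsI setT _ (lsys (fun G => r2 @^-1` G) _ mG mr2
    (preimage_setT _) (fun _ _ => erefl) (fun _ _ h => preimage_subset h)
    (fun _ => erefl)).
  move=> /(_ _ (fun _ _ => @subsetT _ _) H mH) [|_].
    move=> K bK; split; first exact: sub_sigma_algebra.
    by rewrite setIC base// muleC.
  by rewrite setIC muleC.
move=> G mG H mH.
have := @lambda_system_subset _ basics basicsI setT _ (lsys (fun G => r1 @^-1` G) _ (mr2 _ mH) mr1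
    (preimage_setT _) (fun _ _ => erefl) (fun _ _ h => preimage_subset h)
    (fun _ => erefl)).
move=> /(_ _ (fun _ _ => @subsetT _ _) G mG) [|_ //].
by move=> K bK; split; [exact: sub_sigma_algebra|exact: half].
Qed.

End Independence.
End EnvironmentTheory.

(** * Space-time shifts of environments *)

Definition ptadd (z y : pt) : pt := (z.1 + y.1, z.2 + y.2).

(** The environment seen from [y]. The image of the trajectories under [path_shift y] is written as
    a preimage under the inverse shift, so that membership just unfolds. *)
Definition cshift (R : realType) (y : pt) (c : conf R) : conf R :=
  ([set w | c.1 (path_shift (- y.1, - y.2) w)], fun z => c.2 (ptadd z y)).

Lemma path_shiftK y w : path_shift (- y.1, - y.2) (path_shift y w) = w.
Proof. by apply/funext => n; rewrite /path_shift /= subrK opprK subrK. Qed.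

Lemma path_shiftVK y w : path_shift y (path_shift (- y.1, - y.2) w) = w.
Proof. by apply/funext => n; rewrite /path_shift /= addrK opprK addrK. Qed.

Section ShiftInvariance.
Variable R : realType.
Notation env := (conf R).

Lemma cshift_basic y D ys b : cshift y @^-1` (basic D ys b : set env) =
  basic (path_shift y @^-1` D) [seq ptadd z y | z <- ys]
    (fun z => b (ptadd z (- y.1, - y.2))).
Proof.
apply/seteqP; split => c /= [h1 h2]; split.
- by move=> w cw; apply: h1; rewrite /= path_shiftK.
- move=> _ /mapP[z zys ->]; have -> : ptadd (ptadd z y) (- y.1, - y.2) = z.
    by case: z {zys} => z1 z2; rewrite /ptadd /= !addrK.
  exact: h2.
- by move=> w /= cw Dw; apply: (h1 _ cw); rewrite /preimage /= path_shiftVK.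
- move=> z zys /=; have -> : z = ptadd (ptadd z y) (- y.1, - y.2).
    by case: z {zys} => z1 z2; rewrite /ptadd /= !addrK.
  by have := h2 _ (map_f (fun z => ptadd z y) zys); rewrite /ptadd /= !addrK.
Qed.

Lemma ptadd_inj y : injective (fun z => ptadd z y).
Proof. by move=> [a1 a2] [b1 b2] [/addIr -> /addIr ->]. Qed.

Lemma measurable_cshift y : measurable_fun setT (cshift y : env -> env).
Proof.
apply: (@measurability _ _ _ _ setT (cshift y : env -> env) (@basics R)) => //.
move=> _ [_ [D [ys [b [mD uys hb ->]]]] <-].
rewrite setTI cshift_basic; apply: measurable_basic => //.
  by have := measurable_path_shift y measurableT mD; rewrite setTI.
by rewrite map_inj_uniq//; exact: ptadd_inj.
Qed.

Lemma mu_cshift (mu : probability env R) (av : set Wt -> R) y (E : set env) :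
  (forall D ys b, measurable D -> uniq ys -> (forall y, 0 <= b y <= 1) ->
    mu (basic D ys b) = (av D * \prod_(y <- ys) b y)%:E) ->
  (forall z D, measurable D -> av (path_shift z @^-1` D) = av D) ->
  measurable E -> mu (cshift y @^-1` E) = mu E.
Proof.
move=> mub avs mE.
pose pf : {measure set env -> \bar R} := pushforward mu (cshift y : env -> env).
pose m2 := pf (measurable_cshift y).
have mm2 A : m2 A = mu (cshift y @^-1` A) by [].
rewrite -mm2; apply/esym.
have bT : (basic set0 [::] (fun=> 0) : set env) = setT.
  by apply/seteqP; split => // c _; split => // w _ [].
apply: (measure_unique (@basics R) (fun=> setT)) => //.
- exact: basicsI.
- move=> _; exists set0, [::], (fun=> 0); split => // _.
  by rewrite lexx ler01.
- by apply/seteqP; split => // c _; exists 0%N.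
- move=> _ [D [ys [b [mD uys hb ->]]]]; rewrite mm2 cshift_basic [LHS]mub// mub//.
  + congr (_ * _)%:E; first by rewrite avs.
    rewrite big_map; apply: eq_bigr => z _; congr (b _).
    by case: z => z1 z2; rewrite /ptadd /= !addrK.
  + by have := measurable_path_shift y measurableT mD; rewrite setTI.
  + by rewrite map_inj_uniq//; exact: ptadd_inj.
- by move=> _; apply: le_lt_trans (probability_le1 mu measurableT) (ltry 1).
Qed.

End ShiftInvariance.

(** * Avoidance probabilities and the canonical law of the environment *)

Section Law.
Variables (R : realType) (rho : R) (Px : int -> probability Wt R).
Hypothesis rho0 : 0 < rho.

Definition av (D : set Wt) : R := Defs.poisson_pmf (rho%:E * lam Px D)%E 0.

Lemma avE D : av D = if lam Px D is l%:E then expR (- (rho * l)) else 0.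
Proof.
rewrite /av; case: (lam Px D) => [l| |] /=.
- by rewrite expr0 fact0 mulr1 divr1.
- by rewrite gt0_muley ?lte_fin.
- by rewrite gt0_muleNy ?lte_fin.
Qed.

Lemma avU D D' : measurable D -> measurable D' -> D `&` D' = set0 ->
  av (D `|` D') = av D * av D'.
Proof.
move=> mD mD' DD'; rewrite !avE.
have -> : lam Px (D `|` D') = (lam Px D + lam Px D')%E by rewrite measureU.
have : (0 <= lam Px D)%E by exact: measure_ge0.
have : (0 <= lam Px D')%E by exact: measure_ge0.
case: (lam Px D) => [l| |] //; case: (lam Px D') => [l'| |] //= _ _; rewrite ?mul0r ?mulr0//.
by rewrite -expRD; congr expR; ring.
Qed.

Lemma av_gt0 D : (lam Px D < +oo)%E -> 0 < av D.
Proof.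
rewrite avE; have : (0 <= lam Px D)%E by exact: measure_ge0.
case: (lam Px D) => [l _ _|_|//]; first exact: expR_gt0.
by rewrite ltxx.
Qed.

Lemma av_ge D (L : R) : (lam Px D <= L%:E)%E -> 1 - rho * L <= av D.
Proof.
rewrite avE; have : (0 <= lam Px D)%E by exact: measure_ge0.
case: (lam Px D) => // l _; rewrite lee_fin => lL.
have := expR_ge1Dx (- (rho * l)).
have : rho * l <= rho * L by rewrite ler_pM2l.
lra.
Qed.

Lemma av0 : av set0 = 1.
Proof.
have e : lam Px set0 = 0%E by exact: measure0.
by rewrite avE e /= mulr0 oppr0 expR0.
Qed.

Lemma av_path_shift (q : R) y D : 0 < q < 1 -> (forall x, lazy_walk_law q x (Px x)) ->
  measurable D -> av (path_shift y @^-1` D) = av D.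
Proof.
move=> q01 hPx mD; rewrite /av; congr (Defs.poisson_pmf (_ * _)%E 0).
exact: (lam_path_shift q01 hPx y mD).
Qed.

Context {d : measure_display} {Omega : measurableType d}.
Variables (P : probability Omega R) (ws : Omega -> nat -> Wt) (U : Omega -> pt -> R).
Hypothesis hlaw : env_law P rho Px ws U.

Definition envmap (o : Omega) : conf R := (range (ws o), U o).

Lemma envmap_basic D ys b : envmap @^-1` basic D ys b =
  [set o | (forall i, (i < 1)%N -> omega_count_is ws o D 0) /\
               (forall y, y \in ys -> U o y <= b y)].
Proof.
have e o : omega_count_is ws o D 0 <-> forall w, (envmap o).1 w -> ~ D w.
  rewrite /omega_count_is II0; split.
    rewrite card_eq0 => /eqP h w [i _ <-] Dw; have : [set i | D (ws o i)] i by [].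
    by rewrite h.
  move=> h; rewrite card_eq0; apply/eqP/seteqP; split => // i /= Di.
  by apply: (h (ws o i)) => //; exists i.
apply/seteqP; split => o /= [h1 h2]; split => //.
  by move=> _ _; apply/e.
by apply/e; exact: (h1 0%N).
Qed.

Lemma measurable_envmap : measurable_fun setT envmap.
Proof.
have [mw [mU _]] := hlaw.
apply: (@measurability _ _ _ _ setT envmap (@basics R)) => //.
move=> _ [_ [D [ys [b [mD uys hb ->]]]] <-].
rewrite setTI; pose Q o := (forall i, ~ D (ws o i)) /\ (forall y, y \in ys -> U o y <= b y).
apply: (@mpred_eq _ _ Q).
  move=> o; split => [[h1 h2]|[h1 h2]]; split => //.
    by move=> w [i _ <-]; exact: h1.
  by move=> i; apply: h1; exists i.
apply: mpred_and; apply: mpred_all => i.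
  apply: mpred_not; have := mw i measurableT _ mD; rewrite setTI; exact.
apply: mpred_imp; first exact: mpred_const.
have := mU i measurableT _ (@measurable_itv R `]-oo, (b i)]%R); rewrite setTI.
by congr measurable; apply/seteqP; split => o /=; rewrite in_itv.
Qed.

(** The probabilistic arguments take place under this image law on configurations, where shifts and
    erasures of the environment act as maps. *)
Lemma env_distribution : exists mu : probability (conf R) R,
  (forall E, measurable E -> mu E = P (envmap @^-1` E)) /\
  (forall D ys b, measurable D -> uniq ys -> (forall y, 0 <= b y <= 1) ->
    mu (basic D ys b) = (av D * \prod_(y <- ys) b y)%:E).
Proof.
pose X : {mfun Omega >-> conf R} :=
  HB.pack envmap (isMeasurableFun.Build _ _ _ _ envmap measurable_envmap).
have muE E : distribution P X E = P (envmap @^-1` E) by [].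
exists (distribution P X); split => // D ys b mD uys hb.
apply: etrans (muE _) _; rewrite envmap_basic.
have [_ [_ h]] := hlaw.
rewrite (h 1%N (fun=> D) (fun=> 0%N) ys b) ?big_ord1 /av ?lamE//.
by move=> [|i] [|j].
Qed.

End Law.

(** * The walk, its cones and its records *)

Section FirstHit.
Implicit Types P Q : nat -> Prop.

Lemma exists_first P n : P n -> exists2 m, P m & forall j, (j < m)%N -> ~ P j.
Proof.
elim/ltn_ind: n => n IH Pn.
have [[m mn Pm]|h] := pselect (exists2 m, (m < n)%N & P m); first exact: (IH m).
by exists n => // j jn Pj; apply: h; exists j.
Qed.

Lemma first_hit_spec P : match first_hit P with
  | Some n => P n /\ (forall m, (m < n)%N -> ~ P m)
  | None => forall n, ~ P n end.
Proof.
rewrite /first_hit; set S := [set o | _].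
suff : S (xget None S) by rewrite /S /=; case: xget.
apply: xgetPex; have [[n Pn]|h] := pselect (exists n, P n).
  by have [m Pm hm] := exists_first Pn; exists (Some m).
by exists None => n Pn; apply: h; exists n.
Qed.

Lemma first_hit_some P n : first_hit P = Some n <-> P n /\ forall m, (m < n)%N -> ~ P m.
Proof.
split => [h|[Pn hn]]; first by have := first_hit_spec P; rewrite h.
have := first_hit_spec P; case: first_hit => [m [Pm hm]|/(_ n)//].
have [mn|nm|-> //] := ltngtP m n; first by have := hn _ mn.
by have := hm _ nm.
Qed.

Lemma first_hit_none P : first_hit P = None <-> forall n, ~ P n.
Proof.
split => [h|hn]; first by have := first_hit_spec P; rewrite h.
by have := first_hit_spec P; case: first_hit => // m [/hn].
Qed.

Lemma first_hit_ext P Q : (forall n, P n <-> Q n) -> first_hit P = first_hit Q.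
Proof. by move=> h; congr first_hit; apply/funext => n; apply/propext. Qed.

End FirstHit.

Section Cones.
Variables (R : realType) (vb : R).
Hypothesis vb01 : 0 < vb <= 1 / 3.

Definition level (z : pt) : R := z.1%:~R - vb * z.2%:~R.

(** Cone membership becomes a product order on time and level, so that inclusions between cones are
    instances of transitivity. *)
Lemma coneP y z : cone vb y z <-> y.2 <= z.2 /\ level y <= level z.
Proof.
have /andP[v0 v1] := vb01.
rewrite /cone /level /= !intrB; split => [[h1 [h2 h3]]|[h1 h2]].
  by split; [lia|lra].
have h3 : 0 <= z.2%:~R - y.2%:~R :> R by rewrite -intrB ler0z subr_ge0.
have h4 : 0 <= vb * (z.2%:~R - y.2%:~R) by rewrite mulr_ge0// ltW.
split; last by split; [rewrite subr_ge0|lra].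
by rewrite -(ler0z R) intrB; lra.
Qed.

Lemma rconeP y z : rcone vb y z <-> z.2 <= y.2 /\ level z < level y.
Proof.
have /andP[v0 v1] := vb01.
rewrite /rcone /level /= !intrB; split => [[h1 [h2 h3]]|[h1 h2]].
  by split; [lia|lra].
have h3 : 0 <= y.2%:~R - z.2%:~R :> R by rewrite -intrB ler0z subr_ge0.
have h4 : 0 <= vb * (y.2%:~R - z.2%:~R) by rewrite mulr_ge0// ltW.
split; last by split; [rewrite subr_le0|lra].
by rewrite -(lerz0 R) intrB; lra.
Qed.

Lemma cone_refl y : cone vb y y.
Proof. exact/coneP. Qed.

Lemma rcone_cone y z : rcone vb y z -> cone vb z y.
Proof. by move=> /rconeP[h1 h2]; apply/coneP; split => //; exact: ltW. Qed.

Lemma rcone_cone_disjoint y : rcone vb y `&` cone vb y = set0.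
Proof.
by apply/seteqP; split => // z [/rconeP[_ h1] /coneP[_ h2]]; lra.
Qed.

Lemma cone_sub y z : cone vb y z -> cone vb z `<=` cone vb y.
Proof.
move=> /coneP[h1 h2] u /coneP[h3 h4]; apply/coneP; split; [exact: le_trans h3|exact: le_trans h4].
Qed.

Lemma rcone_sub y z : cone vb y z -> rcone vb y `<=` rcone vb z.
Proof.
move=> /coneP[h1 h2] u /rconeP[h3 h4]; apply/rconeP; split; [exact: le_trans h1|exact: lt_le_trans h2].
Qed.

Lemma cone_ptadd y z u : cone vb (ptadd z y) (ptadd u y) <-> cone vb z u.
Proof.
rewrite !coneP /level /ptadd /= !intrD; split => -[h1 h2]; split.
all: try lia; lra.
Qed.

Lemma rcone_ptadd y z u : rcone vb (ptadd z y) (ptadd u y) <-> rcone vb z u.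
Proof.
rewrite !rconeP /level /ptadd /= !intrD; split => -[h1 h2]; split.
all: try lia; lra.
Qed.

Definition hit (Z : set pt) : set Wt := [set w : Wt | (trace w `&` Z) !=set0].
Notation HC y := (hit (cone vb y)).
Notation HR y := (hit (rcone vb y)).

Lemma hitP Z w : hit Z w <-> exists n, Z (w n, n).
Proof.
split => [[z [[n ->] Zz]]|[n Zn]]; first by exists n.
by exists (w n, n); split => //; exists n.
Qed.

Lemma measurable_hit Z : measurable (hit Z).
Proof.
apply: (mpred_eq (Phi := fun w : Wt => exists n, Z (w n, n))); first by move=> w; apply: iff_sym; exact: hitP.
by apply: mpred_ex => n; exact: (@measurable_path_set (fun a => Z (a, n))).
Qed.

Lemma hitS Z Z' : Z `<=` Z' -> hit Z `<=` hit Z'.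
Proof. by move=> h w [z [tz Zz]]; exists z; split => //; exact: h. Qed.

Lemma hit_path_shift (Z Z' : set pt) y w : (forall u, Z (ptadd u y) <-> Z' u) ->
  hit Z' (path_shift y w) <-> hit Z w.
Proof.
move=> h; rewrite !hitP; split => [[n /h]|[n Zn]].
  by rewrite /ptadd /path_shift /= subrK => Zn; exists (n + y.2).
exists (n - y.2); apply/h; rewrite /ptadd /path_shift /= subrK.
by have -> : n - y.2 + y.2 = n by rewrite subrK.
Qed.

End Cones.
Notation HC vb y := (hit (cone vb y)).
Notation HR vb y := (hit (rcone vb y)).

Section Walker.
Variables (R : realType) (pb pc vb : R).
Hypothesis vb01 : 0 < vb <= 1 / 3.
Notation env := (conf R).
Implicit Types c : env.
Notation HC y := (HC vb y).
Notation HR y := (HR vb y).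
Notation level := (level vb).

Definition cT c : set pt := [set z | exists2 w, c.1 w & w z.2 = z.1].
Definition goes_right c z := (cT c z /\ c.2 z <= pb) \/ (~ cT c z /\ c.2 z <= pc).
Definition cY c y i : pt := Ypath (cT c) c.2 pb pc y i.
Definition cno c y := forall w, c.1 w -> ~ Wcross vb y w.
Definition cA c y := forall i, cone vb y (cY c y i).
Definition renewal c y := cno c y /\ cA c y.
Definition cR c (k : nat) : option nat :=
  first_hit (fun n => (1 - vb) * k%:R + vb * n%:R <= (cY c (0, 0) n).1%:~R).
Definition cI c : option nat :=
  first_hit (fun k => (1 <= k)%N /\
    match cR c k with Some r => renewal c (cY c (0, 0) r) | None => False end).
Definition ctau c : option nat := match cI c with Some k => cR c k | None => None end.
Definition cZ c : option (nat * seq int) :=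
  match ctau c with
  | Some t => Some (t, [seq (cY c (0, 0) s).1 | s <- iota 0 t.+1])
  | None => None end.

Lemma cZE c : cZ c = if ctau c is Some t
  then Some (t, [seq (cY c (0, 0) s).1 | s <- iota 0 t.+1]) else None.
Proof. by []. Qed.

Lemma cYS c y i : cY c y i.+1 = let z := cY c y i in
  if `[< goes_right c z >] then (z.1 + 1, z.2 + 1) else (z.1 - 1, z.2 + 1).
Proof. by []. Qed.

Lemma cY_time c y i : (cY c y i).2 = y.2 + i%:Z.
Proof.
elim: i => [|i IH]; first by rewrite addr0.
by rewrite cYS /=; case: ifP => _ /=; rewrite IH -addn1 PoszD addrA.
Qed.

Lemma cY_add c y i j : cY c y (i + j) = cY c (cY c y i) j.
Proof. by elim: j => [|j IH]; rewrite ?addn0// addnS !cYS IH. Qed.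

Lemma cY_step c y i : (cY c y i.+1).1 = (cY c y i).1 + 1 \/ (cY c y i.+1).1 = (cY c y i).1 - 1.
Proof. by rewrite cYS /=; case: ifP => _; [left|right]. Qed.

Lemma cY_ext c c' y n :
  (forall i, (i < n)%N -> goes_right c (cY c y i) <-> goes_right c' (cY c y i)) ->
  forall i, (i <= n)%N -> cY c' y i = cY c y i.
Proof.
move=> h; elim=> [//|i IH] iLn; rewrite !cYS IH ?(ltnW iLn)//=.
by congr (if _ then _ else _); apply/asbool_equiv_eq; apply: iff_sym; exact: h.
Qed.

Lemma cT_cshift c y z : cT (cshift y c) z <-> cT c (ptadd z y).
Proof.
split => -[w cw e].
  exists (path_shift (- y.1, - y.2) w) => //.
  by rewrite /path_shift /= addrK e opprK.
exists (path_shift y w); first by rewrite /= path_shiftK.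
by rewrite /path_shift e /= addrK.
Qed.

Lemma goes_right_cshift c y z : goes_right (cshift y c) z <-> goes_right c (ptadd z y).
Proof. by rewrite /goes_right !cT_cshift. Qed.

Lemma cY_cshift c y z i : ptadd (cY (cshift y c) z i) y = cY c (ptadd z y) i.
Proof.
elim: i => [//|i IH]; rewrite !cYS -IH /=.
have -> : `[< goes_right (cshift y c) (cY (cshift y c) z i) >] =
          `[< goes_right c (ptadd (cY (cshift y c) z i) y) >].
  by apply/asbool_equiv_eq; exact: goes_right_cshift.
by case: ifP => _; rewrite /ptadd /= [_ + _ + y.2]addrAC [_ + _ + y.1]addrAC.
Qed.

Lemma WcrossE y : Wcross vb y = HC y `&` HR y.
Proof. by []. Qed.

Lemma cno_cshift c y z : cno (cshift y c) z <-> cno c (ptadd z y).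
Proof.
have e w : Wcross vb z (path_shift y w) <-> Wcross vb (ptadd z y) w.
  rewrite !WcrossE; split => -[h1 h2]; split.
  - by apply/(hit_path_shift (Z' := cone vb z) (y := y)) => // u; exact: cone_ptadd.
  - by apply/(hit_path_shift (Z' := rcone vb z) (y := y)) => // u; exact: rcone_ptadd.
  - by apply/(hit_path_shift (Z := cone vb (ptadd z y))) => // u; exact: cone_ptadd.
  - by apply/(hit_path_shift (Z := rcone vb (ptadd z y))) => // u; exact: rcone_ptadd.
split => h w cw; first by move=> /e; apply: h; rewrite /= path_shiftK.
by rewrite -(path_shiftVK y w) => /e; exact: h.
Qed.

Lemma cA_cshift c y z : cA (cshift y c) z <-> cA c (ptadd z y).
Proof.
by split => h i; have := h i; rewrite -cY_cshift => /(cone_ptadd vb01).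
Qed.

Lemma renewal_cshift c y z : renewal (cshift y c) z <-> renewal c (ptadd z y).
Proof. by rewrite /renewal cno_cshift cA_cshift. Qed.

Lemma ptadd0 y : ptadd (0, 0) y = y.
Proof. by case: y => a b; rewrite /ptadd /= !add0r. Qed.

Lemma level_cY c n : level (cY c (0, 0) n) = (cY c (0, 0) n).1%:~R - vb * n%:R.
Proof. by rewrite /level cY_time /= add0r. Qed.

(** In terms of levels, [R_k] is a first passage at height [(1 - vb) * k]. The unit [1 - vb] is the
    largest gain of level in one step, so a record overshoots by less than one unit and [R_k] is at
    least [k]. *)
Lemma cR_some c k r : cR c k = Some r <->
  (1 - vb) * k%:R <= level (cY c (0, 0) r) /\
  forall m, (m < r)%N -> level (cY c (0, 0) m) < (1 - vb) * k%:R.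
Proof.
rewrite first_hit_some level_cY lerBrDr; split => -[h1 h2]; split => // m /h2.
  by move=> /negP; rewrite -ltNge level_cY ltrBlDr.
by rewrite level_cY ltrBlDr ltNge => /negP.
Qed.

Lemma level_step c n : level (cY c (0, 0) n.+1) <= level (cY c (0, 0) n) + (1 - vb).
Proof.
rewrite !level_cY -natr1; have [->|->] := cY_step c (0, 0) n.
  by rewrite intrD; lra.
by rewrite intrB; lra.
Qed.

Lemma level_le c n : level (cY c (0, 0) n) <= (1 - vb) * n%:R.
Proof.
elim: n => [|n IH]; first by rewrite level_cY /= !mulr0 subr0.
by apply: le_trans (level_step c n) _; rewrite -natr1; lra.
Qed.

Lemma cR_past c k r m : cR c k = Some r -> (m < r)%N ->
  rcone vb (cY c (0, 0) r) (cY c (0, 0) m).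
Proof.
move=> /cR_some[h1 h2] mr; apply/rconeP => //; split; last by apply: lt_le_trans h1; exact: h2.
by rewrite !cY_time; lia.
Qed.

Lemma cR_mono c j k r : (j <= k)%N -> cR c k = Some r -> exists2 r', (r' <= r)%N & cR c j = Some r'.
Proof.
move=> jk /cR_some[h1 h2].
have jk' : (1 - vb) * j%:R <= (1 - vb) * k%:R.
  by have /andP[v0 v1] := vb01; rewrite ler_wpM2l ?ler_nat//; lra.
pose P m : Prop := (1 - vb) * j%:R <= level (cY c (0, 0) m).
have Pr : P r by exact: le_trans h1.
have [m Pm hm] := exists_first Pr.
exists m; first by rewrite leqNgt; apply/negP => /hm.
by apply/cR_some; split => // i /hm /negP; rewrite -ltNge.
Qed.

Lemma cR_cone c j k r' r : (j <= k)%N -> cR c j = Some r' -> cR c k = Some r ->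
  cone vb (cY c (0, 0) r') (cY c (0, 0) r).
Proof.
move=> jk hj hk; have [r1 r1r] := cR_mono jk hk; rewrite hj => -[e]; subst r1.
move: r1r; rewrite leq_eqVlt => /orP[/eqP->|lt]; first exact: cone_refl.
by apply: rcone_cone => //; exact: cR_past hk lt.
Qed.

Lemma cR_level_lt c k r : cR c k = Some r -> level (cY c (0, 0) r) < (1 - vb) * k.+1%:R.
Proof.
have /andP[v0 v1] := vb01.
move=> /cR_some[_]; case: r => [_|r /(_ r (ltnSn r)) h].
  by rewrite level_cY /= mulr0 subr0 mulr_gt0//; lra.
by apply: le_lt_trans (level_step c r) _; rewrite -natr1; lra.
Qed.

(** Serves to place a deterministic time before a record: what happens up to time [t <= k] is seen
    before [R_k]. *)
Lemma cR_ge c k r : cR c k = Some r -> (k <= r)%N.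
Proof.
have /andP[v0 v1] := vb01.
move=> /cR_some[h _]; have := le_trans h (level_le c r).
by rewrite ler_pM2l ?ler_nat//; lra.
Qed.

Lemma cR_prefix c c' k r n : (forall i, (i <= n)%N -> cY c' (0, 0) i = cY c (0, 0) i) ->
  (r <= n)%N -> cR c k = Some r -> cR c' k = Some r.
Proof.
move=> h rn /cR_some[h1 h2]; apply/cR_some; split; first by rewrite h.
by move=> m mr; rewrite h ?h2// (leq_trans (ltnW mr)).
Qed.

Lemma goes_right_agree c c' (Z : set pt) z : Z z ->
  (forall w, hit Z w -> c.1 w <-> c'.1 w) -> (forall u, Z u -> c.2 u = c'.2 u) ->
  goes_right c z <-> goes_right c' z.
Proof.
move=> Zz hw hu.
have e : cT c z <-> cT c' z.
  by split => -[w cw ew]; exists w => //; apply/hw => //;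
    apply/hitP; exists z.2; rewrite ew -surjective_pairing.
by rewrite /goes_right e hu.
Qed.

(* The walk before [R_k] stays in the backward cone of its position at [R_k]. *)
Lemma past_path_agree c c' k r : cR c k = Some r ->
  agree (HR (cY c (0, 0) r)) (rcone vb (cY c (0, 0) r)) c c' ->
  forall i, (i <= r)%N -> cY c' (0, 0) i = cY c (0, 0) i.
Proof.
move=> hk [h1 h2]; apply: cY_ext => i ir.
by apply: (goes_right_agree (Z := rcone vb (cY c (0, 0) r))) => //; exact: cR_past hk ir.
Qed.

Lemma future_path_agree c c' y : cA c y -> agree (HC y) (cone vb y) c c' ->
  forall i, cY c' y i = cY c y i.
Proof.
move=> hA [h1 h2] i; apply: (@cY_ext _ _ _ i) => // j _.
exact: (goes_right_agree (Z := cone vb y)).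
Qed.

Lemma cZ_some c t xs : cZ c = Some (t, xs) <-> exists k,
  [/\ (1 <= k)%N, cR c k = Some t, xs = [seq (cY c (0, 0) s).1 | s <- iota 0 t.+1],
  renewal c (cY c (0, 0) t) &
  forall j r, (1 <= j < k)%N -> cR c j = Some r -> ~ renewal c (cY c (0, 0) r)].
Proof.
rewrite /cZ /ctau; split.
  case e : (cI c) => [k|//]; case e' : (cR c k) => [t'|//] [? <-]; subst t'.
  exists k; move: e; rewrite first_hit_some e' => -[[k1 hk] hj]; split => //.
  by move=> j r /andP[j1 jk] ej hr; apply: (hj j jk); rewrite ej.
move=> [k [k1 ek -> hk hj]].
have -> : cI c = Some k.
  apply/first_hit_some; rewrite ek; split => // m mk [m1].
  by case em : (cR c m) => [r|//]; apply: (hj m) => //; rewrite m1.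
by rewrite ek.
Qed.

Lemma cZ_none c : cZ c = None <->
  forall k r, (1 <= k)%N -> cR c k = Some r -> ~ renewal c (cY c (0, 0) r).
Proof.
rewrite /cZ /ctau; split.
  case e : (cI c) => [k|].
    by move: e; rewrite first_hit_some; case: (cR c k) => [//|[[]]].
  by move: e; rewrite first_hit_none => h _ k r k1 ek hr; apply: (h k); rewrite ek.
move=> h; have -> // : cI c = None.
by apply/first_hit_none => k [k1]; case e : (cR c k) => [r|//]; exact: h k1 e.
Qed.

(** The renewal point is read off the value of the block, hence is deterministic on each event
    [cZ c = Some (t, xs)]. *)
Definition endpoint (t : nat) (xs : seq int) : pt := (last 0 xs, t%:Z).

Lemma cZ_endpoint c t xs : cZ c = Some (t, xs) -> endpoint t xs = cY c (0, 0) t.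
Proof.
move=> /cZ_some[k [_ _ -> _ _]].
rewrite /endpoint -addn1 iotaD cats1 map_rcons last_rcons.
by rewrite [RHS]surjective_pairing cY_time /= !add0r.
Qed.

End Walker.

(** * Locality of the renewal events *)

Section Renewals.
Variables (R : realType) (pb pc vb : R).
Hypothesis vb01 : 0 < vb <= 1 / 3.
Notation env := (conf R).
Implicit Types c : env.
Notation HC y := (HC vb y).
Notation HR y := (HR vb y).
Notation level := (level vb).
Notation cY := (cY pb pc).
Notation goes_right := (goes_right pb pc).
Notation cno := (cno vb).
Notation cA := (cA pb pc vb).
Notation renewal := (renewal pb pc vb).
Notation cR := (cR pb pc vb).
Notation cZ := (cZ pb pc vb).

Definition diag (y : pt) (i : nat) : pt := (y.1 + i%:Z, y.2 + i%:Z).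

Lemma diag0 y : diag y 0 = y.
Proof. by rewrite /diag !addr0 -surjective_pairing. Qed.

Lemma level_diag y i : level (diag y i) = level y + (1 - vb) * i%:R.
Proof. by rewrite /level /diag /= !intrD -!pmulrn; ring. Qed.

Lemma cone_diag y i : cone vb y (diag y i).
Proof.
have /andP[v0 v1] := vb01.
apply/(coneP vb01); split; first by rewrite /diag /=; lia.
by rewrite level_diag lerDl mulr_ge0//; lra.
Qed.

Lemma forced_path c y n : (forall i, (i < n)%N -> goes_right c (diag y i)) ->
  forall i, (i <= n)%N -> cY c y i = diag y i.
Proof.
move=> h; elim=> [_|i IH im]; first by rewrite diag0.
rewrite cYS IH ?(ltnW im)//=.
have -> : `[< goes_right c (diag y i) >] by apply/asboolP; exact: h.
by rewrite /diag /= -addn1 PoszD !addrA.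
Qed.

Lemma goes_right_small c z : c.2 z <= pb -> c.2 z <= pc -> goes_right c z.
Proof. by move=> h1 h2; rewrite /goes_right; have [h|h] := pselect (cT c z); [left|right]. Qed.

Hypotheses (pb0 : 0 <= pb) (pc0 : 0 <= pc).

(* With all uniforms equal to 0 in the cone, the walk moves to the right forever. *)
Lemma renewal_crestrict c y : renewal (crestrict (~` HC y) (~` cone vb y) c) y.
Proof.
split => [w [_ nw] [h _]|i]; first exact: nw.
rewrite (@forced_path _ _ i) => [||//]; first exact: cone_diag.
move=> j _; have z : (crestrict (~` HC y) (~` cone vb y) c).2 (diag y j) = 0.
  rewrite /crestrict /=; case: ifP => // /set_mem; case.
  exact: cone_diag.
by apply: goes_right_small; rewrite z.
Qed.

(** A trajectory crossing at an earlier point meets the backward cone of that point, hence that of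
    [y]; and a walk confined to the cone of [y] stays in the larger cone of the earlier point. Thus,
    given confinement after [y], a renewal at the earlier point is decided before [y]. *)
Lemma renewal_transfer c c' n r : let y := cY c (0, 0) n in
  (forall i, (i <= n)%N -> cY c' (0, 0) i = cY c (0, 0) i) ->
  (r <= n)%N -> cone vb (cY c (0, 0) r) y ->
  (forall w, HR y w -> c.1 w <-> c'.1 w) -> cA c' y ->
  renewal c (cY c (0, 0) r) -> renewal c' (cY c (0, 0) r).
Proof.
move=> y hp rn ry hw hA [h1 h2]; split.
  move=> w c'w; rewrite WcrossE => -[h3 h4].
  have hy : HR y w by apply: hitS h4; exact: rcone_sub.
  by apply: (h1 w); [exact/hw|].
move=> i; rewrite -{2}(hp r rn) -cY_add.
have [le|lt] := leqP (r + i) n; first by rewrite hp// cY_add; exact: h2.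
have -> : (r + i = n + (r + i - n))%N by lia.
by rewrite cY_add hp//; apply: (cone_sub vb01 ry); exact: hA.
Qed.

(** Agreement is assumed only for trajectories missing the forward cone; without crossings, every
    trajectory present in the backward cone is one of them. *)
Lemma cno_mem_equiv c c' y : cno c y -> cno c' y -> agree (~` HC y) (~` cone vb y) c c' ->
  forall w, HR y w -> c.1 w <-> c'.1 w.
Proof.
move=> n1 n2 [ha _] w hw; split => cw.
  by apply/ha => //; move=> hc; apply: (n1 w cw).
by apply/ha => //; move=> hc; apply: (n2 w cw).
Qed.

Lemma rcone_notcone y z : rcone vb y z -> ~ cone vb y z.
Proof.
move=> h1 h2; have : (rcone vb y `&` cone vb y) z by [].
by rewrite rcone_cone_disjoint.
Qed.

(** Given a renewal at [y] in both environments, the walk up to [y] and the failures of the earlier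
    records are decided outside the forward cone of [y]. The second conclusion does the same for the
    renewal at the origin, as needed under the conditional law. *)
Lemma past_transfer c c' t xs : let y := endpoint t xs in
  cZ c = Some (t, xs) -> renewal c' y -> agree (~` HC y) (~` cone vb y) c c' ->
  cZ c' = Some (t, xs) /\ (renewal c (0, 0) <-> renewal c' (0, 0)).
Proof.
move=> y hZ [c'no c'A] ha.
have ey : y = cY c (0, 0) t := cZ_endpoint hZ.
move/cZ_some : (hZ) => [k [k1 hk hxs [c_no c_A] hj]].
rewrite -ey in c_no c_A.
have hw := cno_mem_equiv c_no c'no ha.
have hp : forall i, (i <= t)%N -> cY c' (0, 0) i = cY c (0, 0) i.
  apply: (past_path_agree vb01 hk); rewrite -ey; split => // z zy.
  by apply: ha.2 => ?; exact: (rcone_notcone zy).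
have hp' i : (i <= t)%N -> cY c (0, 0) i = cY c' (0, 0) i by move=> /hp.
have hw' w : HR y w -> c'.1 w <-> c.1 w by move=> /hw h; exact: iff_sym.
have tr r : (r <= t)%N -> cone vb (cY c (0, 0) r) y ->
    renewal c (cY c (0, 0) r) <-> renewal c' (cY c (0, 0) r).
  move=> rt ry; split => h.
    by apply: (@renewal_transfer c c' t r); rewrite -?ey.
  rewrite -(hp r rt); apply: (@renewal_transfer c' c t r); rewrite ?hp -?ey//.
split; last first.
  (* The origin is the record of index 0 and [y] lies in its cone, so [tr] applies with [r = 0]. *)
  have /= h := tr 0%N (leq0n t); apply: h.
  have [r0 _ e0] := cR_mono vb01 (leq0n k) hk.
  rewrite ey; apply: (cR_cone vb01 (leq0n k) _ hk).
  apply/cR_some; split => //; rewrite level_cY //= !mulr0 subr0 //.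
apply/cZ_some; exists k; split => //.
- exact: (cR_prefix hp (leqnn t) hk).
- rewrite hxs; apply/eq_in_map => s; rewrite mem_iota add0n => /andP[_ st].
  by rewrite hp.
- by rewrite hp// -ey.
move=> j r /andP[j1 jk] e'.
have e : cR c j = Some r.
  have [r' r't e] := cR_mono vb01 (ltnW jk) hk.
  by have := cR_prefix hp r't e; rewrite e' => -[->].
have [r' r't] := cR_mono vb01 (ltnW jk) hk; rewrite e => -[er]; subst r'.
rewrite hp// => /(tr r r't _) h; apply: (hj j r _ e); first by rewrite j1.
by apply: h; rewrite ey; exact: (cR_cone vb01 (ltnW jk) e hk).
Qed.

Definition past_restrict (y : pt) c : env := crestrict (~` HC y) (~` cone vb y) c.

(** Splits the end of a block into a past and a future condition. Erasing the forward cone makes [y]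
    a renewal point by [renewal_crestrict], so both directions are instances of [past_transfer]. *)
Lemma cZ_someE c t xs : let y := endpoint t xs in
  cZ c = Some (t, xs) <-> cZ (past_restrict y c) = Some (t, xs) /\ renewal c y.
Proof.
move=> y; split => [h|[h1 h2]].
  have hr : renewal c y.
    by rewrite /y (cZ_endpoint h); move/cZ_some : h => [k []].
  split => //; apply: (past_transfer h (renewal_crestrict _ _) _).1.
  exact: agree_crestrict.
apply: (past_transfer h1 h2 _).1; apply: agree_sym; exact: agree_crestrict.
Qed.

Lemma cZ_someE_renewal c t xs : let y := endpoint t xs in
  cZ c = Some (t, xs) /\ renewal c (0, 0) <->
  (cZ (past_restrict y c) = Some (t, xs) /\ renewal (past_restrict y c) (0, 0)) /\ renewal c y.
Proof.
move=> y; split => [[h hB]|[[h1 hB] h2]].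
  have [h1 h2] := (cZ_someE c t xs).1 h; split => //; split => //.
  by apply: (past_transfer h (renewal_crestrict _ _) (agree_crestrict _ _ _)).2.1.
have ha := agree_sym (agree_crestrict (~` HC y) (~` cone vb y) c).
have [h3 h4] := past_transfer h1 h2 ha.
by split => //; apply/h4.
Qed.

Lemma renewal_agree c c' y : agree (HC y) (cone vb y) c c' -> renewal c y -> renewal c' y.
Proof.
move=> ha [h1 h2]; split.
  move=> w c'w; rewrite WcrossE => -[h3 h4]; apply: (h1 w) => //.
  by apply/ha.1.
by move=> i; rewrite (future_path_agree h2 ha).
Qed.

(** After a renewal at the origin the walk never leaves the forward cone, which contains the cones
    of all later positions; a trajectory crossing at one of these meets the cone of the origin
    too. *)
Lemma cZ_future c c' : renewal c (0, 0) -> agree (HC (0, 0)) (cone vb (0, 0)) c c' ->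
  cZ c' = cZ c.
Proof.
move=> hr ha; have hr' := renewal_agree ha hr.
have hp := future_path_agree hr.2 ha.
have e1 k : cR c' k = cR c k by apply: first_hit_ext => n; rewrite hp.
have e2 r : renewal c' (cY c (0, 0) r) <-> renewal c (cY c (0, 0) r).
  have hc : cone vb (0, 0) (cY c (0, 0) r) by exact: hr.2.
  have hcn : cno c' (cY c (0, 0) r) <-> cno c (cY c (0, 0) r).
    split => h w cw; rewrite WcrossE => -[h3 h4]; apply: (h w) => //.
      by apply/ha.1 => //; apply: hitS h3; exact: cone_sub.
    by apply/ha.1 => //; apply: hitS h3; exact: cone_sub.
  have hcA : cA c' (cY c (0, 0) r) <-> cA c (cY c (0, 0) r).
    have e i : cY c' (cY c (0, 0) r) i = cY c (cY c (0, 0) r) i.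
      by rewrite -{1}(hp r) -!cY_add hp.
    by split => h i; [rewrite -e|rewrite e]; exact: h.
  by rewrite /renewal hcn hcA.
have e3 : cI pb pc vb c' = cI pb pc vb c.
  apply: first_hit_ext => k; rewrite e1; case: (cR c k) => [r|//].
  by rewrite hp e2.
rewrite /cZ /ctau e3; case: (cI _ _ _ _) => [k|//]; rewrite e1; case: (cR c k) => [t|//].
by congr (Some (_, _)); apply: eq_map => s; rewrite hp.
Qed.

(** Each block is read in the environment seen from the end of the previous one. A block [None] has
    no end, so nothing is required after it. *)
Fixpoint chain (zs : seq (option (nat * seq int))) c : Prop :=
  if zs is z :: zs' then
    cZ c = z /\ (if z is Some (t, xs) then chain zs' (cshift (endpoint t xs) c) else True)
  else True.

Lemma agree_cshift c c' y : agree (HC y) (cone vb y) c c' ->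
  agree (HC (0, 0)) (cone vb (0, 0)) (cshift y c) (cshift y c').
Proof.
move=> [h1 h2]; split => [w hw|z hz] /=.
  apply: h1; apply/(hit_path_shift (Z' := cone vb (0, 0)) (y := y)).
    by move=> u; have := cone_ptadd vb01 y (0, 0) u; rewrite ptadd0.
  by rewrite path_shiftVK.
apply: h2; have := cone_ptadd vb01 y (0, 0) z; rewrite ptadd0 => e; exact/e.
Qed.

Lemma cZ_renewal c t xs : cZ c = Some (t, xs) -> renewal c (endpoint t xs).
Proof. by move=> h; rewrite (cZ_endpoint h); move/cZ_some : h => [k []]. Qed.

Lemma renewal_cshift0 c y : renewal (cshift y c) (0, 0) <-> renewal c y.
Proof. by have := renewal_cshift pb pc vb01 c y (0, 0); rewrite ptadd0. Qed.

Lemma chain_agree zs c c' : renewal c (0, 0) -> agree (HC (0, 0)) (cone vb (0, 0)) c c' ->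
  chain zs c -> chain zs c'.
Proof.
elim: zs c c' => [//|z zs IH] c c' hr ha /= [hz hc].
split; first by rewrite (cZ_future hr ha).
case: z hz hc => [[t xs]|//] hz hc.
have hry := cZ_renewal hz.
apply: IH hc; first exact/renewal_cshift0.
apply: agree_cshift; apply: agreeS ha.
  apply: hitS; apply: cone_sub => //; rewrite (cZ_endpoint hz); exact: hr.2.
apply: cone_sub => //; rewrite (cZ_endpoint hz); exact: hr.2.
Qed.

Lemma dep_chain zs y : dep (HC y) (cone vb y) (fun c => renewal c y /\ chain zs (cshift y c)).
Proof.
move=> c c' ha [h1 h2]; split; first exact: renewal_agree h1.
apply: chain_agree h2; [exact/renewal_cshift0|exact: agree_cshift].
Qed.

End Renewals.

(** * Measurability of the walk and of its renewal data *)

Section WalkerMeasurability.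
Variables (R : realType) (pb pc vb : R).
Hypotheses (pb01 : 0 <= pb <= 1) (pc01 : 0 <= pc <= 1).
Notation env := (conf R).

Lemma mpred_hit_free (A : set Wt) : measurable A -> mpred (fun c : env => exists2 w, c.1 w & A w).
Proof.
move=> mA; apply: (@mpred_eq _ _ (fun c : env => ~ (forall w, c.1 w -> ~ A w))); last first.
  by apply: mpred_not; exact: mpred_avoid.
move=> c; split.
  by move=> h; apply: contrapT => h'; apply: h => w cw Aw; apply: h'; exists w.
by move=> [w cw Aw] h; exact: (h w).
Qed.

Lemma mpred_cT z : mpred (fun c : env => cT c z).
Proof. by apply: (mpred_hit_free (A := [set w : Wt | w z.2 = z.1])); exact: discrete_mfun_coord. Qed.

Lemma mpred_goes_right z : mpred (fun c : env => goes_right pb pc c z).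
Proof.
by apply: mpred_or; apply: mpred_and; [exact: mpred_cT|exact: mpred_uniform|
  apply: mpred_not; exact: mpred_cT|exact: mpred_uniform].
Qed.

Lemma discrete_mfun_cY y i : discrete_mfun (fun c : env => cY pb pc c y i).
Proof.
elim: i => [|i IH]; first exact: discrete_mfun_const.
apply: (@discrete_mfun_bind _ _ _ _ (fun c => cY pb pc c y i) (fun z c =>
  if `[< goes_right pb pc c z >] then (z.1 + 1, z.2 + 1) else (z.1 - 1, z.2 + 1))) => // z u.
apply: (mpred_eq (Phi := fun c : env => (goes_right pb pc c z /\ (z.1 + 1, z.2 + 1) = u) \/
   (~ goes_right pb pc c z /\ (z.1 - 1, z.2 + 1) = u))).
  move=> c; case: asboolP => h; split; [by case=> -[]|by left|by case=> -[]|by right].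
by apply: mpred_or; apply: mpred_and; [exact: mpred_goes_right|exact: mpred_const|
  apply: mpred_not; exact: mpred_goes_right|exact: mpred_const].
Qed.

Lemma mpred_cno y : mpred (fun c : env => cno vb c y).
Proof. by apply: mpred_avoid; apply: measurableI; exact: measurable_hit. Qed.

Lemma mpred_cA y : mpred (fun c : env => cA pb pc vb c y).
Proof.
apply: mpred_all => i; apply: (@mpred_bind _ _ _ (fun c => cY pb pc c y i) (fun z _ => cone vb y z)).
  exact: discrete_mfun_cY.
by move=> z; exact: mpred_const.
Qed.

Lemma mpred_renewal y : mpred (fun c : env => renewal pb pc vb c y).
Proof. by apply: mpred_and; [exact: mpred_cno|exact: mpred_cA]. Qed.

Lemma mpred_on_cY y i (Q : pt -> env -> Prop) : (forall z, mpred (Q z)) ->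
  mpred (fun c => Q (cY pb pc c y i) c).
Proof. by move=> h; apply: mpred_bind => //; exact: discrete_mfun_cY. Qed.

Lemma discrete_mfun_first_hit (Q : env -> nat -> Prop) : (forall n, mpred (fun c => Q c n)) ->
  discrete_mfun (fun c => first_hit (Q c)).
Proof.
move=> h [n|].
  apply: (mpred_eq (Phi := fun c => Q c n /\ forall m, (m < n)%N -> ~ Q c m)).
    by move=> c; rewrite first_hit_some.
  apply: mpred_and => //; apply: mpred_all => m; apply: mpred_imp; first exact: mpred_const.
  exact: mpred_not.
apply: (mpred_eq (Phi := fun c => forall n, ~ Q c n)); first by move=> c; rewrite first_hit_none.
by apply: mpred_all => n; exact: mpred_not.
Qed.

Lemma discrete_mfun_cR k : discrete_mfun (fun c : env => cR pb pc vb c k).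
Proof.
apply: discrete_mfun_first_hit => n.
apply: (@mpred_on_cY (0, 0) n (fun z _ => (1 - vb) * k%:R + vb * n%:R <= z.1%:~R)) => z.
exact: mpred_const.
Qed.

Lemma mpred_on_cR k (Q : nat -> env -> Prop) (N : Prop) : (forall r, mpred (Q r)) ->
  mpred (fun c => if cR pb pc vb c k is Some r then Q r c else N).
Proof.
move=> h; apply: (@mpred_bind _ _ _ (fun c => cR pb pc vb c k)
  (fun o c => if o is Some r then Q r c else N)); first exact: discrete_mfun_cR.
by case=> [r|]; [exact: h|exact: mpred_const].
Qed.

Lemma discrete_mfun_cI : discrete_mfun (fun c : env => cI pb pc vb c).
Proof.
apply: discrete_mfun_first_hit => k; apply: mpred_and; first exact: mpred_const.
apply: mpred_on_cR => r.
apply: (@mpred_on_cY (0, 0) r (fun z c => renewal pb pc vb c z)) => z; exact: mpred_renewal.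
Qed.

Lemma discrete_mfun_ctau : discrete_mfun (fun c : env => ctau pb pc vb c).
Proof.
apply: (@discrete_mfun_bind _ _ _ _ (fun c => cI pb pc vb c)
  (fun o c => if o is Some k then cR pb pc vb c k else None)); first exact: discrete_mfun_cI.
by case=> [k|]; [exact: discrete_mfun_cR|exact: discrete_mfun_const].
Qed.

Lemma discrete_mfun_map_cY (s : seq nat) : discrete_mfun (fun c : env => [seq (cY pb pc c (0, 0) i).1 | i <- s]).
Proof.
elim: s => [|i s IH] /=; first exact: discrete_mfun_const.
apply: (@discrete_mfun_bind _ _ _ _ (fun c => cY pb pc c (0, 0) i)
  (fun z c => z.1 :: [seq (cY pb pc c (0, 0) i).1 | i <- s])); first exact: discrete_mfun_cY.
by move=> z; exact: (discrete_mfun_comp (cons z.1) IH).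
Qed.

Lemma discrete_mfun_cZ : discrete_mfun (fun c : env => cZ pb pc vb c).
Proof.
apply: (@discrete_mfun_bind _ _ _ _ (fun c => ctau pb pc vb c) (fun o c =>
  if o is Some t then Some (t, [seq (cY pb pc c (0, 0) s).1 | s <- iota 0 t.+1]) else None)).
  exact: discrete_mfun_ctau.
case=> [t|]; last exact: discrete_mfun_const.
exact: (discrete_mfun_comp (fun xs => Some (t, xs)) (discrete_mfun_map_cY _)).
Qed.

Lemma mpred_cshift y (Q : env -> Prop) : mpred Q -> mpred (fun c : env => Q (cshift y c)).
Proof. by move=> h; apply: mpred_preimage h; exact: measurable_cshift. Qed.

Lemma mpred_chain zs : mpred (fun c : env => chain pb pc vb zs c).
Proof.
elim: zs => [|z zs IH] /=; first exact: mpred_const.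
apply: mpred_and; first exact: discrete_mfun_cZ.
by case: z => [[t xs]|]; [exact: mpred_cshift|exact: mpred_const].
Qed.

End WalkerMeasurability.

(** * Positive probability of a renewal at the origin *)

Section ProbabilityValues.
Context {R : realType} {d : measure_display} {T : measurableType d}.
Variable mu : probability T R.
Implicit Types E F : set T.

Definition pr E : R := fine (mu E).

Lemma prE E : measurable E -> mu E = (pr E)%:E.
Proof. by move=> mE; rewrite /pr fineK// fin_num_measure. Qed.

Lemma pr_ge0 E : 0 <= pr E.
Proof. by rewrite /pr fine_ge0. Qed.

Lemma pr_le1 E : measurable E -> pr E <= 1.
Proof. by move=> mE; rewrite -lee_fin -prE// probability_le1. Qed.

Lemma le_pr E F : measurable E -> measurable F -> E `<=` F -> pr E <= pr F.
Proof. by move=> mE mF EF; rewrite -lee_fin -!prE// le_measure ?inE. Qed.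

Lemma pr_setT : pr setT = 1.
Proof. by rewrite /pr probability_setT. Qed.

Lemma pr_split E F : measurable E -> measurable F -> pr E = pr (E `&` F) + pr (E `\` F).
Proof.
move=> mE mF; apply: EFin_inj; rewrite EFinD -!prE//.
- by rewrite [LHS](measureDI mu mE mF) addeC.
- exact: measurableD.
- exact: measurableI.
Qed.

Lemma pr_setC E : measurable E -> pr (~` E) = 1 - pr E.
Proof.
by move=> mE; have := pr_split measurableT mE; rewrite setTI setTD pr_setT; lra.
Qed.

Lemma pr_null_sub E F : measurable E -> measurable F -> E `<=` F -> pr F = 0 -> pr E = 0.
Proof.
by move=> mE mF EF F0; apply/eqP; rewrite eq_le pr_ge0 andbT -F0; exact: le_pr.
Qed.

End ProbabilityValues.

Section RenewalPositive.
Variables (R : realType) (q rho pb pc vstar : R) (Px : int -> probability Wt R).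
Variable mu : probability (conf R) R.
Hypothesis q01 : 0 < q < 1.
Hypothesis hPx : forall x, lazy_walk_law q x (Px x).
Hypothesis rho0 : 0 < rho.
Hypotheses (pb01 : 0 < pb <= 1) (pc01 : 0 < pc <= 1) (vs01 : 0 < vstar < 1).
Let vb := vstar / 3.
Let vb01 : 0 < vb <= 1 / 3.
Proof. by have /andP[v0 v1] := vs01; rewrite /vb; apply/andP; split; lra. Qed.
Notation env := (conf R).
Implicit Types c : env.
Notation HC y := (HC vb y).
Notation HR y := (HR vb y).
Notation level := (level vb).
Notation cY := (cY pb pc).
Notation cno := (cno vb).
Notation cA := (cA pb pc vb).
Notation renewal := (renewal pb pc vb).
Notation pr := (pr mu).
Notation av := (av rho Px).
Hypothesis mu_basic : forall D ys b, measurable D -> uniq ys -> (forall y, 0 <= b y <= 1) ->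
  mu (basic D ys b) = (av D * \prod_(y <- ys) b y)%:E.

Lemma pr_cshift y (E : set env) : measurable E -> pr (cshift y @^-1` E) = pr E.
Proof.
move=> mE; rewrite /pr (mu_cshift y mu_basic)// => z D mD.
exact: (av_path_shift rho z q01 hPx mD).
Qed.

Lemma pr_independence A1 B1 A2 B2 (E F : set env) :
  measurable A1 -> measurable A2 -> A1 `&` A2 = set0 -> B1 `&` B2 = set0 ->
  measurable E -> measurable F -> dep A1 B1 E -> dep A2 B2 F ->
  pr (E `&` F) = pr E * pr F.
Proof.
move=> mA1 mA2 A12 B12 mE mF dE dF; apply: EFin_inj.
rewrite EFinM -!prE//; last exact: measurableI.
by apply: (independence mu_basic (@avU _ _ _ rho0) mA1 mA2 A12 B12).
Qed.

Lemma pr_avoid D : measurable D -> pr [set c | forall w, c.1 w -> ~ D w] = av D.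
Proof.
move=> mD; have -> : [set c : env | forall w, c.1 w -> ~ D w] = basic D [::] (fun=> 0).
  by apply/seteqP; split => c /=; [|case].
rewrite /pr mu_basic// ?big_nil ?mulr1//.
by move=> y; rewrite lexx ler01.
Qed.

(** Below this threshold a uniform forces a step to the right on occupied and vacant sites alike, so
    forcing is independent of the trajectories. Positivity of [pc] is the assumption that the vacant
    drift exceeds -1. *)
Definition pmin := Order.min pb pc.
Lemma pmin01 : 0 < pmin <= 1.
Proof.
have /andP[? ?] := pb01; have /andP[? ?] := pc01.
by rewrite /pmin lt_min ge_min; do ![apply/andP; split => //]; apply/orP; left.
Qed.
Let pmin01' : 0 <= pmin <= 1.
Proof. by have /andP[h ->] := pmin01; rewrite ltW. Qed.
Let pb01' : 0 <= pb <= 1.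
Proof. by have /andP[h ->] := pb01; rewrite ltW. Qed.
Let pb0 : 0 <= pb. Proof. by have /andP[] := pb01'. Qed.
Let pc01' : 0 <= pc <= 1.
Proof. by have /andP[h ->] := pc01; rewrite ltW. Qed.
Let pc0 : 0 <= pc. Proof. by have /andP[] := pc01'. Qed.

Definition forced (y : pt) (n : nat) : set env :=
  [set c | forall i, (i < n)%N -> c.2 (diag y i) <= pmin].

Definition diag_sites (y : pt) (n : nat) : set pt := [set z | exists2 i, (i < n)%N & z = diag y i].

Lemma forcedE y n : forced y n = basic set0 [seq diag y i | i <- iota 0 n] (fun=> pmin).
Proof.
apply/seteqP; split => c /= h.
  split => [w _ []//|z /mapP[i]]; rewrite mem_iota add0n => /andP[_ im] ->; exact: h.
by move=> i im; apply: h.2; apply/mapP; exists i => //; rewrite mem_iota.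
Qed.

Lemma diag_inj y : injective (diag y).
Proof. by move=> i j [/addrI [->]]. Qed.

Lemma forced_uniq y n : uniq [seq diag y i | i <- iota 0 n].
Proof. by rewrite map_inj_uniq ?iota_uniq//; exact: diag_inj. Qed.

Lemma measurable_forced y n : measurable (forced y n).
Proof.
rewrite forcedE; apply: measurable_basic => //; exact: forced_uniq.
Qed.

Lemma pr_forced y n : pr (forced y n) = pmin ^+ n.
Proof.
rewrite forcedE /pr mu_basic//; last exact: forced_uniq.
have a0 : av set0 = 1 by exact: av0.
by rewrite /= a0 mul1r big_map /= big_const_seq count_predT size_iota iter_mulr_1.
Qed.

Lemma dep_forced y n : dep set0 (diag_sites y n) (forced y n).
Proof. by move=> c c' [_ h] hc i im; rewrite -h; [exact: hc|exists i]. Qed.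

Lemma forced_goes_right c y n i : forced y n c -> (i < n)%N -> goes_right pb pc c (diag y i).
Proof.
by move=> h /h; rewrite le_min => /andP[h1 h2]; exact: (goes_right_small).
Qed.

Lemma forced_cY c y n i : forced y n c -> (i <= n)%N -> cY c y i = diag y i.
Proof. by move=> h; apply: (forced_path) => j; exact: forced_goes_right. Qed.

Lemma crossing_climbers : Wcross vb (0, 0) `<=` climbers vb 0 0 0.
Proof.
move=> w [/hitP[t1 /(coneP vb01)[/= h1 h2]] /hitP[t0 /(rconeP vb01)[/= h3 h4]]].
move: h2 h4; rewrite /level /= mulr0 subrr => h2 h4.
by split; [exists t0|exists t1].
Qed.

(** A crossing trajectory climbs through level 0 around time 0; such trajectories have finite
    intensity, and a Poisson process avoids a set of finite intensity with positive probability. *)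
Lemma av_crossing_gt0 : 0 < av (Wcross vb (0, 0)).
Proof.
have vb1 : 0 < vb <= 1 by have /andP[h1 h2] := vb01; apply/andP; split; lra.
have [K [th [K0 th0 hK]]] := lam_climbers q01 hPx vb1.
apply: (av_gt0 rho0); apply: le_lt_trans _ (ltry (K * expR (- (th * (0 - 0))))).
apply: le_trans _ (hK 0 0 0); apply: le_measure; rewrite ?inE.
- by apply: measurableI; exact: measurable_hit.
- exact: measurable_climbers.
- exact: crossing_climbers.
Qed.

Definition slow_walk (L : nat) : set env :=
  [set c | exists n : nat, (cY c (0, 0) n).1%:~R < n%:R * vstar - L%:R].

Lemma measurable_slow_walk L : measurable (slow_walk L).
Proof.
rewrite /slow_walk; to_mpred; apply: mpred_ex => n.
apply: (@mpred_on_cY _ _ _ _ _ (0, 0) n (fun z _ => z.1%:~R < n%:R * vstar - L%:R)) => //.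
by move=> z; exact: mpred_const.
Qed.

Hypothesis ballistic : forall e : R, 0 < e -> exists L, pr (slow_walk L) <= e.

(** The walk starts at the tip of the forced steps, but the cone is still that of the origin. *)
Definition stays_in_cone (n : nat) : set env :=
  [set c | forall i, cone vb (0, 0) (cY c (diag (0, 0) n) i)].

Lemma measurable_stays_in_cone n : measurable (stays_in_cone n).
Proof.
rewrite /stays_in_cone; to_mpred; apply: mpred_all => i.
apply: (@mpred_on_cY _ _ _ _ _ (diag (0, 0) n) i (fun z _ => cone vb (0, 0) z)) => //.
by move=> z; exact: mpred_const.
Qed.

(** Of the [2 L] forced steps, [L] pay for the deficit left by ballisticity and the other [L] for
    the growth [2 L * vb] of the boundary of the cone during the forced steps. *)
Lemma not_stays_in_cone L : ~` stays_in_cone L.*2 `<=` cshift (diag (0, 0) L.*2) @^-1` slow_walk L.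
Proof.
move=> c /existsNP[i]; set y := diag _ _.
have := cY_cshift pb pc c y (0, 0) i; rewrite ptadd0 => <-.
set z := cY (cshift y c) (0, 0) i => hz.
have ez : z.2 = i%:Z by rewrite cY_time /= add0r.
exists i; rewrite -/z; apply: contrapT => hn; apply: hz.
apply/(coneP vb01); split; first by rewrite /ptadd /y /diag /= ez add0r -PoszD.
have l0 : level (0, 0) = 0 by rewrite /level /= mulr0 subrr.
move: hn => /negP; rewrite -leNgt l0 /level /ptadd /y /diag /= ez !add0r !intrD.
rewrite -!pmulrn -muln2 natrM /vb => hn.
have /andP[v0 v1] := vs01.
have h1 : 0 <= L%:R * (1 - vstar) by rewrite mulr_ge0// subr_ge0 ltW.
have h2 : 0 <= i%:R * vstar by rewrite mulr_ge0// ltW.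
have h3 : 0 <= L%:R * vstar by rewrite mulr_ge0// ltW.
by lra.
Qed.

Lemma pr_renewal_gt0 : 0 < pr [set c | renewal c (0, 0)].
Proof.
pose a := av (Wcross vb (0, 0)).
have a0 : 0 < a := av_crossing_gt0.
have mW : measurable (Wcross vb (0, 0)) by apply: measurableI; exact: measurable_hit.
have [L hL] := ballistic (ltac:(lra) : 0 < a / 2).
pose n := L.*2; pose N : set env := [set c | cno c (0, 0)].
have mN : measurable N by exact: mpred_cno.
have mS := measurable_stays_in_cone n.
have mB : measurable [set c : env | renewal c (0, 0)] by exact: mpred_renewal.
have h1 : a / 2 <= pr (N `&` stays_in_cone n).
  have hN : pr N = a by exact: pr_avoid.
  have := pr_split mu mN mS; rewrite hN.
  have : pr (N `\` stays_in_cone n) <= a / 2.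
    apply: le_trans hL; rewrite -(pr_cshift (diag (0, 0) n) (measurable_slow_walk L)).
    apply: le_pr; first exact: measurableD.
      have := measurable_cshift (diag (0, 0) n) measurableT (measurable_slow_walk L).
      by rewrite setTI.
    by move=> c [_ ns]; exact: not_stays_in_cone.
  lra.
(* The forced steps involve no trajectory and only sites at times before [n]; the other event may
   use all trajectories, but only sites at times from [n] on. *)
have h2 : pr (forced (0, 0) n `&` (N `&` stays_in_cone n)) = pmin ^+ n * pr (N `&` stays_in_cone n).
  rewrite (@pr_independence set0 (diag_sites (0, 0) n) setT [set z : pt | n%:Z <= z.2]).
  - by rewrite pr_forced.
  - exact: measurable0.
  - exact: measurableT.
  - by rewrite set0I.
  - by apply/seteqP; split => // z [[i im ->]] /=; rewrite add0r lez_nat leqNgt im.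
  - exact: measurable_forced.
  - exact: measurableI.
  - exact: dep_forced.
  - move=> c c' [hw hu] [cN cS]; split; first by move=> w c'w; apply: cN; exact/hw.
    move=> i; suff -> : cY c' (diag (0, 0) n) i = cY c (diag (0, 0) n) i by exact: cS.
    apply: (@cY_ext _ _ _ _ _ _ i) => // j _.
    apply: (@goes_right_agree _ pb pc _ _ [set z : pt | n%:Z <= z.2]).
    + by rewrite /= cY_time /diag /= add0r lerDl.
    + by move=> w _; exact: hw.
    + by move=> u; exact: hu.
have h3 : pr (forced (0, 0) n `&` (N `&` stays_in_cone n)) <= pr [set c | renewal c (0, 0)].
  apply: le_pr => //.
    by apply: measurableI; [exact: measurable_forced|exact: measurableI].
  move=> c [cF [cN cS]]; split => // i.
  have [le|/ltnW lt] := leqP i n; first by rewrite (forced_cY cF le); exact: (cone_diag vb01).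
  by rewrite -(subnKC lt) cY_add (forced_cY cF (leqnn n)); exact: cS.
apply: lt_le_trans h3; rewrite h2 mulr_gt0// ?exprn_gt0//; last by lra.
by have := pmin01; lra.
Qed.

End RenewalPositive.

(** * Trajectories crossing a record *)

Lemma pr_union_bound {R : realType} {d} {T : measurableType d} (mu : probability T R)
  (n : nat) (F : nat -> set T) (a : nat -> R) (E : set T) :
  measurable E -> (forall i, (i < n)%N -> measurable (F i)) ->
  (forall i, (i < n)%N -> pr mu (F i) <= a i) ->
  (forall x, E x -> exists2 i, (i < n)%N & F i x) ->
  pr mu E <= \sum_(i < n) a i.
Proof.
elim: n E => [|n IH] E mE mF ha hE.
  have -> : E = set0 by apply/seteqP; split => // x /hE [].
  by rewrite big_ord0 /pr measure0.
rewrite big_ord_recr /=.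
have h1 : pr mu (E `\` F n) <= \sum_(i < n) a i.
  apply: IH => [|i im|i im|x [Ex nF]].
  - by apply: measurableD => //; exact: mF.
  - by apply: mF; exact: ltnW.
  - by apply: ha; exact: ltnW.
  - have [i] := hE x Ex; rewrite ltnS leq_eqVlt => /orP[/eqP-> //|im Fi].
    by exists i.
rewrite (pr_split mu mE (mF n (ltnSn n))) addrC; apply: lerD => //.
apply: le_trans (ha n (ltnSn n)); apply: le_pr; [|exact: mF|exact: subIsetr].
by apply: measurableI => //; exact: mF.
Qed.

Lemma sum_arith_geometric {R : realType} (x : R) n : 0 <= x < 1 ->
  \sum_(m < n) (m.+1%:R * x ^+ m) <= (1 - x)^-1 ^+ 2.
Proof.
move=> /andP[x0 x1].
have e : (\sum_(m < n) (m.+1%:R * x ^+ m)) * (1 - x) ^+ 2 =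
   1 - n.+1%:R * x ^+ n + n%:R * x ^+ n.+1.
  elim: n => [|n IH]; first by rewrite big_ord0 mul0r expr0; ring.
  by rewrite big_ord_recr /= mulrDl IH -!natr1 !exprS; ring.
have p : 0 < (1 - x) ^+ 2 by rewrite exprn_gt0// subr_gt0.
rewrite exprVn -[leRHS]mul1r ler_pdivlMr// e.
have h : n%:R * x ^+ n.+1 <= n.+1%:R * x ^+ n.
  apply: ler_pM; rewrite ?ler0n ?exprn_ge0 ?ler_nat//.
  by rewrite exprS ler_piMl ?exprn_ge0// ltW.
lra.
Qed.

Section OldTrajectories.
Variables (R : realType) (q rho pb pc vb : R) (Px : int -> probability Wt R).
Variable mu : probability (conf R) R.
Hypothesis q01 : 0 < q < 1.
Hypothesis hPx : forall x, lazy_walk_law q x (Px x).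
Hypothesis rho0 : 0 < rho.
Hypotheses (pb01 : 0 <= pb <= 1) (pc01 : 0 <= pc <= 1) (vb01 : 0 < vb <= 1 / 3).
Notation env := (conf R).
Implicit Types c : env.
Notation HC y := (HC vb y).
Notation HR y := (HR vb y).
Notation level := (level vb).
Notation cY := (cY pb pc).
Notation cR := (cR pb pc vb).
Notation pr := (pr mu).
Notation av := (av rho Px).
Notation climbers := (climbers vb).
Hypothesis mu_basic : forall D ys b, measurable D -> uniq ys -> (forall y, 0 <= b y <= 1) ->
  mu (basic D ys b) = (av D * \prod_(y <- ys) b y)%:E.

Definition record_pos (k : nat) c : option pt :=
  if cR c k is Some r then Some (cY c (0, 0) r) else None.

Lemma discrete_mfun_record_pos k : discrete_mfun (record_pos k).
Proof.
apply: (@discrete_mfun_bind _ _ _ _ (fun c : env => cR c k)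
  (fun o c => if o is Some r then Some (cY c (0, 0) r) else None)); first exact: discrete_mfun_cR.
case=> [r|]; last exact: discrete_mfun_const.
exact: (discrete_mfun_comp Some (discrete_mfun_cY _ _ _ _)).
Qed.

Lemma record_posP k c y : record_pos k c = Some y <->
  exists2 r, cR c k = Some r & y = cY c (0, 0) r.
Proof.
rewrite /record_pos; split; first by case: (cR c k) => [r [<-]|//]; exists r.
by move=> [r -> ->].
Qed.

Lemma dep_record_pos k y : dep (HR y) (rcone vb y) (fun c => record_pos k c = Some y).
Proof.
move=> c c' ha /record_posP[r hr ey]; apply/record_posP; exists r.
  by apply: (cR_prefix _ (leqnn r) hr); apply: (past_path_agree vb01 hr); rewrite -ey.
by rewrite (past_path_agree vb01 hr) -?ey.
Qed.

(* The trajectories missing the backward cone of the [j]-th record are independent of the walk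
   up to that record, whatever happened before. *)
Definition fresh_climber (j : nat) (g : nat) (al be : R) : set env :=
  [set c | exists y, record_pos j c = Some y /\
     exists2 w, c.1 w & (~` HR y `&` climbers (y.2 + g%:Z) al be) w].

(** The case of a trajectory that already meets the backward cone of the origin: there is no earlier
    record for it to miss. *)
Definition initial_climber (g : nat) (al be : R) : set env :=
  [set c | exists2 w, c.1 w & climbers g%:Z al be w].

Lemma measurable_fresh_climber j g al be : measurable (fresh_climber j g al be).
Proof.
rewrite /fresh_climber; to_mpred; apply: mpred_ex => y; apply: mpred_and; first exact: discrete_mfun_record_pos.
apply: mpred_hit_free; apply: measurableI; last exact: measurable_climbers.
by apply: measurableC; exact: measurable_hit.
Qed.

Lemma measurable_initial_climber g al be : measurable (initial_climber g al be).
Proof. by apply: mpred_hit_free; exact: measurable_climbers. Qed.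

Lemma pr_hit_le (D : set Wt) (L : R) : measurable D -> (lam Px D <= L%:E)%E ->
  pr [set c | exists2 w, c.1 w & D w] <= rho * L.
Proof.
move=> mD hL; have mA : measurable [set c : env | forall w, c.1 w -> ~ D w] by exact: mpred_avoid.
have -> : [set c : env | exists2 w, c.1 w & D w] = ~` [set c | forall w, c.1 w -> ~ D w].
  apply/seteqP; split => c /=; first by move=> [w cw Dw] h; exact: (h w).
  by move=> h; apply: contrapT => h'; apply: h => w cw Dw; apply: h'; exists w.
by rewrite pr_setC// (pr_avoid mu_basic)//; have := av_ge rho0 hL; lra.
Qed.

Lemma pr_fresh_climber j g al be (L : R) : 0 <= L ->
  (forall s, (lam Px (climbers s al be) <= L%:E)%E) ->
  pr (fresh_climber j g al be) <= rho * L.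
Proof.
move=> L0 hL; have rL0 : 0 <= rho * L by rewrite mulr_ge0// ltW.
rewrite -lee_fin -prE; last exact: measurable_fresh_climber.
rewrite -[leRHS]mule1 -(probability_setT mu).
apply: (le_measure_fibers (discrete_mfun_record_pos j) (discrete_mfun_record_pos j)) => //.
  exact: measurable_fresh_climber.
case=> [y|]; last first.
  rewrite (_ : _ `&` _ = set0) ?measure0 ?mule_ge0//.
  by apply/seteqP; split => // c [[y [h _]] /=]; rewrite h.
have mH : measurable [set c | record_pos j c = Some y] by exact: discrete_mfun_record_pos.
pose D := ~` HR y `&` climbers (y.2 + g%:Z) al be.
have mD : measurable D.
  apply: measurableI; last exact: measurable_climbers.
  by apply: measurableC; exact: measurable_hit.
have mE : measurable [set c : env | exists2 w, c.1 w & D w] by exact: mpred_hit_free.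
rewrite setTI.
have -> : fresh_climber j g al be `&` [set c | record_pos j c = Some y] =
   [set c | record_pos j c = Some y] `&` [set c : env | exists2 w, c.1 w & D w].
  apply/seteqP; split => c.
    by move=> [[z [hz hw]] /= hy]; split => //; move: hw; rewrite hz in hy; case: hy => ->.
  by move=> [/= hy hw]; split => //; exists y.
have hAB := measurableI _ _ mH mE.
rewrite [X in (_ * X)%E](prE mu mH) [leLHS](prE mu hAB) -EFinM lee_fin.
rewrite (pr_independence rho0 mu_basic (A1 := HR y) (B1 := rcone vb y) (A2 := D) (B2 := set0)) //.
- rewrite mulrC ler_wpM2r ?pr_ge0//; apply: pr_hit_le => //.
  apply: le_trans _ (hL (y.2 + g%:Z)); apply: le_measure; rewrite ?inE//.
  exact: measurable_climbers.
  by move=> w [].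
- exact: measurable_hit.
- by apply/seteqP; split => // w [h1 [h2 _]].
- by rewrite setI0.
- exact: dep_record_pos.
- by move=> c c' [h _] [w cw Dw]; exists w => //; exact/h.
Qed.

Lemma pr_initial_climber g al be (L : R) :
  (forall s, (lam Px (climbers s al be) <= L%:E)%E) ->
  pr (initial_climber g al be) <= rho * L.
Proof. by move=> hL; apply: pr_hit_le => //; exact: measurable_climbers. Qed.

(** Looking back from record [k], the elapsed time is at most linear in the number of records
    passed. This bounds the time offsets over which a union bound has to run. *)
Definition slow_record (M k r : nat) c : Prop :=
  forall j rj, (j <= k)%N -> cR c j = Some rj -> (r <= rj + M * (k - j))%N.

Definition old_at (l r : nat) c : Prop :=
  exists2 w, c.1 w & (HR (cY c (0, 0) r) `&` HC (diag (cY c (0, 0) r) l)) w.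

Definition bad_record (M l k : nat) : set env :=
  [set c | if cR c k is Some r then slow_record M k r c /\ old_at l r c else False].

Lemma mpred_old_at l r : mpred (fun c : env => old_at l r c).
Proof.
apply: (mpred_on_cY pb01 pc01 (0, 0) r
  (Q := fun y c => exists2 w, c.1 w & (HR y `&` HC (diag y l)) w)) => y.
by apply: mpred_hit_free; apply: measurableI; exact: measurable_hit.
Qed.

Lemma mpred_slow_record M k r : mpred (fun c : env => slow_record M k r c).
Proof.
apply: mpred_all => j; apply: mpred_all => rj; apply: mpred_imp; first exact: mpred_const.
by apply: mpred_imp; [exact: discrete_mfun_cR|exact: mpred_const].
Qed.

Lemma measurable_bad_record M l k : measurable (bad_record M l k).
Proof.
rewrite /bad_record; to_mpred; apply: (mpred_on_cR vb pb01 pc01 k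
  (Q := fun r c => slow_record M k r c /\ old_at l r c)) => r.
by apply: mpred_and; [exact: mpred_slow_record|exact: mpred_old_at].
Qed.

Lemma climbers_of_old c l j rj k r w : (j <= k)%N ->
  cR c j = Some rj -> cR c k = Some r ->
  HR (cY c (0, 0) rj) w -> HC (diag (cY c (0, 0) r) l) w ->
  climbers r%:Z ((1 - vb) * j.+1%:R) ((1 - vb) * (k + l)%:R) w.
Proof.
move=> jk hj hk /hitP[t0 /(rconeP vb01)[h1 h2]] /hitP[t1 /(coneP vb01)[h3 h4]].
have [rj' rjr] := cR_mono vb01 jk hk; rewrite hj => -[e]; subst rj'.
split.
  exists t0; split; last by apply: lt_trans h2 (cR_level_lt vb01 hj).
  by apply: le_trans h1 _; rewrite cY_time /= add0r lez_nat.
exists t1; split.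
  apply: le_trans h3; rewrite /diag /= cY_time /= add0r lerDl.
  by [].
apply: le_trans h4; rewrite level_diag natrD mulrDr lerD2r.
by move/cR_some : hk => [].
Qed.

Lemma bad_record_cover M l k c : bad_record M l k c ->
  (exists2 g, (g < (M * k.+1).+1)%N & initial_climber g ((1 - vb) * 1%:R) ((1 - vb) * (k + l)%:R) c) \/
  (exists2 j, (j < k)%N & exists2 g, (g < (M * (k - j)).+1)%N &
     fresh_climber j g ((1 - vb) * j.+2%:R) ((1 - vb) * (k + l)%:R) c).
Proof.
rewrite /bad_record /=; case hk : (cR c k) => [r|//] [hs [w cw [hw1 hw2]]].
pose P j := exists2 rj, cR c j = Some rj & HR (cY c (0, 0) rj) w.
have Pk : P k by exists r.
have [j [rj hj hjw] hmin] := exists_first Pk.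
have jk : (j <= k)%N by rewrite leqNgt; apply/negP => /hmin; apply.
have hcl := climbers_of_old jk hj hk hjw hw2.
case: j jk hj hjw hmin hcl => [|j] jk hj hjw hmin hcl.
  left; exists r; last by exists w.
  have := hs 0%N 0%N jk; rewrite subn0 add0n ltnS => h.
  have h0 : cR c 0 = Some 0%N.
    by apply/cR_some; split => //; rewrite level_cY /= !mulr0 subr0.
  by apply: leq_trans (h h0) _; rewrite leq_mul2l leqnSn orbT.
right; exists j => //.
have [r' r'r hr'] := cR_mono vb01 (ltnW jk) hk.
exists (r - r')%N.
  by rewrite ltnS leq_subLR; exact: hs (ltnW jk) hr'.
exists (cY c (0, 0) r'); split; first by apply/record_posP; exists r'.
exists w => //; split.
  by move=> hw; apply: (hmin j (ltnSn j)); exists r'.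
by rewrite cY_time /= add0r -PoszD subnKC.
Qed.

(** If the first record met is [m] records before [k], the climb is at least [m + l - 1] units, one
    unit being lost to the overshoot: hence the factor [x^-1]. There are at most [(M + 1) * (m + 1)]
    time offsets, and summing over [m] leaves [x ^+ l], uniformly in [k]. *)
Lemma pr_bad_record : exists K x : R, [/\ 0 < K, 0 < x, x < 1 &
  forall M l k, pr (bad_record M l k) <= M.+1%:R * K * x ^+ l].
Proof.
have vb1 : 0 < vb <= 1 by have /andP[h1 h2] := vb01; apply/andP; split; lra.
have [K [th [K0 th0 hK]]] := lam_climbers q01 hPx vb1.
have /andP[v0 v1] := vb01.
pose x := expR (- (th * (1 - vb))).
have x0 : 0 < x by exact: expR_gt0.
have x1 : x < 1.
  rewrite /x -[ltRHS]expR0 ltr_expR oppr_lt0 mulr_gt0// subr_gt0; lra.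
have ix : 0 < (1 - x)^-1 ^+ 2 by rewrite exprn_gt0// invr_gt0 subr_gt0.
have K'0 : 0 < rho * (K * x^-1) by rewrite !mulr_gt0// invr_gt0.
exists (rho * (K * x^-1) * (1 - x)^-1 ^+ 2), x; split => //; first by rewrite mulr_gt0.
move=> M l k.
have expx n : expR (- (th * ((1 - vb) * n%:R))) = x ^+ n.
  by rewrite /x -expRM_natl; congr expR; ring.
pose D := rho * (K * x^-1) * x ^+ l.
have D0 : 0 <= D by rewrite /D mulr_ge0 ?exprn_ge0// ltW.
have hL m j : (m + j.+1 = k)%N -> forall s,
    (lam Px (climbers s ((1 - vb) * j.+2%:R) ((1 - vb) * (k + l)%:R)) <= (K * x^-1 * x ^+ l * x ^+ m)%:E)%E.
  move=> mj s; apply: le_trans (hK _ _ _) _; rewrite lee_fin -!mulrA ler_pM2l//.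
  rewrite le_eqVlt; apply/orP; left; apply/eqP.
  rewrite -!expx /x -expRN -!expRD; congr expR.
  by rewrite -mj !natrD -[j.+2%:R]natr1 -natr1; ring.
have hL0 s : (lam Px (climbers s ((1 - vb) * 1%:R) ((1 - vb) * (k + l)%:R)) <=
    (K * x^-1 * x ^+ l * x ^+ k)%:E)%E.
  apply: le_trans (hK _ _ _) _; rewrite lee_fin -!mulrA ler_pM2l//.
  rewrite le_eqVlt; apply/orP; left; apply/eqP.
  by rewrite -!expx /x -expRN -!expRD; congr expR; rewrite natrD; ring.
(* Here [m] is the distance from record [k] back to the first record met; [m = k] is the origin,
   which has no predecessor and gives an initial climber. *)
pose G m : set env := [set c | exists2 g, (g < (M * m.+1).+1)%N &
  if (m < k)%N then fresh_climber (k - m.+1) g ((1 - vb) * (k - m.+1).+2%:R) ((1 - vb) * (k + l)%:R) c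
  else initial_climber g ((1 - vb) * 1%:R) ((1 - vb) * (k + l)%:R) c].
have mG m : measurable (G m).
  apply: (mpred_eq (Phi := fun c => exists g, (g < (M * m.+1).+1)%N /\
    (if (m < k)%N then fresh_climber (k - m.+1) g ((1 - vb) * (k - m.+1).+2%:R) ((1 - vb) * (k + l)%:R) c
    else initial_climber g ((1 - vb) * 1%:R) ((1 - vb) * (k + l)%:R) c))).
    by move=> c; split => [[g [g1 g2]]|[g g1 g2]]; exists g.
  apply: mpred_ex => g; apply: mpred_and; first exact: mpred_const.
  case: (m < k)%N; [exact: measurable_fresh_climber|exact: measurable_initial_climber].
apply: le_trans (_ : _ <= \sum_(m < k.+1) (M.+1%:R * D * (m.+1%:R * x ^+ m))) _; last first.
  rewrite -mulr_sumr; have := @sum_arith_geometric R x k.+1 => h.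
  have {}h := h (introT andP (conj (ltW x0) x1)).
  have -> : M.+1%:R * (rho * (K * x^-1) * (1 - x)^-1 ^+ 2) * x ^+ l =
    M.+1%:R * D * (1 - x)^-1 ^+ 2 by rewrite /D; ring.
  by apply: ler_wpM2l => //; rewrite mulr_ge0.
apply: (@pr_union_bound _ _ _ mu k.+1 G (fun m => M.+1%:R * D * (m.+1%:R * x ^+ m))) => [||m mk|c hc].
- exact: measurable_bad_record.
- by move=> m _; exact: mG.
- apply: le_trans (_ : _ <= \sum_(g < (M * m.+1).+1) (D * x ^+ m)) _.
    apply: (@pr_union_bound _ _ _ mu _ (fun g => if (m < k)%N then
      fresh_climber (k - m.+1) g ((1 - vb) * (k - m.+1).+2%:R) ((1 - vb) * (k + l)%:R)
      else initial_climber g ((1 - vb) * 1%:R) ((1 - vb) * (k + l)%:R)) (fun=> D * x ^+ m)) => [|g _|g _|c].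
    + exact: mG.
    + case: (m < k)%N; [exact: measurable_fresh_climber|exact: measurable_initial_climber].
    + have -> : D * x ^+ m = rho * (K * x^-1 * x ^+ l * x ^+ m) by rewrite /D; ring.
      case: ifP => [mk'|/negbT]; last first.
        rewrite -leqNgt => km; have -> : m = k by apply/eqP; rewrite eqn_leq km -ltnS mk.
        exact: pr_initial_climber.
      apply: pr_fresh_climber; last by apply: hL; rewrite subnSK// subnKC// ltnW.
      by rewrite !mulr_ge0 ?exprn_ge0 ?invr_ge0// ltW.
    + by move=> [g g1 g2]; exists g => //; case: ifP g2.
  rewrite sumr_const card_ord -[_ *+ _]mulr_natr.
  have -> : M.+1%:R * D * (m.+1%:R * x ^+ m) = D * x ^+ m * (M.+1 * m.+1)%:R.
    by rewrite natrM; ring.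
  apply: ler_wpM2l; first by rewrite mulr_ge0// exprn_ge0// ltW.
  by rewrite ler_nat mulSn -addn1 addnC leq_add2r.
have [[g g1 g2]|[j jk [g g1 g2]]] := bad_record_cover hc.
  by exists k => //; exists g => //; rewrite ltnn.
have e : (k - (k - j.+1).+1 = j)%N by rewrite subnSK// subKn// ltnW.
exists (k - j.+1)%N; first by rewrite ltnS leq_subr.
exists g; first by rewrite subnSK.
by rewrite e ifT// subnSK// leq_subr.
Qed.

End OldTrajectories.

(* The slow indices are the times of running minima of [r k - M k]. *)
Lemma slow_count (r : nat -> nat) (M n : nat) :
  (forall k, (r k <= r k.+1)%N) ->
  let slow k := all (fun j => r k <= r j + M * (k - j))%N (iota 0 k.+1) in
  forall j, (j <= n)%N -> (M * j <= r j + M * \sum_(k < n) slow k.+1)%N.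
Proof.
move=> hr slow; elim: n => [|n IH] j.
  by rewrite leqn0 => /eqP ->; rewrite muln0.
rewrite big_ord_recr /=; set S := (\sum_(k < n) _)%N in IH *.
rewrite leq_eqVlt => /orP[/eqP ->|]; last first.
  rewrite ltnS => /IH h; apply: leq_trans h _.
  by rewrite leq_add2l leq_mul2l leq_addr orbT.
case: (boolP (slow n.+1)) => [_|].
  have := IH n (leqnn n); have := hr n; rewrite mulnS mulnDr muln1.
  by move: (M * n)%N (M * S)%N (r n) (r n.+1) => *; lia.
move=> /allPn[i]; rewrite mem_iota add0n ltnS => /andP[_ iln]; rewrite -ltnNge => h.
move: iln; rewrite leq_eqVlt => /orP[/eqP e|]; first by move: h; rewrite e; lia.
rewrite ltnS => iln; have := IH i iln; rewrite mulnDr.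
have : (M * n.+1 = M * i + M * (n.+1 - i))%N by rewrite -mulnDr subnKC// leqW.
by move: h; move: (M * (n.+1 - i))%N (M * i)%N (M * n.+1)%N (M * S)%N => *; lia.
Qed.

Lemma bad_count_arith (C n L k0 s b r : nat) : (0 < C)%N ->
  (r <= C * (n + L))%N -> (4 * C * n <= r + 4 * C * s)%N -> (s <= b + k0)%N ->
  (L + 4 * k0 <= n)%N -> (n <= 2 * b)%N.
Proof.
move=> C0 h1 h2 h3 h4.
have : (C * (4 * n) <= C * (n + L + 4 * s))%N.
  by rewrite !mulnDr; move: h1 h2; rewrite mulnDr; lia.
rewrite leq_pmul2l// => h; clear -h h3 h4; lia.
Qed.

Lemma count_below n k0 : (\sum_(i < n | (i.+1 < k0)) 1 <= k0)%N.
Proof.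
suff : (\sum_(i < n | (i.+1 < k0)) 1 <= minn n k0)%N by move=> h; apply: leq_trans h (geq_minr _ _).
elim: n => [|n IH]; first by rewrite big_ord0.
move: IH; rewrite big_mkcond => IH; rewrite big_mkcond big_ord_recr /=; move: IH; move: (\sum_(i < n) _)%N => S.
by case: ifP => h; rewrite !leq_min => /andP[]; lia.
Qed.

(** Markov's inequality for the number of [F i] that occur, without integrals: [D] is split along
    the last set, and the required count drops by one on the part inside it. *)
Lemma multiplicity_bound {R : realType} {d} {T : measurableType d} (mu : probability T R)
  (n : nat) (F : nat -> set T) : (forall i, measurable (F i)) ->
  forall (m : nat) (D : set T), measurable D ->
  (forall x, D x -> (m <= \sum_(i < n) `[< F i x >])%N) ->
  m%:R * pr mu D <= \sum_(i < n) pr mu (D `&` F i).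
Proof.
move=> mF; elim: n => [|n IH] m D mD hD.
  rewrite big_ord0; have [-> | m0] := eqVneq m 0%N; first by rewrite mul0r.
  have -> : D = set0.
    by apply/seteqP; split => // x /hD; rewrite big_ord0 leqn0 (negbTE m0).
  by rewrite /pr measure0 mulr0.
have mDI := measurableI _ _ mD (mF n).
have mDD := measurableD mD (mF n).
have h1 : (m.-1)%:R * pr mu (D `&` F n) <= \sum_(i < n) pr mu (D `&` F n `&` F i).
  apply: IH => // x [Dx Fx]; have := hD x Dx.
  by rewrite big_ord_recr /= asboolT// addn1; case: m {hD}.
have h2 : m%:R * pr mu (D `\` F n) <= \sum_(i < n) pr mu ((D `\` F n) `&` F i).
  apply: IH => // x [Dx Fx]; have := hD x Dx.
  by rewrite big_ord_recr /= asboolF// addn0.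
have h3 : m%:R * pr mu (D `&` F n) <= pr mu (D `&` F n) + (m.-1)%:R * pr mu (D `&` F n).
  case: m {hD h1 h2} => [|m] /=; first by rewrite mul0r addr_ge0 ?mulr_ge0 ?pr_ge0.
  by rewrite -natr1 mulrDl mul1r addrC.
rewrite big_ord_recr /= {1}(pr_split mu mD (mF n)) mulrDr.
have -> : \sum_(i < n) pr mu (D `&` F i) =
    \sum_(i < n) pr mu (D `&` F n `&` F i) + \sum_(i < n) pr mu ((D `\` F n) `&` F i).
  rewrite -big_split /=; apply: eq_bigr => i _.
  rewrite (pr_split mu (measurableI _ _ mD (mF i)) (mF n)) setIAC; congr (_ + pr mu _).
  by apply/seteqP; split => x [[? ?] ?].
lra.
Qed.

Lemma exists_small_power {R : realType} (A x e : R) : 0 < x -> x < 1 -> 0 < e ->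
  exists l, A * x ^+ l <= e.
Proof.
move=> x0 x1 e0.
have h : A * x ^+ n @[n --> \oo] --> A * 0.
  by apply: cvgMr; apply: cvg_expr; rewrite gtr0_norm.
rewrite mulr0 in h; have /cvgrPdist_le /(_ _ e0) [l _ hl] := h.
exists l; have := hl l (leqnn l); rewrite /= sub0r normrN => hl'.
by apply: le_trans hl'; exact: ler_norm.
Qed.

(** * Good records keep appearing *)

Section GoodRecords.
Variables (R : realType) (q rho pb pc vstar : R) (Px : int -> probability Wt R).
Variable mu : probability (conf R) R.
Hypothesis q01 : 0 < q < 1.
Hypothesis hPx : forall x, lazy_walk_law q x (Px x).
Hypothesis rho0 : 0 < rho.
Hypotheses (pb_gt0 : 0 < pb <= 1) (pc_gt0 : 0 < pc <= 1) (vs01 : 0 < vstar < 1).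
Let pb01 : 0 <= pb <= 1.
Proof. by have /andP[h ->] := pb_gt0; rewrite ltW. Qed.
Let pc01 : 0 <= pc <= 1.
Proof. by have /andP[h ->] := pc_gt0; rewrite ltW. Qed.
Let vb := vstar / 3.
Let vb01 : 0 < vb <= 1 / 3.
Proof. by have /andP[v0 v1] := vs01; rewrite /vb; apply/andP; split; lra. Qed.
Notation env := (conf R).
Implicit Types c : env.
Notation level := (level vb).
Notation cY := (cY pb pc).
Notation cR := (cR pb pc vb).
Notation pr := (pr mu).
Notation av := (av rho Px).
Notation slow_walk := (slow_walk pb pc vstar).
Hypothesis mu_basic : forall D ys b, measurable D -> uniq ys -> (forall y, 0 <= b y <= 1) ->
  mu (basic D ys b) = (av D * \prod_(y <- ys) b y)%:E.
Hypothesis ballistic : forall e : R, 0 < e -> exists L, pr (slow_walk L) <= e.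

Definition good_record (l k : nat) : set env :=
  [set c | if cR c k is Some r then ~ old_at pb pc vb l r c else False].

Lemma measurable_good_record l k : measurable (good_record l k).
Proof.
rewrite /good_record; to_mpred.
apply: (mpred_on_cR vb pb01 pc01 k (Q := fun r c => ~ old_at pb pc vb l r c)) => r.
by apply: mpred_not; exact: mpred_old_at.
Qed.

(** As [vstar = 3 * vb], the level at time [n] is at least [2 * vb * n - L], and [C] is chosen so
    that this exceeds [k] at time [C * (k + L)]. *)
Lemma fast_walk_record C L c k : 1 <= 2 * vb * C%:R -> ~ slow_walk L c ->
  exists2 r, cR c k = Some r & (r <= C * (k + L))%N.
Proof.
move=> hC hL; pose n := (C * (k + L))%N.
pose P m : Prop := (1 - vb) * k%:R <= level (cY c (0, 0) m).
have /andP[v0 v1] := vb01.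
have Pn : P n.
  rewrite /P level_cY.
  have : n%:R * vstar - L%:R <= (cY c (0, 0) n).1%:~R.
    by rewrite leNgt; apply/negP => h; apply: hL; exists n.
  have -> : vstar = 3 * vb by rewrite /vb; field.
  have h1 : k%:R + L%:R <= 2 * vb * n%:R.
    rewrite /n natrM mulrA -natrD -{1}[(k + L)%:R]mul1r.
    by apply: ler_wpM2r.
  have h2 : 0 <= vb * k%:R by rewrite mulr_ge0// ltW.
  lra.
have [m Pm hm] := exists_first Pn.
exists m; last by rewrite leqNgt; apply/negP => /hm.
by apply/cR_some; split => // i /hm /negP; rewrite -ltNge.
Qed.

(** When no record from [k0] on is good, each slow one is bad; counting slow records then makes at
    least half of the first [n] bad. *)
Lemma many_bad_records C L l k0 n c : (0 < C)%N -> 1 <= 2 * vb * C%:R -> ~ slow_walk L c ->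
  (forall k, (k0 <= k)%N -> ~ good_record l k c) -> (L + 4 * k0 <= n)%N ->
  (n <= 2 * \sum_(i < n) `[< bad_record pb pc vb (4 * C) l i.+1 c >])%N.
Proof.
move=> C0 hC hL hg hn.
have hR k := fast_walk_record k hC hL.
pose r k := odflt 0%N (cR c k).
have er k : cR c k = Some (r k) by rewrite /r; have [s -> _] := hR k.
have r_mono k : (r k <= r k.+1)%N.
  by have [s sr] := cR_mono vb01 (leqnSn k) (er k.+1); rewrite er => -[->].
pose slow k := all (fun j => r k <= r j + 4 * C * (k - j))%N (iota 0 k.+1).
have hS : (4 * C * n <= r n + 4 * C * \sum_(i < n) slow i.+1)%N.
  exact: (@slow_count r (4 * C) n r_mono n (leqnn n)).
have slow_bad k : (k0 <= k)%N -> slow k -> bad_record pb pc vb (4 * C) l k c.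
  move=> kk /allP h; rewrite /bad_record /= er; split.
    by move=> j rj jk; rewrite er => -[<-]; apply: h; rewrite mem_iota.
  by have := hg _ kk; rewrite /good_record /= er => /contrapT.
apply: (@bad_count_arith C n L k0 _ _ (r n)) hS _ hn => //.
  by have [s e] := hR n; rewrite er in e; case: e => <-.
rewrite (bigID (fun i : 'I_n => (i.+1 < k0)%N)) [leqLHS]addnC /=; apply: leq_add.
  rewrite [leqRHS](bigID (fun i : 'I_n => ~~ (i.+1 < k0)%N)) /=.
  apply: leq_trans (leq_addr _ _); apply: leq_sum => i; rewrite -leqNgt => ik.
  by case: (boolP (slow i.+1)) => // /(slow_bad _ ik) h; rewrite asboolT.
apply: leq_trans (count_below n k0).
by apply: leq_sum => i _; exact: leq_b1.
Qed.

(** The order of quantifiers matters: [l] is fixed before [k0], so that [k0] may later be pushed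
    beyond any finite part of the past. *)
Lemma pr_no_good_record (e : R) : 0 < e -> exists l, forall k0,
  pr [set c | forall k, (k0 <= k)%N -> ~ good_record l k c] <= e.
Proof.
move=> e0; have /andP[v0 v1] := vb01.
have [L hL] : exists L, pr (slow_walk L) <= e / 2 by apply: ballistic; lra.
have [K [x [K0 x0 x1 hbad]]] := pr_bad_record q01 hPx rho0 pb01 pc01 vb01 mu_basic.
pose C := (Num.truncn (1 / (2 * vb))).+1.
have hC : 1 <= 2 * vb * C%:R.
  have := truncnS_gt (1 / (2 * vb)); rewrite -/C => h.
  have v2 : 0 < 2 * vb by lra.
  by rewrite -ler_pdivrMl// mulrC ltW.
pose M := (4 * C)%N.
(* Each record is bad with probability at most [e / 4]; since at least half of them would have to be
   bad, Markov's inequality doubles this to [e / 2]. *)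
have [l hl] : exists l, M.+1%:R * K * x ^+ l <= e / 4 by apply: exists_small_power => //; lra.
exists l => k0; set E := [set c | _].
have mE : measurable E.
  rewrite /E; to_mpred; apply: mpred_all => k; apply: mpred_imp; first exact: mpred_const.
  by apply: mpred_not; exact: measurable_good_record.
have mSW := measurable_slow_walk vstar pb_gt0 pc_gt0 L.
pose n := (L + 4 * k0).+1.
pose F i := bad_record pb pc vb M l i.+1.
have mF i : measurable (F i) by exact: measurable_bad_record.
have mD : measurable (E `\` slow_walk L) by exact: measurableD.
have h1 : pr (E `\` slow_walk L) <= e / 2.
  have hm c : (E `\` slow_walk L) c -> (n <= 2 * \sum_(i < n) `[< F i c >])%N.
    move=> [hE hS]; apply: (@many_bad_records C L l k0 n c isT hC hS hE); exact: leqnSn.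
  have hu c : (E `\` slow_walk L) c -> (uphalf n <= \sum_(i < n) `[< F i c >])%N.
    by move=> /hm; move: (\sum_(i < n) _)%N => s; rewrite leq_uphalf_double -mul2n.
  have h := @multiplicity_bound _ _ _ mu n F mF (uphalf n) _ mD hu.
  have h2 : \sum_(i < n) pr ((E `\` slow_walk L) `&` F i) <= n%:R * (e / 4).
    rewrite -[n in leRHS]card_ord -sum1_card natr_sum mulr_suml.
    apply: ler_sum => i _; rewrite mul1r; apply: le_trans hl.
    apply: le_trans _ (hbad M l i.+1).
    by apply: le_pr; [exact: measurableI|exact: mF|exact: subIsetr].
  have h3 : n%:R <= 2 * (uphalf n)%:R :> R.
    by rewrite -natrM ler_nat mul2n -leq_uphalf_double.
  have n0 : 0 < n%:R :> R by rewrite ltr0n.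
  have p0 := pr_ge0 mu (E `\` slow_walk L).
  have h4 : n%:R * pr (E `\` slow_walk L) <= 2 * (uphalf n)%:R * pr (E `\` slow_walk L).
    exact: ler_wpM2r.
  rewrite -(ler_pM2l n0); move: h h2 h4; rewrite -mulrA; lra.
rewrite (pr_split mu mE mSW); have : pr (E `&` slow_walk L) <= e / 2.
  by apply: (le_trans _ hL); apply: le_pr; [exact: measurableI|exact: mSW|exact: subIsetr].
lra.
Qed.

End GoodRecords.

(** * Almost sure existence of a renewal *)

Section RecordTrials.
Variables (R : realType) (pb pc vstar : R).
Let vb := vstar / 3.
Hypotheses (pb_gt0 : 0 < pb <= 1) (pc_gt0 : 0 < pc <= 1) (vs01 : 0 < vstar < 1).
Let vb01 : 0 < vb <= 1 / 3.
Proof. by have /andP[v0 v1] := vs01; rewrite /vb; apply/andP; split; lra. Qed.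
Let pb01 : 0 <= pb <= 1.
Proof. by have /andP[h ->] := pb_gt0; rewrite ltW. Qed.
Let pc01 : 0 <= pc <= 1.
Proof. by have /andP[h ->] := pc_gt0; rewrite ltW. Qed.
Notation env := (conf R).
Implicit Types c : env.
Notation HC y := (HC vb y).
Notation HR y := (HR vb y).
Notation level := (level vb).
Notation cY := (cY pb pc).
Notation cR := (cR pb pc vb).
Notation cno := (cno vb).
Notation renewal := (renewal pb pc vb).
Notation cZ := (cZ pb pc vb).
Notation forced := (forced pb pc).
Notation record_pos := (record_pos pb pc vb).
Notation good_record := (good_record pb pc vstar).

Lemma cR_transfer c c' k r : (forall i, (i <= r)%N -> cY c' (0, 0) i = cY c (0, 0) i) ->
  cR c k = Some r -> forall j, (j <= k)%N -> cR c' j = cR c j.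
Proof.
move=> hp hk j jk; have [r' r'r e] := cR_mono vb01 jk hk.
by rewrite e; exact: cR_prefix hp r'r e.
Qed.

(* A version of [failures J] decided by the walk up to time [t]; it increases to [failures J]
   as [t] grows. *)
Definition seen_failures (J t : nat) : set env :=
  [set c | forall j, (1 <= j <= J)%N -> if cR c j is Some r then
     ~ (cno c (cY c (0, 0) r) /\ forall i, (r <= i <= t)%N ->
         cone vb (cY c (0, 0) r) (cY c (0, 0) i)) else True].

Definition failures (J : nat) : set env :=
  [set c | forall j, (1 <= j <= J)%N -> if cR c j is Some r then
     ~ renewal c (cY c (0, 0) r) else True].

Definition never_renews : set env := [set c | cZ c = None].

Lemma never_renewsP c : never_renews c <-> forall J, failures J c.
Proof.
rewrite /never_renews /= cZ_none; split => [h J j /andP[j1 jJ]|h k r k1 e].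
  by case e : (cR c j) => [r|//]; exact: h j1 e.
by have := h k k; rewrite k1 leqnn e => /(_ isT).
Qed.

Lemma failuresS J J' : (J <= J')%N -> failures J' `<=` failures J.
Proof. by move=> JJ c h j /andP[j1 jJ]; apply: h; rewrite j1 (leq_trans jJ). Qed.

Lemma seen_failures_sub J t : seen_failures J t `<=` failures J.
Proof.
move=> c h j hj; have := h j hj; case: (cR c j) => [r|//] hn [h1 h2]; apply: hn.
split => // i /andP[ri it]; have := h2 (i - r)%N.
by rewrite -cY_add subnKC.
Qed.

Lemma seen_failuresS J t t' : (t <= t')%N -> seen_failures J t `<=` seen_failures J t'.
Proof.
move=> tt c h j hj; have := h j hj; case: (cR c j) => [r|//] hn [h1 h2]; apply: hn.
by split => // i /andP[ri it]; apply: h2; rewrite ri (leq_trans it).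
Qed.

Lemma failures_seen J c : failures J c -> exists t, seen_failures J t c.
Proof.
elim: J => [|J IH] h; first by exists 0%N => j; rewrite leqn0 => /andP[+ /eqP e]; rewrite e.
have [t ht] := IH (failuresS (leqnSn J) h).
suff [t' ht'] : exists t', if cR c J.+1 is Some r then
     ~ (cno c (cY c (0, 0) r) /\ forall i, (r <= i <= t')%N ->
         cone vb (cY c (0, 0) r) (cY c (0, 0) i)) else True.
  exists (maxn t t') => j /andP[j1]; rewrite leq_eqVlt => /orP[/eqP ->|].
    move: ht'; case: (cR c J.+1) => [r|//] hn [h1 h2]; apply: hn; split => // i /andP[ri it].
    by apply: h2; rewrite ri (leq_trans it)// leq_maxr.
  rewrite ltnS => jJ; apply: (seen_failuresS (leq_maxl t t') ht).
  by rewrite j1.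
have := h J.+1; rewrite leqnn /= => /(_ isT).
case: (cR c J.+1) => [r|_]; last by exists 0%N.
move=> hn; have [hno|hno] := pselect (cno c (cY c (0, 0) r)); last by exists 0%N => -[].
have : ~ cA pb pc vb c (cY c (0, 0) r) by move=> hA; exact: hn.
move=> /existsNP[i hi]; exists (r + i)%N => -[_ h2]; apply: hi.
by rewrite -cY_add; apply: h2; rewrite leq_addr leqnn.
Qed.

Definition first_good (l k0 k : nat) : set env :=
  [set c | good_record l k c /\ forall j, (k0 <= j < k)%N -> ~ good_record l j c].

Definition trial_at (J t l k0 k : nat) (y : pt) : set env :=
  seen_failures J t `&` first_good l k0 k `&` [set c | record_pos k c = Some y].

(** [J <= k] places the failed records before record [k], and [t <= k <= R_k] does so for the
    observed stretch of the walk. Trajectories that cross or are old at these records meet the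
    backward cone of [y]. *)
Lemma dep_trial_at J t l k0 k y : (J <= k)%N -> (t <= k)%N ->
  dep (HR y) (rcone vb y) (trial_at J t l k0 k y).
Proof.
move=> Jk tk c c' ha [[hE [hg hng]] hpos].
have /record_posP[r hr ey] := hpos.
have hp : forall i, (i <= r)%N -> cY c' (0, 0) i = cY c (0, 0) i.
  by apply: (past_path_agree vb01 hr); rewrite -ey.
have hR := cR_transfer hp hr.
have hle j rj : (j <= k)%N -> cR c j = Some rj -> (rj <= r)%N.
  by move=> jk e; have [r' r'r] := cR_mono vb01 jk hr; rewrite e => -[->].
have hsub j rj : (j <= k)%N -> cR c j = Some rj -> HR (cY c (0, 0) rj) `<=` HR y.
  by move=> jk e; apply: hitS; apply: rcone_sub => //; rewrite ey; exact: (cR_cone vb01 jk e hr).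
have hold j : (j <= k)%N -> good_record l j c <-> good_record l j c'.
  move=> jk; rewrite /good_record /= hR//; case e : (cR c j) => [rj|//].
  have hY : cY c' (0, 0) rj = cY c (0, 0) rj by apply: hp; exact: hle jk e.
  rewrite /old_at hY; split => hn [w cw [h1 h2]]; apply: hn; exists w => //;
    by apply/ha.1 => //; exact: (hsub j rj).
split; [split; [|split]|].
- move=> j /andP[j1 jJ]; have jk := leq_trans jJ Jk; rewrite hR//.
  have := hE j; rewrite j1 jJ => /(_ isT); case e : (cR c j) => [rj|//] hn [h1 h2].
  have hY : cY c' (0, 0) rj = cY c (0, 0) rj by apply: hp; exact: hle jk e.
  apply: hn; split.
    move=> w cw hw; rewrite hY in h1; apply: (h1 w) => //; apply/ha.1 => //.
    by apply: (hsub j rj) => //; move: hw => [].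
  move=> i /andP[ri it]; have := h2 i; rewrite ri it hY hp; first exact.
  by apply: leq_trans it _; apply: leq_trans tk _; exact: cR_ge hr.
- exact/hold.
- by move=> j /andP[j1 jk] /hold h; apply: (hng j); [rewrite j1|apply: h; exact: ltnW].
- exact: dep_record_pos ha hpos.
Qed.

(** Trajectories meeting the backward cone of [y] are erased, so the event is independent of the
    past of [y]. At a good record none of them reaches the cone of [diag y l], and a success there
    is a true renewal. *)
Definition success (l : nat) (y : pt) : set env :=
  [set c | forced y l c /\ renewal (crestrict (~` HR y) (cone vb y) c) (diag y l)].

Lemma crestrict_agree A B c c' : agree A B c c' -> crestrict A B c = crestrict A B c'.
Proof.
move=> [h1 h2]; congr (_, _).
  by apply/seteqP; split => w [cw Aw]; split => //; apply/h1.
by apply/funext => y; case: ifP => // /set_mem; exact: h2.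
Qed.

Lemma dep_success l y : dep (~` HR y) (cone vb y) (success l y).
Proof.
move=> c c' ha [h1 h2]; split; last by rewrite -(crestrict_agree ha).
by move=> i il; rewrite -ha.2; [exact: h1|exact: (cone_diag vb01)].
Qed.

Lemma success_of_renewal l y : forced y l `&` [set c | renewal c (diag y l)] `<=` success l y.
Proof.
move=> c [hf hr]; split => //; apply: renewal_agree (hr); split => [w hw|z hz] /=.
  split => [cw|[]//]; split => // hy; apply: (hr.1 w cw); split => //.
  by apply: hitS hy; apply: rcone_sub => //; exact: cone_diag.
by rewrite mem_set//; apply: (cone_sub vb01) hz; exact: cone_diag.
Qed.

(** A diagonal step gains exactly one unit of level and the overshoot at record [k] is less than a
    unit, so each forced step produces exactly the next record. *)
Lemma record_after_diag c k r l : cR c k = Some r ->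
  (forall i, (i <= l)%N -> cY c (cY c (0, 0) r) i = diag (cY c (0, 0) r) i) ->
  cR c (k + l) = Some (r + l)%N.
Proof.
have /andP[v0 v1] := vb01.
move=> hr hd; have hl := cR_level_lt vb01 hr.
move/cR_some : (hr) => [h1 h2]; apply/cR_some; split.
  by rewrite cY_add hd// level_diag natrD mulrDr lerD2r.
move=> m; have [mr _|rm] := ltnP m r.
  apply: lt_le_trans (h2 m mr) _; rewrite ler_wpM2l//; first by lra.
  by rewrite ler_nat leq_addr.
rewrite -(subnKC rm) ltn_add2l => ml; rewrite cY_add hd 1?ltnW// level_diag.
apply: (@lt_le_trans _ _ ((1 - vb) * k.+1%:R + (1 - vb) * (m - r)%:R)); first by rewrite ltrD2r.
rewrite -mulrDr -natrD; apply: ler_wpM2l; first by lra.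
by rewrite ler_nat addSn -addnS leq_add2l.
Qed.

Lemma trial_success J t l k0 k y : (1 <= k)%N ->
  trial_at J t l k0 k y `&` success l y `<=` ~` never_renews.
Proof.
move=> k1 c [[[_ [hg _]] /record_posP[r hr ey]] [hf hren]] hn.
have hd i : (i <= l)%N -> cY c y i = diag y i by exact: forced_cY.
have hR : cR c (k + l) = Some (r + l)%N.
  by apply: record_after_diag => // i il; rewrite -ey; exact: hd.
move: hn; rewrite /never_renews /= cZ_none => /(_ _ _ _ hR); apply.
  by apply: leq_trans k1 _; rewrite leq_addr.
rewrite cY_add -ey hd//; apply: renewal_agree hren; split => [w hw|z hz] /=.
  split => [[]//|cw]; split => // hy; move: hg; rewrite /good_record /= hr; apply.
  by exists w => //; rewrite -ey.
by rewrite mem_set//; apply: (cone_sub vb01) hz; exact: (cone_diag vb01).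
Qed.

Lemma measurable_failures J : measurable (failures J).
Proof.
rewrite /failures; to_mpred; apply: mpred_all => j; apply: mpred_imp; first exact: mpred_const.
apply: (mpred_on_cR vb pb01 pc01 j (Q := fun r c => ~ renewal c (cY c (0, 0) r))) => r.
apply: mpred_not; apply: (mpred_on_cY pb01 pc01 (0, 0) r (Q := fun y c => renewal c y)) => y.
exact: mpred_renewal.
Qed.

Lemma measurable_seen_failures J t : measurable (seen_failures J t).
Proof.
rewrite /seen_failures; to_mpred; apply: mpred_all => j; apply: mpred_imp; first exact: mpred_const.
apply: (mpred_on_cR vb pb01 pc01 j (Q := fun r c => ~ (cno c (cY c (0, 0) r) /\
  forall i, (r <= i <= t)%N -> cone vb (cY c (0, 0) r) (cY c (0, 0) i)))) => r.
apply: mpred_not; apply: (mpred_on_cY pb01 pc01 (0, 0) r (Q := fun y c => cno c y /\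
  forall i, (r <= i <= t)%N -> cone vb y (cY c (0, 0) i))) => y.
apply: mpred_and; first exact: mpred_cno.
apply: mpred_all => i; apply: mpred_imp; first exact: mpred_const.
apply: (mpred_on_cY pb01 pc01 (0, 0) i (Q := fun z _ => cone vb y z)) => z; exact: mpred_const.
Qed.

Lemma measurable_never_renews : measurable never_renews.
Proof. exact: discrete_mfun_cZ. Qed.

Lemma measurable_first_good l k0 k : measurable (first_good l k0 k).
Proof.
rewrite /first_good; to_mpred; apply: mpred_and; first exact: measurable_good_record.
apply: mpred_all => j; apply: mpred_imp; first exact: mpred_const.
by apply: mpred_not; exact: measurable_good_record.
Qed.

Lemma measurable_success l y : measurable (success l y).
Proof.
rewrite /success; to_mpred; apply: mpred_and; first exact: measurable_forced.
have mA : measurable (~` HR y) by apply: measurableC; exact: measurable_hit.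
have mr : mpred (fun c : env => renewal c (diag y l)) by exact: mpred_renewal.
exact: (mpred_preimage (measurable_crestrict (cone vb y) mA) mr).
Qed.

End RecordTrials.

Lemma pr_vanishing {R : realType} {d} {T : measurableType d} (mu : probability T R)
  (G : nat -> set T) (e : R) : (forall n, measurable (G n)) ->
  (forall n, G n.+1 `<=` G n) -> \bigcap_n G n = set0 -> 0 < e ->
  exists n, pr mu (G n) <= e.
Proof.
move=> mG dG G0 e0.
have h : mu (G n) @[n --> \oo] --> mu (\bigcap_n G n).
  apply: nonincreasing_cvg_mu => //.
  - by apply: le_lt_trans (probability_le1 mu (mG 0%N)) (ltry 1).
  - by apply: bigcapT_measurable.
  - by apply/nonincreasing_seqP => n; apply/subsetPset; exact: dG.
rewrite G0 measure0 in h.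
have /fine_cvgP [_ /cvgrPdist_le /(_ _ e0) [n _ hn]] := h.
exists n; have := hn n (leqnn n); rewrite /= sub0r normrN => h'.
by apply: le_trans h'; exact: ler_norm.
Qed.

Section AlmostSureRenewal.
Variables (R : realType) (q rho pb pc vstar : R) (Px : int -> probability Wt R).
Variable mu : probability (conf R) R.
Hypothesis q01 : 0 < q < 1.
Hypothesis hPx : forall x, lazy_walk_law q x (Px x).
Hypothesis rho0 : 0 < rho.
Hypotheses (pb_gt0 : 0 < pb <= 1) (pc_gt0 : 0 < pc <= 1) (vs01 : 0 < vstar < 1).
Let vb := vstar / 3.
Let vb01 : 0 < vb <= 1 / 3.
Proof. by have /andP[v0 v1] := vs01; rewrite /vb; apply/andP; split; lra. Qed.
Let pb01 : 0 <= pb <= 1.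
Proof. by have /andP[h ->] := pb_gt0; rewrite ltW. Qed.
Let pc01 : 0 <= pc <= 1.
Proof. by have /andP[h ->] := pc_gt0; rewrite ltW. Qed.
Notation env := (conf R).
Implicit Types c : env.
Notation HC y := (HC vb y).
Notation HR y := (HR vb y).
Notation pr := (pr mu).
Notation av := (av rho Px).
Notation renewal := (renewal pb pc vb).
Notation slow_walk := (slow_walk pb pc vstar).
Notation good_record := (good_record pb pc vstar).
Notation first_good := (first_good pb pc vstar).
Notation record_pos := (record_pos pb pc vb).
Notation failures := (failures pb pc vstar).
Notation seen_failures := (seen_failures pb pc vstar).
Notation never_renews := (never_renews pb pc vstar).
Notation success := (success pb pc vstar).
Notation trial_at := (trial_at pb pc vstar).
Hypothesis mu_basic : forall D ys b, measurable D -> uniq ys -> (forall y, 0 <= b y <= 1) ->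
  mu (basic D ys b) = (av D * \prod_(y <- ys) b y)%:E.
Hypothesis ballistic : forall e : R, 0 < e -> exists L, pr (slow_walk L) <= e.

Definition success_prob (l : nat) : R := pmin pb pc ^+ l * pr [set c | renewal c (0, 0)].

Lemma success_prob_gt0 l : 0 < success_prob l.
Proof.
rewrite /success_prob mulr_gt0//; last first.
  exact: (pr_renewal_gt0 q01 hPx rho0 pb_gt0 pc_gt0 vs01 mu_basic ballistic).
by rewrite exprn_gt0//; have /andP[] := pmin01 pb_gt0 pc_gt0.
Qed.

Lemma pr_renewal y : pr [set c | renewal c y] = pr [set c | renewal c (0, 0)].
Proof.
have mB : measurable [set c : env | renewal c (0, 0)] by exact: mpred_renewal.
rewrite -(pr_cshift q01 hPx mu_basic y mB); congr pr.
by apply/seteqP; split => c /=; rewrite (renewal_cshift0 _ _ vb01).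
Qed.

Lemma pr_success l y : success_prob l <= pr (success l y).
Proof.
have mB : measurable [set c : env | renewal c (diag y l)] by exact: mpred_renewal.
have mF := measurable_forced pb_gt0 pc_gt0 y l.
have -> : success_prob l = pr (forced pb pc y l `&` [set c | renewal c (diag y l)]).
  rewrite (pr_independence rho0 mu_basic (A1 := set0) (B1 := diag_sites y l)
    (A2 := HC (diag y l)) (B2 := cone vb (diag y l))) //.
  - by rewrite (pr_forced rho0 pb_gt0 pc_gt0 mu_basic) pr_renewal.
  - exact: measurable_hit.
  - by rewrite set0I.
  - apply/seteqP; split => // z [[i il ->]] /(coneP vb01)[+ _].
    by rewrite /diag /= lerD2l lez_nat leqNgt il.
  - exact: dep_forced.
  - by move=> c c' ha; exact: renewal_agree.
apply: le_pr; [exact: measurableI|exact: measurable_success|].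
exact: success_of_renewal.
Qed.

Lemma measurable_trial_at J t l k0 k y : measurable (trial_at J t l k0 k y).
Proof.
apply: measurableI; last exact: discrete_mfun_record_pos.
apply: measurableI; first exact: measurable_seen_failures.
exact: measurable_first_good.
Qed.

Lemma pr_trial_fails J t l k0 k y : (1 <= k)%N -> (J <= k)%N -> (t <= k)%N ->
  pr (trial_at J t l k0 k y `&` never_renews) <= (1 - success_prob l) * pr (trial_at J t l k0 k y).
Proof.
move=> k1 Jk tk; set C := trial_at _ _ _ _ _ _.
have mC : measurable C by exact: measurable_trial_at.
have mS : measurable (success l y) by exact: measurable_success.
have mN : measurable never_renews by exact: measurable_never_renews.
have h1 : pr (C `&` success l y) = pr C * pr (success l y).
  apply: (pr_independence rho0 mu_basic (A1 := HR y) (B1 := rcone vb y)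
    (A2 := ~` HR y) (B2 := cone vb y)) => //.
  - exact: measurable_hit.
  - by apply: measurableC; exact: measurable_hit.
  - by rewrite setICr.
  - exact: rcone_cone_disjoint.
  - exact: dep_trial_at.
  - exact: dep_success.
have h2 : pr (C `&` never_renews) <= pr (C `\` success l y).
  apply: le_pr; [exact: measurableI|exact: measurableD|].
  move=> c [hC hN]; split => // hS.
  exact: (trial_success vs01 k1 (conj hC hS) hN).
have h3 := pr_split mu mC mS.
have h4 : pr C * success_prob l <= pr C * pr (success l y).
  by apply: ler_wpM2l; [exact: pr_ge0|exact: pr_success].
lra.
Qed.

Definition first_good_index (l k0 : nat) c : option nat :=
  first_hit (fun k => (k0 <= k)%N /\ good_record l k c).

Definition first_good_pos (l k0 : nat) c : option (nat * pt) :=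
  if first_good_index l k0 c is Some k then omap (pair k) (record_pos k c) else None.

Lemma discrete_mfun_first_good_pos l k0 : discrete_mfun (first_good_pos l k0).
Proof.
apply: (@discrete_mfun_bind _ _ _ _ (first_good_index l k0)
  (fun o c => if o is Some k then omap (pair k) (record_pos k c) else None)).
  apply: discrete_mfun_first_hit => n; apply: mpred_and; first exact: mpred_const.
  exact: measurable_good_record.
case=> [k|]; last exact: discrete_mfun_const.
exact: (discrete_mfun_comp (omap (pair k)) (discrete_mfun_record_pos vb pb01 pc01 k)).
Qed.

Lemma first_good_posP l k0 c k y : first_good_pos l k0 c = Some (k, y) <->
  [/\ (k0 <= k)%N, first_good l k0 k c & record_pos k c = Some y].
Proof.
rewrite /first_good_pos /first_good_index; split.
  case e : (first_hit _) => [k'|//].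
  case e' : (record_pos k' c) => [y'|//] [<- <-].
  move: e; rewrite first_hit_some => -[[h1 h2] h3]; split => //; split => // j /andP[kj jk] hj.
  by apply: (h3 j).
move=> [h1 [h2 h3] h4].
have -> : first_hit (fun k => (k0 <= k)%N /\ good_record l k c) = Some k.
  by apply/first_hit_some; split => // m mk [m1 m2]; apply: (h3 m) => //; rewrite m1.
by rewrite h4.
Qed.

Definition good_after (l k0 : nat) : set env :=
  [set c | exists k, (k0 <= k)%N /\ good_record l k c].

Lemma measurable_good_after l k0 : measurable (good_after l k0).
Proof.
rewrite /good_after; to_mpred; apply: mpred_ex => k; apply: mpred_and; first exact: mpred_const.
exact: measurable_good_record.
Qed.

Lemma first_good_pos_none l k0 c : good_after l k0 c -> first_good_pos l k0 c <> None.
Proof.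
move=> [k [h1 h2]]; rewrite /first_good_pos /first_good_index.
case e : (first_hit _) => [k'|]; last by move: e; rewrite first_hit_none => /(_ k); case.
move: e; rewrite first_hit_some => -[[_ hg] _].
by move: hg; rewrite /good_record /record_pos /=; case: (cR _ _ _ _ _).
Qed.

(** A strong Markov argument at the first good record from [k0] on: its index and position are
    frozen, and each frozen trial fails with the same bound. *)
Lemma pr_fails_after J t l k0 : (1 <= k0)%N -> (J <= k0)%N -> (t <= k0)%N ->
  pr (seen_failures J t `&` good_after l k0 `&` never_renews) <=
  (1 - success_prob l) * pr (seen_failures J t `&` good_after l k0).
Proof.
move=> k1 Jk tk.
have mS := measurable_seen_failures vstar pb_gt0 pc_gt0 J t.
have mN := measurable_never_renews vstar pb_gt0 pc_gt0.
have mG := measurable_good_after l k0.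
have mSG := measurableI _ _ mS mG.
have d1 : 0 <= 1 - success_prob l.
  rewrite subr_ge0 (le_trans (pr_success l (0, 0)))// pr_le1//.
  exact: measurable_success.
rewrite -lee_fin EFinM -!prE//; last exact: measurableI.
apply: (le_measure_fibers (discrete_mfun_first_good_pos l k0) (discrete_mfun_first_good_pos l k0)) => //.
  exact: measurableI.
case=> [[k y]|]; last first.
  rewrite (_ : _ `&` _ `&` _ `&` _ = set0) ?measure0 ?mule_ge0//.
  by apply/seteqP; split => // c [[[_ /first_good_pos_none h] _]].
have mT := measurable_trial_at J t l k0 k y.
have [kk|kk] := leqP k0 k; last first.
  rewrite (_ : _ `&` _ `&` _ `&` _ = set0) ?measure0 ?mule_ge0//.
  by apply/seteqP; split => // c [_ /first_good_posP[h _ _]]; rewrite leqNgt kk in h.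
have -> : seen_failures J t `&` good_after l k0 `&` [set c | first_good_pos l k0 c = Some (k, y)] =
    trial_at J t l k0 k y.
  apply/seteqP; split => c; first by move=> [[h1 _] /first_good_posP[_ h2 h3]].
  move=> [[h1 h2] h3]; split; last by apply/first_good_posP.
  by split => //; exists k; split => //; case: h2.
have -> : seen_failures J t `&` good_after l k0 `&` never_renews `&`
    [set c | first_good_pos l k0 c = Some (k, y)] = trial_at J t l k0 k y `&` never_renews.
  apply/seteqP; split => c; first by move=> [[[h1 _] hn] /first_good_posP[_ h2 h3]].
  move=> [[[h1 h2] h3] hn]; split; last by apply/first_good_posP.
  by split => //; split => //; exists k; split => //; case: h2.
rewrite [X in (_ * X)%E](prE mu mT) [leLHS](prE mu (measurableI _ _ mT mN)) -EFinM lee_fin.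
apply: pr_trial_fails; [exact: leq_trans kk|exact: leq_trans kk|exact: leq_trans kk].
Qed.

(* A 0-1 law by hand: a success has conditional probability at least [success_prob l] at each
   good record, whatever the past, and good records never stop appearing. *)
Lemma pr_never_renews : pr never_renews = 0.
Proof.
apply/eqP; rewrite eq_le pr_ge0 andbT leNgt; apply/negP => p0.
set e := pr never_renews in p0.
have [l hl] := pr_no_good_record q01 hPx rho0 pb_gt0 pc_gt0 vs01 mu_basic ballistic
  (ltac:(lra) : 0 < e / 2).
have d0 := success_prob_gt0 l; set dl := success_prob l in d0.
(* The two approximations below cost [2 * eta = dl * e / 4] in all, less than the [dl * e / 2] that
   a trial gains. *)
pose eta := dl * e / 8.
have eta0 : 0 < eta by rewrite /eta divr_gt0// mulr_gt0.
have mN := measurable_never_renews vstar pb_gt0 pc_gt0.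
have mFl J := measurable_failures vstar pb_gt0 pc_gt0 J.
have mSF J t := measurable_seen_failures vstar pb_gt0 pc_gt0 J t.
(* The event of never renewing is approximated from outside by [failures J], and that one from
   inside by [seen_failures J t], which the past of a late record decides. *)
have [J hJ] : exists J, pr (failures J `\` never_renews) <= eta.
  apply: pr_vanishing => //.
  - by move=> n; exact: measurableD.
  - by move=> n c [h1 h2]; split => //; exact: (failuresS (leqnSn n)) h1.
  - apply/seteqP; split => // c h; have [_ nn] := h 0%N I; apply: nn.
    by apply/never_renewsP => J; have [] := h J I.
have [t ht] : exists t, pr (failures J `\` seen_failures J t) <= eta.
  apply: pr_vanishing => //.
  - by move=> n; exact: measurableD.
  - move=> n c [h1 h2]; split => // h3; apply: h2; exact: (seen_failuresS (leqnSn n)) h3.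
  - apply/seteqP; split => // c h; have [hf _] := h 0%N I.
    by have [t ht] := failures_seen hf; have [_] := h t I.
(* Past both [J] and [t], so that every trial from [k0] on is independent of [seen_failures J t];
   the bound [hl] holds for this [k0] as well. *)
pose k0 := (maxn J t).+1.
have mG := measurable_good_after l k0.
have hfail := @pr_fails_after J t l k0 isT (leqW (leq_maxl _ _)) (leqW (leq_maxr _ _)).
have h1 : e / 2 <= pr (never_renews `&` good_after l k0).
  have := pr_split mu mN mG; rewrite -/e.
  have : pr (never_renews `\` good_after l k0) <= e / 2.
    apply: le_trans _ (hl k0); apply: le_pr; first exact: measurableD.
      to_mpred; apply: mpred_all => k; apply: mpred_imp; first exact: mpred_const.
      by apply: mpred_not; exact: measurable_good_record.
    by move=> c [_ hn] k kk hg; apply: hn; exists k.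
  lra.
have mNG := measurableI _ _ mN mG.
have mSG := measurableI _ _ (mSF J t) mG.
have h2 : pr (never_renews `&` good_after l k0) <=
    pr (seen_failures J t `&` good_after l k0 `&` never_renews) + eta.
  rewrite (pr_split mu mNG (mSF J t)); apply: lerD.
    apply: le_pr; [exact: measurableI|exact: measurableI|].
    by move=> c [[? ?] ?].
  apply: le_trans ht; apply: le_pr; [exact: measurableD|exact: measurableD|].
  move=> c [[h _] hn]; split => //.
  by move/never_renewsP : h.
have h3 : pr (seen_failures J t `&` good_after l k0) <= pr (never_renews `&` good_after l k0) + eta.
  rewrite (pr_split mu mSG mN); apply: lerD.
    apply: le_pr; [exact: measurableI|exact: mNG|].
    by move=> c [[? ?] ?].
  apply: le_trans hJ; apply: le_pr; [exact: measurableD|exact: measurableD|].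
  move=> c [[h _] hn]; split => //; exact: seen_failures_sub h.
have d1 : 0 <= 1 - dl.
  rewrite subr_ge0 (le_trans (pr_success l (0, 0)))// pr_le1//.
  exact: measurable_success.
set x := pr (never_renews `&` good_after l k0) in h1 h2 h3.
set y := pr (seen_failures J t `&` good_after l k0) in h3 hfail.
set z := pr (seen_failures J t `&` good_after l k0 `&` never_renews) in h2 hfail.
have h4 : (1 - dl) * y <= (1 - dl) * (x + eta) by apply: ler_wpM2l.
have h5 : dl * x <= 2 * eta.
  have : (1 - dl) * eta <= eta by rewrite ler_piMl ?(ltW eta0)//; lra.
  by move: hfail h4; rewrite -/dl; lra.
have h6 : dl * (e / 2) <= dl * x by rewrite ler_pM2l.
have e8 : 2 * eta = dl * (e / 4) by rewrite /eta; field.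
have : 0 < dl * (e / 4) by rewrite mulr_gt0//; lra.
lra.
Qed.

End AlmostSureRenewal.

(** * Law of the successive renewal blocks *)

Section ChainLaw.
Variables (R : realType) (q rho pb pc vstar : R) (Px : int -> probability Wt R).
Variable mu : probability (conf R) R.
Hypothesis q01 : 0 < q < 1.
Hypothesis hPx : forall x, lazy_walk_law q x (Px x).
Hypothesis rho0 : 0 < rho.
Hypotheses (pb_gt0 : 0 < pb <= 1) (pc_gt0 : 0 < pc <= 1) (vs01 : 0 < vstar < 1).
Let vb := vstar / 3.
Let vb01 : 0 < vb <= 1 / 3.
Proof. by have /andP[v0 v1] := vs01; rewrite /vb; apply/andP; split; lra. Qed.
Let pb01 : 0 <= pb <= 1.
Proof. by have /andP[h ->] := pb_gt0; rewrite ltW. Qed.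
Let pc01 : 0 <= pc <= 1.
Proof. by have /andP[h ->] := pc_gt0; rewrite ltW. Qed.
Let pb0 : 0 <= pb. Proof. by have /andP[] := pb01. Qed.
Let pc0 : 0 <= pc. Proof. by have /andP[] := pc01. Qed.
Notation env := (conf R).
Implicit Types c : env.
Notation HC y := (HC vb y).
Notation HR y := (HR vb y).
Notation pr := (pr mu).
Notation av := (av rho Px).
Notation renewal := (renewal pb pc vb).
Notation cZ := (cZ pb pc vb).
Notation chain := (chain pb pc vb).
Notation past_restrict := (past_restrict vb).
Notation slow_walk := (slow_walk pb pc vstar).
Hypothesis mu_basic : forall D ys b, measurable D -> uniq ys -> (forall y, 0 <= b y <= 1) ->
  mu (basic D ys b) = (av D * \prod_(y <- ys) b y)%:E.
Hypothesis ballistic : forall e : R, 0 < e -> exists L, pr (slow_walk L) <= e.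

Definition renewal0 : set env := [set c | renewal c (0, 0)].

Definition cond (z : option (nat * seq int)) : R :=
  pr ([set c | cZ c = z] `&` renewal0) / pr renewal0.

Definition chain_event zs : set env := [set c | chain zs c].

Lemma measurable_renewal0 : measurable renewal0.
Proof. exact: mpred_renewal. Qed.

Lemma measurable_chain_event zs : measurable (chain_event zs).
Proof. exact: mpred_chain. Qed.

Lemma pr_renewal0_gt0 : 0 < pr renewal0.
Proof. exact: (pr_renewal_gt0 q01 hPx rho0 pb_gt0 pc_gt0 vs01 mu_basic ballistic). Qed.

Lemma dep_past_restrict y (E : set env) :
  dep (~` HC y) (~` cone vb y) (past_restrict y @^-1` E).
Proof. by move=> c c' ha; rewrite /preimage /= /past_restrict (crestrict_agree ha). Qed.

Lemma pr_future zs y :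
  pr [set c | renewal c y /\ chain zs (cshift y c)] = pr (renewal0 `&` chain_event zs).
Proof.
have mE : measurable (renewal0 `&` chain_event zs).
  by apply: measurableI; [exact: measurable_renewal0|exact: measurable_chain_event].
rewrite -(pr_cshift q01 hPx mu_basic y mE); congr pr.
by apply/seteqP; split => c /= [h1 h2]; split => //; exact/(renewal_cshift0 _ _ vb01).
Qed.

(* Regeneration: the past event lives on trajectories missing the forward cone of [y]. *)
Lemma pr_regeneration (E : set env) zs y : measurable E ->
  pr (past_restrict y @^-1` E `&` [set c | renewal c y /\ chain zs (cshift y c)]) =
  pr (past_restrict y @^-1` E) * pr (renewal0 `&` chain_event zs).
Proof.
move=> mE; rewrite -(pr_future zs y).
have mA : measurable (~` HC y) by apply: measurableC; exact: measurable_hit.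
apply: (pr_independence rho0 mu_basic (A1 := ~` HC y) (B1 := ~` cone vb y)
  (A2 := HC y) (B2 := cone vb y)) => //.
- exact: measurable_hit.
- by rewrite setICl.
- by rewrite setICl.
- by have := measurable_crestrict (~` cone vb y) mA measurableT mE; rewrite setTI.
- to_mpred; apply: mpred_and; first exact: mpred_renewal.
  by apply: mpred_cshift; exact: mpred_chain.
- exact: dep_past_restrict.
- exact: dep_chain.
Qed.

(** Regeneration applied with [zs] and with the empty list involves the same past factor;
    eliminating it gives this identity, kept free of division. *)
Lemma pr_chain_cons t xs zs :
  pr (chain_event (Some (t, xs) :: zs)) * pr renewal0 =
  pr [set c | cZ c = Some (t, xs)] * pr (renewal0 `&` chain_event zs).
Proof.
pose y := endpoint t xs; pose E : set env := [set c | cZ c = Some (t, xs)].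
have mE : measurable E by exact: discrete_mfun_cZ.
have e zs' : chain_event (Some (t, xs) :: zs') =
    past_restrict y @^-1` E `&` [set c | renewal c y /\ chain zs' (cshift y c)].
  apply/seteqP; split => c.
    by move=> [/(cZ_someE vb01 pb0 pc0) [h1 h2] h3].
  by move=> [h1 [h2 h3]]; split => //; apply/(cZ_someE vb01 pb0 pc0).
have eE : E = chain_event [:: Some (t, xs)] by apply/seteqP; split => c /=; [|case].
rewrite -/E [in RHS]eE !e !pr_regeneration//.
have -> : renewal0 `&` chain_event [::] = renewal0 by apply/seteqP; split => c [].
by ring.
Qed.

Lemma pr_renewal_chain_cons t xs zs :
  pr (renewal0 `&` chain_event (Some (t, xs) :: zs)) * pr renewal0 =
  pr ([set c | cZ c = Some (t, xs)] `&` renewal0) * pr (renewal0 `&` chain_event zs).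
Proof.
pose y := endpoint t xs; pose E : set env := [set c | cZ c = Some (t, xs)] `&` renewal0.
have mE : measurable E by apply: measurableI; [exact: discrete_mfun_cZ|exact: measurable_renewal0].
have e zs' : renewal0 `&` chain_event (Some (t, xs) :: zs') =
    past_restrict y @^-1` E `&` [set c | renewal c y /\ chain zs' (cshift y c)].
  apply/seteqP; split => c.
    by move=> [h0 [h1 h3]]; have [[h4 h5] h6] := (cZ_someE_renewal vb01 pb0 pc0 _ _ _).1 (conj h1 h0).
  move=> [h1 [h2 h3]]; have [h4 h5] := (cZ_someE_renewal vb01 pb0 pc0 c t xs).2 (conj h1 h2).
  by split.
have eE : E = renewal0 `&` chain_event [:: Some (t, xs)].
  by apply/seteqP; split => c; [case|case => ? []].
rewrite -/E [in RHS]eE !e !pr_regeneration//.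
have -> : renewal0 `&` chain_event [::] = renewal0 by apply/seteqP; split => c [].
by ring.
Qed.

(* Only the last entry may be [None]. *)
Fixpoint extendable (zs : seq (option (nat * seq int))) : bool :=
  match zs with
  | z :: ((_ :: _) as zs') => isSome z && extendable zs'
  | _ => true
  end.

Lemma pr_renewal_chain zs : extendable zs ->
  pr (renewal0 `&` chain_event zs) = pr renewal0 * \prod_(z <- zs) cond z.
Proof.
have b0 := pr_renewal0_gt0; have bn : pr renewal0 != 0 by rewrite gt_eqF.
elim: zs => [_|z [|z' zs] IH].
- by rewrite big_nil mulr1; congr pr; apply/seteqP; split => c // [].
- move=> _; rewrite big_seq1 /cond mulrC divfK//; congr pr.
  apply/seteqP; split => c; first by move=> [h0 [h1 _]].
  by move=> [h1 h0]; split => //; case: z h1 => [[t xs]|] h1; split.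
case: z => [[t xs]|//] /= hz.
apply: (mulIf bn); rewrite pr_renewal_chain_cons IH// [in RHS]big_cons.
move: (\prod_(j <- _) _) => p; rewrite /cond; field.
exact: bn.
Qed.

Lemma pr_chain z zs : extendable (z :: zs) ->
  pr (chain_event (z :: zs)) = pr [set c | cZ c = z] * \prod_(z' <- zs) cond z'.
Proof.
have b0 := pr_renewal0_gt0; have bn : pr renewal0 != 0 by rewrite gt_eqF.
case: zs => [_|z' zs].
  rewrite big_nil mulr1; congr pr; apply/seteqP; split => c /=; [by case|].
  by case: z => [[t xs]|] h; split.
case: z => [[t xs]|//] hz.
apply: (mulIf bn); rewrite pr_chain_cons pr_renewal_chain//; ring.
Qed.

Lemma cond_none : cond None = 0.
Proof.
rewrite /cond (@pr_null_sub _ _ _ mu _ [set c | cZ c = None]) ?mul0r//.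
- by apply: measurableI; [exact: discrete_mfun_cZ|exact: measurable_renewal0].
- exact: discrete_mfun_cZ.
- exact: (pr_never_renews q01 hPx rho0 pb_gt0 pc_gt0 vs01 mu_basic ballistic).
Qed.

End ChainLaw.

(** * Renewal times as functions of the environment *)

Section RenewalTimes.
Variables (R : realType) (pb pc vb : R).
Notation env := (conf R).
Implicit Types c : env.
Notation cY := (cY pb pc).
Notation cZ := (cZ pb pc vb).
Notation ctau := (ctau pb pc vb).

(* Junk: the position stays put once a renewal time is infinite. *)
Fixpoint renewal_pos (n : nat) c : pt :=
  if n is m.+1 then
    let p := renewal_pos m c in
    if ctau (cshift p c) is Some t then cY c p t else p
  else (0, 0).

Definition renewal_time (n : nat) c : option nat :=
  if n is m.+1 then ctau (cshift (renewal_pos m c) c) else None.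

Lemma cshift_cshift y z c : cshift z (cshift y c) = cshift (ptadd z y) c.
Proof.
congr (_, _); last by apply/funext => u; rewrite /ptadd /= !addrA.
have e w : path_shift (- y.1, - y.2) (path_shift (- z.1, - z.2) w) =
    path_shift (- (ptadd z y).1, - (ptadd z y).2) w.
  apply/funext => n; rewrite /path_shift /ptadd /= !opprK addrA; congr (w _ + _ + _).
  by rewrite opprD addrA addrAC.
by apply/seteqP; split => w; rewrite /cshift /= e.
Qed.

Lemma cshift0 c : cshift (0, 0) c = c.
Proof.
case: c => S u; congr (_, _); last first.
  by apply/funext => z; rewrite /ptadd /= !addr0 -surjective_pairing.
have e w : path_shift (- 0, - 0) w = w.
  by apply/funext => n; rewrite /path_shift /= oppr0 addr0 subr0.
by apply/seteqP; split => w /=; rewrite e.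
Qed.

Lemma cZ_ctau c t xs : cZ c = Some (t, xs) -> ctau c = Some t.
Proof. by rewrite cZE; case: (ctau c) => [t'|//] [->]. Qed.

Lemma renewal_pos_next n c t xs : cZ (cshift (renewal_pos n c) c) = Some (t, xs) ->
  ptadd (endpoint t xs) (renewal_pos n c) = renewal_pos n.+1 c.
Proof.
move=> h; rewrite /= (cZ_ctau h) (cZ_endpoint h) cY_cshift.
by rewrite ptadd0.
Qed.

Lemma chain_renewal_pos zs n c : extendable zs ->
  chain pb pc vb zs (cshift (renewal_pos n c) c) <->
  forall i, (i < size zs)%N -> cZ (cshift (renewal_pos (n + i) c) c) = nth None zs i.
Proof.
elim: zs n => [//|z zs IH] n hz; split.
  move=> [h hc] [|i]; first by rewrite addn0.
  case: zs IH hz hc => [//|z' zs] IH; case: z h => [[t xs]|//] h /= hz.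
  rewrite cshift_cshift (renewal_pos_next h) => hc im.
  by rewrite addnS -addSn; exact: (IH n.+1 hz).1 hc i im.
move=> h; have h0 := h 0%N isT; rewrite addn0 /= in h0.
split => //; case: z h0 hz h => [[t xs]|//] h0 hz h.
rewrite cshift_cshift (renewal_pos_next h0).
case: zs IH hz h => [//|z' zs] IH /= hz h.
apply/(IH n.+1) => // i im; rewrite addSn -addnS.
exact: (h i.+1).
Qed.

Lemma SsumS n c : Ssum renewal_time n.+1 c = oadd (Ssum renewal_time n c) (renewal_time n.+1 c).
Proof.
have -> : Ssum renewal_time n.+1 c = foldr oadd (Some 0%N)
    ([seq renewal_time i c | i <- iota 1 n] ++ [:: renewal_time n.+1 c]).
  by rewrite /Ssum (_ : iota 1 n.+1 = iota 1 n ++ [:: n.+1]) ?map_cat// -[X in iota 1 X]addn1 iotaD add1n.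
rewrite foldr_cat /Ssum /=.
elim: [seq _ | _ <- _] => [|a s IH] /=.
  by case: (ctau _) => [t|] //=; rewrite addn0.
rewrite IH; case: a => [a|] //=; case: (foldr _ _ _) => [b|] //=.
by case: (ctau _) => [t|] //=; rewrite addnA.
Qed.

Lemma Ssum_pos n c s : Ssum renewal_time n c = Some s -> renewal_pos n c = cY c (0, 0) s.
Proof.
elim: n s => [|n IH] s; first by move=> [<-].
rewrite SsumS; case e : (Ssum _ n c) => [s'|//]; case e' : (renewal_time n.+1 c) => [t|//] [<-].
move: e' => /= ->; rewrite (IH _ e).
by rewrite cY_add.
Qed.

Lemma Zseg_cZ n c s : Ssum renewal_time n c = Some s ->
  Zseg (fun c n => (cY c (0, 0) n).1) renewal_time n c = cZ (cshift (renewal_pos n c) c).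
Proof.
move=> hs; rewrite /Zseg hs cZE.
have -> : renewal_time n.+1 c = ctau (cshift (renewal_pos n c) c) by [].
case: (ctau _) => [t|//]; congr (Some (_, _)).
apply: eq_map => i; rewrite cY_add -(Ssum_pos hs) -{1}[renewal_pos n c]ptadd0 -cY_cshift.
by rewrite /ptadd /= addrK.
Qed.

(** All prescribed values before the last are finite, hence so are the partial sums, and [Zseg] is
    then the block of the environment seen from the renewal point. Only the last value may be
    [None]. *)
Lemma Zseg_renewal_pos (z : nat -> option (nat * seq int)) N c :
  (forall i, (i < N)%N -> z i <> None) ->
  (cZ c = z 0%N /\ forall n, (1 <= n <= N)%N ->
     Zseg (fun c n => (cY c (0, 0) n).1) renewal_time n c = z n) <->
  (forall n, (n <= N)%N -> cZ (cshift (renewal_pos n c) c) = z n).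
Proof.
move=> hz.
have sums M : (M <= N)%N -> (forall n, (n < M)%N -> cZ (cshift (renewal_pos n c) c) = z n) ->
    exists s, Ssum renewal_time M c = Some s.
  elim: M => [|M IH] MN h; first by exists 0%N.
  have [s hs] := IH (ltnW MN) (fun n nM => h n (ltnW nM)).
  have := h M (ltnSn M); case e : (z M) => [[t xs]|]; last by have := hz M MN e.
  by move=> /cZ_ctau e'; exists (s + t)%N; rewrite SsumS hs /= e'.
split.
  move=> [h0 h]; elim/ltn_ind => n IH nN.
  have [s hs] := sums n nN (fun m mn => IH m mn (leq_trans (ltnW mn) nN)).
  rewrite -(Zseg_cZ hs); case: n {IH} nN hs => [|n] nN hs; last by apply: h; rewrite nN.
  by rewrite (Zseg_cZ hs) /= cshift0.
move=> h; split; first by have := h 0%N (leq0n N); rewrite /= cshift0.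
move=> n /andP[n1 nN]; have [s hs] := sums n nN (fun m mn => h m (leq_trans (ltnW mn) nN)).
by rewrite (Zseg_cZ hs); exact: h.
Qed.

Lemma extendable_map (z : nat -> option (nat * seq int)) k M :
  (forall i, (k <= i < k + M)%N -> z i <> None) -> extendable [seq z i | i <- iota k M.+1].
Proof.
elim: M k => [//|M IH] k hz.
have zk : isSome (z k) by case e : (z k) => //; case: (hz k) => //; rewrite leqnn addnS ltnS leq_addr.
have := IH k.+1; rewrite /= zk; apply => i /andP[ki iM].
by apply: hz; rewrite (ltnW ki) addnS -addSn.
Qed.

Lemma Zseg_chain (z : nat -> option (nat * seq int)) M :
  (forall i, (i < M)%N -> z i <> None) ->
  [set c | cZ c = z 0%N /\ forall n, (1 <= n <= M)%N ->
     Zseg (fun c n => (cY c (0, 0) n).1) renewal_time n c = z n] =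
  [set c | chain pb pc vb [seq z i | i <- iota 0 M.+1] c].
Proof.
move=> hz; set zs := [seq _ | _ <- _].
have hzs : extendable zs.
  by apply: extendable_map => i /andP[_]; rewrite add0n; exact: hz.
have key c : chain pb pc vb zs c <->
    forall i, (i <= M)%N -> cZ (cshift (renewal_pos i c) c) = z i.
  have := chain_renewal_pos 0 c hzs; rewrite {1}/renewal_pos cshift0 => e.
  have en i : (i < size zs)%N -> nth None zs i = z i.
    rewrite size_map size_iota => iM.
    by rewrite (nth_map 0%N) ?size_iota// nth_iota.
  have es : size zs = M.+1 by rewrite size_map size_iota.
  split; first by move=> /e h i iM; have := h i; rewrite es ltnS => /(_ iM) ->; rewrite en// es.
  by move=> h; apply/e => i iM; rewrite en// h// -ltnS -es.
by apply/seteqP; split => c h; [apply/key/(Zseg_renewal_pos _ hz)|apply/(Zseg_renewal_pos _ hz)/key].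
Qed.

Hypotheses (pb01 : 0 <= pb <= 1) (pc01 : 0 <= pc <= 1).

Lemma discrete_mfun_shifted_ctau (f : env -> pt) : discrete_mfun f -> discrete_mfun (fun c => ctau (cshift (f c) c)).
Proof.
move=> mf; apply: (@discrete_mfun_bind _ _ _ _ f (fun y c => ctau (cshift y c))) => // y k.
exact: (mpred_cshift y (discrete_mfun_ctau vb pb01 pc01 k)).
Qed.

Lemma discrete_mfun_renewal_pos n : discrete_mfun (renewal_pos n).
Proof.
elim: n => [|n IH]; first exact: discrete_mfun_const.
apply: (@discrete_mfun_bind _ _ _ _ (renewal_pos n) (fun p c =>
  if ctau (cshift p c) is Some t then cY c p t else p)) => // p.
apply: (@discrete_mfun_bind _ _ _ _ (fun c : env => ctau (cshift p c)) (fun o c =>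
  if o is Some t then cY c p t else p)).
  by apply: discrete_mfun_shifted_ctau; exact: discrete_mfun_const.
by case=> [t|]; [exact: discrete_mfun_cY|exact: discrete_mfun_const].
Qed.

Lemma discrete_mfun_renewal_time n : discrete_mfun (renewal_time n).
Proof.
case: n => [|n]; first exact: discrete_mfun_const.
by apply: discrete_mfun_shifted_ctau; exact: discrete_mfun_renewal_pos.
Qed.

Lemma discrete_mfun_Ssum n : discrete_mfun (Ssum renewal_time n).
Proof.
elim: n => [|n IH]; first exact: discrete_mfun_const.
have e : Ssum renewal_time n.+1 =
    (fun c => oadd (Ssum renewal_time n c) (renewal_time n.+1 c)).
  by apply/funext => c; exact: SsumS.
rewrite e; apply: (@discrete_mfun_bind _ _ _ _ (Ssum renewal_time n)
  (fun o c => oadd o (renewal_time n.+1 c))) => // o.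
exact: (discrete_mfun_comp (oadd o) (discrete_mfun_renewal_time n.+1)).
Qed.

Lemma discrete_mfun_Zseg n : discrete_mfun (fun c : env => Zseg (fun c n => (cY c (0, 0) n).1) renewal_time n c).
Proof.
have -> : (fun c : env => Zseg (fun c n => (cY c (0, 0) n).1) renewal_time n c) =
  (fun c => if Ssum renewal_time n c is Some s then cZ (cshift (renewal_pos n c) c) else None).
  apply/funext => c; case e : (Ssum renewal_time n c) => [s|]; first exact: Zseg_cZ e.
  by rewrite /Zseg e.
apply: (@discrete_mfun_bind _ _ _ _ (Ssum renewal_time n) (fun o c =>
  if o is Some s then cZ (cshift (renewal_pos n c) c) else None)); first exact: discrete_mfun_Ssum.
case=> [s|]; last exact: discrete_mfun_const.
apply: (@discrete_mfun_bind _ _ _ _ (renewal_pos n) (fun y c => cZ (cshift y c))).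
  exact: discrete_mfun_renewal_pos.
by move=> y z; exact: (mpred_cshift y (discrete_mfun_cZ vb pb01 pc01 z)).
Qed.

End RenewalTimes.

Lemma stretched_exponential_vanishes {R : realType} (c0 gamma e : R) :
  0 < c0 -> 1 < gamma -> 0 < e ->
  exists L : nat, (1 <= L)%N /\ c0^-1 * expR (- (c0 * ln (L%:R : R) `^ gamma)) <= e.
Proof.
move=> c00 g1 e0.
(* The maximum with 1 gives [ln L >= 1], so that raising to the power [gamma > 1] only increases it;
   the other term makes the exponential at most [e * c0]. *)
pose m := Order.max 1 (- ln (e * c0) / c0).
pose L := (Num.truncn (expR m)).+1.
exists L; split => //.
have hL : m <= ln (L%:R : R).
  rewrite -[leLHS]expRK ler_ln ?posrE ?expR_gt0 ?ltr0n//.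
  exact/ltW/truncnS_gt.
have m1 : 1 <= ln (L%:R : R) by apply: le_trans hL; rewrite /m le_max lexx.
have h1 : ln (L%:R : R) <= ln (L%:R : R) `^ gamma.
  rewrite -[leLHS]powRr1; last exact: le_trans ler01 m1.
  by apply: ler_powR => //; exact: ltW.
have h2 : - ln (e * c0) <= c0 * ln (L%:R : R) `^ gamma.
  rewrite [leRHS]mulrC -ler_pdivrMr//; apply: le_trans _ h1; apply: le_trans _ hL.
  by rewrite /m le_max lexx orbT.
have h3 : expR (- (c0 * ln (L%:R : R) `^ gamma)) <= e * c0.
  by rewrite -[leRHS]lnK ?posrE ?mulr_gt0// ler_expR; lra.
by rewrite mulrC ler_pdivrMr.
Qed.

(** * Identification with the original probability space *)

Section Transfer.
Variables (R : realType) (pb pc vstar : R).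
Context {d : measure_display} {Omega : measurableType d}.
Variables (ws : Omega -> nat -> Wt) (U : Omega -> pt -> R).
Let vb := vstar / 3.
Notation em := (envmap ws U).

Lemma Tset_cT o : Tset (ws o) = cT (em o).
Proof.
apply/seteqP; split => z /=.
  by move=> [i [n ->]]; exists (ws o i) => //; exists i.
by move=> [_ [i _ <-] e]; exists i, z.2; rewrite e -surjective_pairing.
Qed.

Lemma Yw_cY o y i : Yw pb pc ws U o y i = cY pb pc (em o) y i.
Proof. by rewrite /Yw Tset_cT. Qed.

Lemma Xw_cY o i : Xw pb pc ws U o i = (cY pb pc (em o) (0, 0) i).1.
Proof. by rewrite /Xw Yw_cY. Qed.

Lemma noCross_cno o y : noCross vstar ws o y <-> cno vb (em o) y.
Proof.
split => h; first by move=> w [i _ <-]; exact: h.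
by move=> i; apply: (h (ws o i)); exists i.
Qed.

Lemma Aev_cA o y : Aev pb pc vstar ws U o y <-> cA pb pc vb (em o) y.
Proof. by split => h i; have := h i; rewrite Yw_cY. Qed.

Lemma Rk_cR o k : Rk pb pc vstar ws U o k = cR pb pc vb (em o) k.
Proof. by apply: first_hit_ext => n; rewrite Xw_cY. Qed.

Lemma tauw_ctau o : tauw pb pc vstar ws U o = ctau pb pc vb (em o).
Proof.
have e : Iidx pb pc vstar ws U o = cI pb pc vb (em o).
  apply: first_hit_ext => k; rewrite Rk_cR; case: (cR _ _ _ _ _) => [r|//].
  by rewrite Yw_cY /renewal noCross_cno Aev_cA.
by rewrite /tauw e /ctau; case: (cI _ _ _ _) => // k; exact: Rk_cR.
Qed.

Lemma Z0_cZ o : Z0 pb pc vstar ws U o = cZ pb pc vb (em o).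
Proof.
rewrite /Z0 tauw_ctau /cZ; case: (ctau _ _ _ _) => [t|//].
by congr (Some (_, _)); apply: eq_map => s; exact: Xw_cY.
Qed.

Lemma Bangle_renewal0 : Bangle pb pc vstar ws U = em @^-1` renewal0 pb pc vstar.
Proof.
by apply/seteqP; split => o; rewrite /Bangle /renewal0 /renewal /preimage /= noCross_cno Aev_cA.
Qed.

Lemma Zseg_envmap (tau : nat -> conf R -> option nat) n o :
  Zseg (fun o => Xw pb pc ws U o) (fun n o => tau n (em o)) n o =
  Zseg (fun c n => (cY pb pc c (0, 0) n).1) tau n (em o).
Proof.
rewrite /Zseg; have -> : Ssum (fun n o => tau n (em o)) n o = Ssum tau n (em o) by [].
case: (Ssum _ _ _) => [s|//]; case: (tau n.+1 (em o)) => [t|//].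
by congr (Some (_, _)); apply: eq_map => i; rewrite !Xw_cY.
Qed.

End Transfer.

Theorem theorem4p7 (R : realType) (q pc pb rho vstar c0 gamma : R)
  (d : measure_display) (Omega : measurableType d) (P : probability Omega R)
  (Px : int -> probability Wt R) (ws : Omega -> nat -> Wt) (U : Omega -> pt -> R) :
  0 < q < 1 -> 0 <= pc <= 1 -> 0 <= pb <= 1 ->
  0 < 2 * pb - 1 -> -1 < 2 * pc - 1 -> 0 < rho ->
  (forall x, lazy_walk_law q x (Px x)) ->
  env_law P rho Px ws U ->
  0 < vstar < 2 * pb - 1 -> 0 < c0 -> 1 < gamma ->
  (forall L : nat, (1 <= L)%N ->
     (P [set o | exists n : nat,
          ((Xw pb pc ws U o n)%:~R < n%:R * vstar - L%:R)%R]
      <= (c0^-1 * expR (- (c0 * ln (L%:R : R) `^ gamma)))%R%:E)%E) ->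
  exists (d' : measure_display) (Omega' : measurableType d') (P' : probability Omega' R)
         (pi : Omega' -> Omega) (tau : nat -> Omega' -> option nat),
    (* (Omega', P') is an enlargement of (Omega, P) *)
    measurable_fun setT pi /\
    (forall A, measurable A -> P' (pi @^-1` A) = P A) /\
    (* the tau_n are random times with tau_1 = tau *)
    (forall n k, measurable [set o' | tau n o' = k]) /\
    (forall o', tau 1%N o' = tauw pb pc vstar ws U (pi o')) /\
    (* i.i.d., independent of (tau, X_[0,tau]), with law that of (tau, X_[0,tau]) under P^angle *)
    (forall (N : nat) (z : nat -> option (nat * seq int)),
       fine (P' [set o' | Z0 pb pc vstar ws U (pi o') = z 0%N /\
                  forall n, (1 <= n <= N)%N ->
                    Zseg (fun o' => Xw pb pc ws U (pi o')) tau n o' = z n])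
       = fine (P [set o | Z0 pb pc vstar ws U o = z 0%N]) *
         \prod_(1 <= n < N.+1)
            condP P (Bangle pb pc vstar ws U) [set o | Z0 pb pc vstar ws U o = z n]).

Proof.
move=> q01 pc01 pb01 vb0 vc0 rho0 hPx hlaw vs01 c00 g1 hball.
have [mu [muE mu_basic]] := env_distribution hlaw.
have mem := measurable_envmap hlaw.
set em := envmap ws U in muE mem.
have pbs : 0 < pb <= 1 by case/andP: pb01 => _ ->; rewrite andbT; lra.
have pcs : 0 < pc <= 1 by case/andP: pc01 => _ ->; rewrite andbT; lra.
have vs1 : 0 < vstar < 1.
  by case/andP: vs01 => h1 h2; rewrite h1 /=; case/andP: pb01 => h3 h4; lra.
have mpre (E : set (conf R)) : measurable E -> measurable (em @^-1` E).
  by move=> mE; have := mem measurableT _ mE; rewrite setTI.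
have prPE (E : set (conf R)) : measurable E -> fine (P (em @^-1` E)) = pr mu E.
  by move=> mE; rewrite /pr muE.
have ballistic (e : R) : 0 < e -> exists L, pr mu (slow_walk pb pc vstar L) <= e.
  move=> e0; have [L [L1 hL]] := stretched_exponential_vanishes c00 g1 e0.
  exists L; apply: le_trans hL.
  have mS := measurable_slow_walk vstar pbs pcs L.
  rewrite -lee_fin -prE// muE//; apply: le_trans (hball L L1).
  rewrite (_ : [set o | _] = em @^-1` slow_walk pb pc vstar L)//.
  apply/seteqP; split => o [n hn]; exists n; move: hn; by rewrite Xw_cY.
pose rt n := renewal_time pb pc (vstar / 3) n.
exists d, Omega, P, id, (fun n o => rt n (em o)).
have mZ z : measurable [set c : conf R | cZ pb pc (vstar / 3) c = z] by exact: discrete_mfun_cZ.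
have mB := measurable_renewal0 vstar pbs pcs.
have PZ z : fine (P [set o | Z0 pb pc vstar ws U o = z]) =
    pr mu [set c | cZ pb pc (vstar / 3) c = z].
  rewrite -prPE//; congr (fine (P _)).
  by apply/seteqP; split => o /=; rewrite Z0_cZ.
have PC z : condP P (Bangle pb pc vstar ws U) [set o | Z0 pb pc vstar ws U o = z] =
    cond pb pc vstar mu z.
  rewrite /condP /cond Bangle_renewal0 -!prPE//; last exact: measurableI.
  congr (fine (P _) / _).
  by apply/seteqP; split => o /= [h1 h2]; split => //; rewrite -?Z0_cZ// Z0_cZ.
split; first exact: measurable_id.
split=> [A _ //|].
split=> [n k|].
  exact: (mpred_preimage mem (discrete_mfun_renewal_time (vstar / 3) pb01 pc01 n k)).
split=> [w|N z].
  by rewrite tauw_ctau /rt /= cshift0.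
pose EV M : set (conf R) := [set c | cZ pb pc (vstar / 3) c = z 0%N /\ forall n, (1 <= n <= M)%N ->
     Zseg (fun c n => (cY pb pc c (0, 0) n).1) rt n c = z n].
have mEV M : measurable (EV M).
  rewrite /EV; to_mpred; apply: mpred_and; first exact: discrete_mfun_cZ.
  apply: mpred_all => n; apply: mpred_imp; first exact: mpred_const.
  exact: discrete_mfun_Zseg.
have prEV M : (forall i, (i < M)%N -> z i <> None) ->
    pr mu (EV M) = pr mu [set c | cZ pb pc (vstar / 3) c = z 0%N] *
      \prod_(z' <- [seq z i | i <- iota 1 M]) cond pb pc vstar mu z'.
  move=> hz; rewrite /EV (Zseg_chain pb pc (vstar / 3) hz).
  apply: (pr_chain q01 hPx rho0 pbs pcs vs1 mu_basic ballistic).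
  by have := @extendable_map z 0 M; apply => i /andP[_]; rewrite add0n; exact: hz.
have -> : [set o' | Z0 pb pc vstar ws U (id o') = z 0%N /\ forall n, (1 <= n <= N)%N ->
    Zseg (fun o' => Xw pb pc ws U (id o')) (fun n o => rt n (em o)) n o' = z n] = em @^-1` EV N.
  apply/seteqP; split => o /= [h1 h2]; split; rewrite -?Z0_cZ//.
    by move=> n hn; rewrite -Zseg_envmap; exact: h2.
    by rewrite Z0_cZ.
  by move=> n hn; rewrite Zseg_envmap; exact: h2.
rewrite prPE// PZ.
under eq_bigr do rewrite PC.
have -> : \prod_(1 <= n < N.+1) cond pb pc vstar mu (z n) =
    \prod_(z' <- [seq z i | i <- iota 1 N]) cond pb pc vstar mu z'.
  by rewrite big_map /index_iota subSS subn0.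
have [h|/existsNP[i0 /not_implyP[i0N /contrapT zi0]]] :=
  pselect (forall i, (i < N)%N -> z i <> None); first exact: prEV.
(* Some value before the last is [None]. Up to the first such index the product formula still
   applies and contains a zero factor, and the full event is contained in the truncated one. *)
have [i zi hi] := @exists_first (fun i => z i = None) i0 zi0.
have iN : (i <= N)%N.
  apply: leq_trans (ltnW i0N); rewrite leqNgt; apply/negP => /hi; exact.
have zero M : (i <= M)%N -> pr mu [set c | cZ pb pc (vstar / 3) c = z 0%N] *
    \prod_(z' <- [seq z i | i <- iota 1 M]) cond pb pc vstar mu z' = 0.
  (* At index 0 the zero factor is the probability of an infinite tau; at a later index it is its
     conditional version [cond None]. *)
  case: i zi {hi iN} => [|i] zi iM.
    have := pr_never_renews q01 hPx rho0 pbs pcs vs1 mu_basic ballistic.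
    by rewrite /never_renews zi => ->; rewrite mul0r.
  apply/eqP; rewrite mulf_eq0; apply/orP; right.
  rewrite prodf_seq_eq0; apply/hasP; exists (z i.+1).
    by apply: map_f; rewrite mem_iota add1n.
  by rewrite zi /= (cond_none q01 hPx rho0 pbs pcs vs1 mu_basic ballistic).
rewrite zero//; apply: (@pr_null_sub _ _ _ mu _ (EV i)) => //.
  move=> c [h1 h2]; split => // n /andP[n1 ni]; apply: h2.
  by rewrite n1 (leq_trans ni).
by rewrite prEV// zero.
Qed.
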